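(* Let $d\ge1$ and $0\le r\le a<1$, let $\omega$ be a finite nonnegative measure on $\mathbb{R}^d$, and let $Q_{a,r}:=\mathcal{L}_r(\psi_a*\omega)$. Consider a distributional free-boundary ansatz $(\Omega,F)$ ($\Omega\subset\mathbb{R}^d$ open, $S:=\mathbb{R}^d\setminus\Omega$) satisfying the admissibility hypotheses (see context) whenever the candidate measure $$\phi:=Q_{a,r}-\mathcal{L}_rF$$ is formed. Let $\alpha_r:=\frac{d+1+r}{2}$. Choose an integer $p\ge0$ and $s\in(0,1]$ such that $\alpha_r=p+s$, with the convention that if $\alpha_r\in\mathbb{N}$ one takes $s=1$ and $p=\alpha_r-1$. Let $$H:=(-\Delta)^pF,$$ assuming that this expression is well defined as a distribution. Then the equation $\mathcal{L}_rF=Q_{a,r}$ in $\Omega$ is equivalent, inside $\Omega$, to $$(-\Delta)^sH=c_{d,r}^{-1}Q_{a,r}\quad\text{in }\Omega .$$ The exterior condition $H=0$ in $\Omega^c$ does not follow from the equation $\mathcal{L}_rF=Q_{a,r}$ in $\Omega$; it is an additional homogeneous Dirichlet ansatz. Under this ansatz, the fractional Dirichlet problem is $$(-\Delta)^sH=K_\Omega:=c_{d,r}^{-1}Q_{a,r}\ \text{ in }\Omega,\qquad H=0\ \text{ in }\Omega^c .$$ Assume that this Dirichlet problem is well posed in a class for which the Green representation is valid. If $G_\Omega^s$ is the corresponding Green kernel, then $$H(x)=\int_\Omega G_\Omega^s(x,y)K_\Omega(y)\,dy,\qquad x\in\Omega.$$ For the zero extension of $H$, the corresponding candidate stationary measure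 is $$\phi=Q_{a,r}-c_{d,r}(-\Delta)^sH .$$ This candidate gives an actual zero-flux stationary state only after the following are verified: the remaining free-boundary conditions $$\nabla F=0\ \ \phi\text{-a.e. on }S,\qquad Q_{a,r}-\mathcal{L}_rF\ge0\ \text{ as a measure supported in }S,\qquad \int_{\mathbb{R}^d}(Q_{a,r}-\mathcal{L}_rF)=1,$$ the admissibility hypotheses, and the convolution gauge condition $$F=\psi_a*\omega-\psi_r*\phi .$$
   Context: For $\sigma\in[0,1)$: $\psi_\sigma(x)=|x|^{1+\sigma}$, $K_\sigma(x)=\nabla\psi_\sigma(x)=(1+\sigma)|x|^{\sigma-1}x$ for $x\neq0$, $K_\sigma(0)=0$. Fourier transform $\widehat f(\xi)=\int e^{-ix\cdot\xi}f(x)\,dx$; for $\alpha>0$, $(-\Delta)^\alpha$ is the Fourier multiplier $|\xi|^{2\alpha}$ (whenever the product is a tempered distribution). One has $\widehat{\psi_\sigma}=\gamma_{d,\sigma}\operatorname{fp}|\xi|^{-d-1-\sigma}$ in the space $\mathcal{S}'(\mathbb{R}^d)$ of tempered distributions, $\gamma_{d,\sigma}\ne0$, with $\operatorname{fp}$ the Hadamard finite part (homogeneous distribution of degree $-d-1-\sigma$). $\mathfrak{P}_\sigma$ is the set of $f\in\mathcal{S}'(\mathbb{R}^d)$ of the form $f=\psi_\sigma*\mu$ with $\mu$ a (necessarily unique) finite measure, and $\mathcal{L}_\sigma f:=\mu$; this is the Fourier multiplier $\gamma_{d,\sigma}^{-1}|\xi|^{d+1+\sigma}$, i.e. $\mathcal{L}_\sigma=c_{d,\sigma}(-\Delta)^{(d+1+\sigma)/2}$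 with $c_{d,\sigma}\neq0$. For $0\le r\le a<1$ and a finite measure $\mu$ with $\psi_a*\mu$ a tempered distribution (''$\psi_a*\mu$ is admissible for the action of $\mathcal{L}_r$''), $\mathcal{L}_r(\psi_a*\mu)$ is defined by $\widehat{\mathcal{L}_r(\psi_a*\mu)}(\xi)=\frac{\gamma_{d,a}}{\gamma_{d,r}}|\xi|^{r-a}\widehat\mu(\xi)$. Admissibility hypotheses (for $\phi$, $\omega$, $F$): $\psi_r*\phi\in\mathfrak{P}_r$; $\psi_a*\omega$ is admissible for the action of $\mathcal{L}_r$; $F$ has a Borel gradient representative that is $\phi$-integrable. Zero-flux stationary state: a probability measure $\phi$ with $\phi\,(K_a*\omega-K_r*\phi)=0$ in the sense of vector-valued distributions. The Green kernel $G_\Omega^s$ is that of $(-\Delta)^s$ on $\Omega$ with homogeneous Dirichlet condition on $\Omega^c$.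
   Formalization: The Borel gradient representative of F must equal the limit of its symmetric ball averages φ-a.e.; for an arbitrary representative the final claim fails for singular φ. That the exterior condition does not follow is claimed when Ω^c is not Lebesgue-null (it is void for Ω=R^d). *)

(* Defs.v *)
From HB Require Import structures.
From mathcomp Require Import all_boot all_order all_algebra.
From mathcomp Require Import all_classical all_reals all_analysis.
From mathcomp Require complex.

Set Implicit Arguments.
Unset Strict Implicit.
Unset Printing Implicit Defensive.

Import Order.TTheory GRing.Theory Num.Theory.
Import numFieldNormedType.Exports.

Local Open Scope classical_set_scope.
Local Open Scope ring_scope.


(* R^d carries the product sigma-algebra generated by the coordinates, as the
   library does for tuples; it is the Borel sigma-algebra. *)
Section measurable_row.
Context (R : realType) (d : nat).

Definition row_coord (i : 'I_d) (x : 'rV[R]_d) : R := x ord0 i.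

Definition row_display : measure_display.
Proof. exact: (measure_tuple_display default_measure_display). Qed.

Let row_set0 : g_sigma_preimage row_coord set0.
Proof. exact: sigma_algebra0. Qed.

Let row_setC A : g_sigma_preimage row_coord A ->
  g_sigma_preimage row_coord (~` A).
Proof. exact: sigma_algebraC. Qed.

Let row_bigcup (F : (set 'rV[R]_d)^nat) :
  (forall i, g_sigma_preimage row_coord (F i)) ->
  g_sigma_preimage row_coord (\bigcup_i (F i)).
Proof. exact: sigma_algebra_bigcup. Qed.

HB.instance Definition _ := @isMeasurable.Build row_display
  'rV[R]_d (g_sigma_preimage row_coord) row_set0 row_setC row_bigcup.

End measurable_row.

Section lebesgue_row.
Context (R : realType).

Definition tuple_cons (d : nat) (z : R * d.-tuple R) : d.+1.-tuple R :=
  [tuple of z.1 :: z.2].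

Lemma measurable_tuple_cons (d : nat) : measurable_fun setT (@tuple_cons d).
Proof. exact: measurable_cons. Qed.

Definition tuple_row (d : nat) (t : d.-tuple R) : 'rV[R]_d :=
  \row_i tnth t i.

Lemma measurable_tuple_row (d : nat) : measurable_fun setT (@tuple_row d).
Proof.
move=> _ Y mY; rewrite setTI.
suff -> : measurable (@tuple_row d @^-1` Y) =
    g_sigma_preimage (fun i => @row_coord R d i \o @tuple_row d)
      (@tuple_row d @^-1` Y).
  by rewrite g_sigma_preimage_comp; exists Y => //; rewrite setTI.
rewrite /measurable /=; congr (g_sigma_preimage _ _).
by apply/funext => i; apply/funext => t; rewrite /row_coord /tuple_row /= mxE.
Qed.

Definition image_measure d1 d2 (T1 : measurableType d1) (T2 : measurableType d2)
    (m : {measure set T1 -> \bar R}) (f : T1 -> T2)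
    (mf : measurable_fun setT f) : {measure set T2 -> \bar R} :=
  measure_function_pushforward__canonical__measure_function_Measure m mf.

Fixpoint lebesgue_tuple (d : nat) : {measure set (d.-tuple R) -> \bar R} :=
  match d with
  | 0%N => \d_ [tuple]
  | n.+1 => image_measure (lebesgue_measure \x^ lebesgue_tuple n)%E
              (@measurable_tuple_cons n)
  end.

Definition lebesgue (d : nat) : {measure set 'rV[R]_d -> \bar R} :=
  image_measure (lebesgue_tuple d) (@measurable_tuple_row d).

End lebesgue_row.

Section defs.
Context (R : realType) (d : nat).
Local Notation E := 'rV[R]_d.
Local Notation lam := (@lebesgue R d).
Implicit Types (x y xi : E) (f g h eta : E -> R).

(* The norm `|x| of the library on 'rV is the sup norm. *)
Definition dot x y : R := \sum_i x ord0 i * y ord0 i.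
Definition enorm x : R := Num.sqrt (dot x x).


Definition partial (i : 'I_d) f : E -> R := 'D_(delta_mx ord0 i) f.
Definition partials (s : seq 'I_d) f : E -> R := foldr partial f s.
Definition smooth f : Prop := forall s x, differentiable (partials s f) x.

Definition schwartz f : Prop :=
  smooth f /\
  forall (k : nat) s, exists C : R,
    forall x, (1 + enorm x) ^+ k * `|partials s f x| <= C.

Definition supp f : set E := closure [set x | f x != 0].

Definition test_on (Omega : set E) f : Prop :=
  [/\ smooth f, compact (supp f) & supp f `<=` Omega].

(* Real tempered distributions, as functionals on real Schwartz functions; the
   values outside the Schwartz space are irrelevant. *)
Definition dist : Type := (E -> R) -> R.
Implicit Types (T F H Q U V : dist).

Definition tempered T : Prop :=
  (forall (k : R) f g, schwartz f -> schwartz g ->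
     T (fun x => k * f x + g x) = k * T f + T g) /\
  exists (N : nat) (C : R), forall f (M : R), schwartz f ->
    (forall s x, (size s <= N)%N ->
       (1 + enorm x) ^+ N * `|partials s f x| <= M) ->
    `|T f| <= C * M.

Definition dist_eq T U : Prop := forall f, schwartz f -> T f = U f.
Definition eq_on (Omega : set E) T U : Prop :=
  forall f, test_on Omega f -> T f = U f.

Definition dist_scale (c : R) T : dist := fun f => c * T f.
Definition dist_sub T U : dist := fun f => T f - U f.
Definition dist_delta y : dist := fun f => f y.

Definition dist_measure (mu : {measure set E -> \bar R}) : dist :=
  fun f => \int[mu]_x f x.

(* T is the function h, which is locally integrable and of tempered growth. *)
Definition represents h T : Prop :=
  measurable_fun setT h /\
  forall f, schwartz f ->
    lam.-integrable setT (EFin \o (fun x => h x * f x)) /\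
    T f = \int[lam]_x (h x * f x).

Definition represents_on (Omega : set E) h T : Prop :=
  measurable_fun Omega h /\
  forall f, test_on Omega f ->
    lam.-integrable Omega (EFin \o (fun x => h x * f x)) /\
    T f = \int[lam]_(x in Omega) (h x * f x).


Local Notation C := (complex.complex R).
Local Notation mkC := (@complex.Complex R).

Definition fourier f xi : C :=
  mkC (\int[lam]_x (f x * cos (dot x xi)))
      (- \int[lam]_x (f x * sin (dot x xi))).

Definition fourier_measure (mu : {measure set E -> \bar R}) xi : C :=
  mkC (\int[mu]_x cos (dot x xi)) (- \int[mu]_x sin (dot x xi)).

(* <T^, f> = <T, f^>, where T acts on the complex function f^ by complex
   linearity.  The complex distribution T^ is determined by its values on real
   Schwartz functions. *)
Definition fourier_dist T f : C :=
  mkC (T (fun xi => complex.Re (fourier f xi)))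
      (T (fun xi => complex.Im (fourier f xi))).

Definition cvgC (I : Type) (z : I -> C) (l : C) (G : set_system I) : Prop :=
  (fun t => complex.Re (z t)) @ G --> complex.Re l /\
  (fun t => complex.Im (z t)) @ G --> complex.Im l.


Definition cutoff f : Prop :=
  [/\ smooth f, compact (supp f) & \forall x \near (0 : E), f x = 1].

(* frac_lap alpha T U: (-Delta)^alpha T exists and is U, that is, the product
   of |xi|^(2 alpha) and T^ is the tempered distribution U^.
   If alpha is a natural number, |xi|^(2 alpha) is a polynomial and this is the
   product of a distribution by a smooth function.  Otherwise |xi|^(2 alpha)
   is smooth only off the origin: the product, defined there in the
   usual sense, is extended to R^d without mass at 0, as the limit of
   (1 - theta(xi/eps)) |xi|^(2 alpha) T^ for every cutoff theta. *)
Definition frac_lap (alpha : R) T U : Prop :=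
  tempered U /\
  forall f, schwartz f ->
    ((exists n : nat, alpha = n%:R) ->
       fourier_dist U f =
       fourier_dist T (fun xi => enorm xi `^ (2 * alpha) * f xi)) /\
    (~ (exists n : nat, alpha = n%:R) ->
       forall theta, cutoff theta ->
       cvgC (fun eps : R => fourier_dist T (fun xi =>
               (1 - theta (eps^-1 *: xi)) * enorm xi `^ (2 * alpha) * f xi))
            (fourier_dist U f) 0^'+).


Definition psi (sigma : R) x : R := enorm x `^ (1 + sigma).

Definition K (sigma : R) x : E :=
  if x == 0 then 0 else ((1 + sigma) * enorm x `^ (sigma - 1)) *: x.

(* Hadamard finite part of |xi|^(- d - 1 - sigma) against f: the constant term
   left after removal of the divergent power of eps. *)
Definition finite_part (sigma : R) f (L : R) : Prop :=
  exists A : R,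
    (fun eps : R =>
       \int[lam]_(xi in [set xi | eps < enorm xi])
          (f xi * enorm xi `^ (- d%:R - 1 - sigma))
       - A * eps `^ (- 1 - sigma)) @ 0^'+ --> L.

(* c is the constant gamma_{d,sigma}. *)
Definition gamma_const (sigma c : R) : Prop :=
  c != 0 /\
  forall f, schwartz f -> exists2 L, finite_part sigma f L &
    fourier_dist (fun g => \int[lam]_x (psi sigma x * g x)) f = mkC (c * L) 0.

(* T is the tempered distribution psi_sigma * mu. *)
Definition psi_conv (sigma : R) (mu : {measure set E -> \bar R}) T : Prop :=
  tempered T /\
  forall f, schwartz f ->
    mu.-integrable setT
      (EFin \o (fun y => \int[lam]_x (psi sigma (x - y) * f x))) /\
    T f = \int[mu]_y \int[lam]_x (psi sigma (x - y) * f x).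

(* The same for the signed measure mu - nu. *)
Definition psi_conv_signed (sigma : R) (mu nu : {measure set E -> \bar R}) T :
    Prop :=
  exists U V, [/\ psi_conv sigma mu U, psi_conv sigma nu V
                & dist_eq T (dist_sub U V)].

Definition frakP (sigma : R) : set dist :=
  [set T | exists mu nu : {finite_measure set E -> \bar R},
             psi_conv_signed sigma mu nu T].

(* The multiplier c (-Delta)^((d+1+sigma)/2), with c = c_{d,sigma}. *)
Definition calL (sigma c : R) T U : Prop :=
  exists2 V, frac_lap ((d%:R + 1 + sigma) / 2) T V & dist_eq U (dist_scale c V).

(* U = L_r (psi_a * mu), where ga = gamma_{d,a} and gr = gamma_{d,r}. *)
Definition calL_psi (r a gr ga : R) (mu : {measure set E -> \bar R}) U : Prop :=
  tempered U /\
  forall f, schwartz f ->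
    let k xi := ga / gr * enorm xi `^ (r - a) * f xi in
    fourier_dist U f =
    mkC (\int[lam]_xi (k xi * complex.Re (fourier_measure mu xi)))
        (\int[lam]_xi (k xi * complex.Im (fourier_measure mu xi))).

Definition K_conv (sigma : R) (mu : {measure set E -> \bar R}) x : E :=
  \row_i \int[mu]_y (K sigma (x - y) ord0 i).


(* g is the gradient of T, as a distribution. *)
Definition gradient_rep T (g : E -> E) : Prop :=
  forall i, represents_on setT (fun x => g x ord0 i)
              (fun f => - T (partial i f)).

(* g x is the limit of the averages of g over the balls centred at x. *)
Definition mean_value_at (g : E -> E) x : Prop :=
  forall i, (fun rho : R =>
      (fine (lam [set y | enorm (y - x) < rho]))^-1 *
      \int[lam]_(y in [set y | enorm (y - x) < rho]) (g y ord0 i)) @ 0^'+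
    --> g x ord0 i.

(* Admissibility, for phi = mu - nu.  A Borel representative of grad F is
   determined by F only up to Lebesgue-null sets, which phi may charge: g is
   normalized at phi-almost every point by the mean value.  For
   F = psi_a * omega - psi_r * phi the normalized representative is
   K_a * omega - K_r * phi, by K_sigma(0) = 0. *)
Definition admissible (r : R) (mu nu : {measure set E -> \bar R})
    F (g : E -> E) : Prop :=
  [/\ exists2 T, psi_conv_signed r mu nu T & frakP r T,
      tempered F,
      gradient_rep F g,
      forall i, mu.-integrable setT (EFin \o (fun x => g x ord0 i)) /\
                nu.-integrable setT (EFin \o (fun x => g x ord0 i))
    & {ae mu, forall x, mean_value_at g x} /\
      {ae nu, forall x, mean_value_at g x}].

(* The ansatz F, with L_r F = LF and with candidate Q - LF equal to the finite
   signed measure mu - nu. *)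
Definition ansatz (r c : R) Q F LF (g : E -> E)
    (mu nu : {finite_measure set E -> \bar R}) : Prop :=
  [/\ calL r c F LF,
      dist_eq (dist_sub Q LF) (dist_sub (dist_measure mu) (dist_measure nu))
    & admissible r mu nu F g].

Definition zero_flux (a r : R) (omega phi : {measure set E -> \bar R}) : Prop :=
  let flux x := K_conv a omega x - K_conv r phi x in
  [/\ phi setT = 1%E,
      {ae phi, forall x, forall i,
         omega.-integrable setT (EFin \o (fun y => K a (x - y) ord0 i)) /\
         phi.-integrable setT (EFin \o (fun y => K r (x - y) ord0 i))}
    & forall f i, test_on setT f ->
        phi.-integrable setT (EFin \o (fun x => f x * flux x ord0 i)) /\
        \int[phi]_x (f x * flux x ord0 i) = 0].

(* The candidate D is the nonnegative measure phi, which is supported in the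
   complement of Omega and has mass 1; g stands for grad F. *)
Definition free_boundary (Omega : set E) (D : dist) (g : E -> E)
    (phi : {measure set E -> \bar R}) : Prop :=
  [/\ {ae phi, forall x, ~ Omega x -> g x = 0},
      dist_eq D (dist_measure phi), phi Omega = 0%E & phi setT = 1%E].

Definition gauge (r : R) (Psi : dist) (phi : {measure set E -> \bar R}) F :
    Prop :=
  exists2 T, psi_conv r phi T & dist_eq F (dist_sub Psi T).


(* H is a function that vanishes on the complement of Omega. *)
Definition exterior_zero (Omega : set E) H : Prop :=
  exists2 h, represents h H & forall x, ~ Omega x -> h x = 0.

(* (-Delta)^s u = D in Omega, u = 0 in the complement of Omega. *)
Definition dirichlet (Omega : set E) (s : R) (D : dist) (u : E -> R) : Prop :=
  (forall x, ~ Omega x -> u x = 0) /\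
  exists U V, [/\ tempered U, represents u U, frac_lap s U V & eq_on Omega V D].

(* G x y is G_Omega^s(x, y), with its zero extension in x outside Omega. *)
Definition green_kernel (Omega : set E) (s : R) (G : E -> E -> R) : Prop :=
  forall y, Omega y -> dirichlet Omega s (dist_delta y) (G ^~ y).

Definition green_potential (Omega : set E) (G : E -> E -> R) (k : E -> R) :
    E -> R :=
  patch (fun=> 0) Omega (fun x => \int[lam]_(y in Omega) (G x y * k y)).

Definition well_posed (Omega : set E) (s : R) (D : dist)
    (cls : set (E -> R)) : Prop :=
  exists! u, cls u /\ dirichlet Omega s D u.

Definition green_valid (Omega : set E) (s : R) (D : dist)
    (cls : set (E -> R)) (G : E -> E -> R) (k : E -> R) : Prop :=
  [/\ forall x, Omega x ->
        lam.-integrable Omega (EFin \o (fun y => G x y * k y)),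
      cls (green_potential Omega G k)
    & dirichlet Omega s D (green_potential Omega G k)].

End defs.

Arguments lebesgue : clear implicits.
Arguments dist : clear implicits.
Arguments gamma_const {R} d sigma c.

(* Main.v *)
(* Write [alpha = p + s].  As [|xi|^(2p) |xi|^(2s) = |xi|^(2 alpha)], the
   distribution [(-Delta)^s H] is [(-Delta)^alpha F]: when [s < 1] the functions
   [(1 - theta(xi/eps)) |xi|^(2s) f] are Schwartz, so [(-Delta)^p] can be applied
   to them before the limit is taken.  It is unique since the Fourier transform
   is injective, which gives the Dirichlet problem and its Green representation.

   The gradient of [psi_a * omega - psi_r * phi] is the flux
   [K_a * omega - K_r * phi] almost everywhere.  Because [K] is odd, the averages
   of [K * mu] over small balls converge to its value at every point, including
   the atoms of [mu]; hence the normalized gradient of [F] is the flux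
   [phi]-almost everywhere, and zero flux means [grad F = 0], by the
   du Bois-Reymond lemma for [phi].

   The exterior condition is independent because [psi_a * omega] and
   [psi_a * omega + x_1^(2p)] are both ansatzes with [L_r F = Q], while the two
   functions [H] differ by a nonzero constant: both cannot vanish on a set of
   positive measure. *)

Require Import Defs.
From HB Require Import structures.
From mathcomp Require Import all_boot all_order all_algebra.
From mathcomp Require Import all_classical all_reals all_analysis.
From mathcomp Require Import measurable_realfun.
From mathcomp Require Import ring lra.

Set Implicit Arguments.
Unset Strict Implicit.
Unset Printing Implicit Defensive.

Import Order.TTheory GRing.Theory Num.Theory.
Import numFieldNormedType.Exports.

Local Open Scope classical_set_scope.
Local Open Scope ring_scope.

(** Distributions act on real functions, so complex exponentials are replaced by the pair cosine and
    sine, and complex identities become pairs of real ones.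

    The identification of [Q] with a multiple of [(-Delta)^alpha] of [psi_a * omega] meets the
    finite part, which is not an integral in general. Here the test functions carry a factor
    [|xi|^(2 alpha)] of order [d + 1 + r] at the origin, against the weight [|xi|^(- d - 1 - a)];
    what remains is [|xi|^(r - a)], integrable because [0 <= a - r < 1 <= d]. The finite part
    becomes an ordinary integral and Fubini with [omega] applies.

    Fubini for the gradients requires a first moment of [omega] and [phi]. It is extracted from the
    existence of the convolution, by testing against a Gaussian.

    The degree [2p] of the perturbation is chosen so that [(-Delta)^p] leaves a nonzero constant and
    one further Laplacian gives 0. Off the origin the multiplier of order [p + s] is
    [|xi|^(2(p + 1))] times a smooth function, so it kills the Fourier transform of the monomial,
    which is carried by the origin. *)

Section ereal_scaling.
Context (R : realType).
Implicit Types (c : R) (a b : \bar R).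

(** At an infinite [a] both sides are 0, the default value of [fine]; integrals can thus be rescaled
    without integrability. *)
Lemma fine_pmul c a : 0 < c -> fine (c%:E * a) = c * fine a.
Proof.
rewrite -lte_fin => c0; case: a => [y||]; first by [].
  by rewrite gt0_muley//= mulr0.
by rewrite gt0_muleNy//= mulr0.
Qed.

(** A positive real factor fixes both infinities, so distributivity survives even [+oo - +oo]. *)
Lemma pmuleBr c a b : 0 < c -> (c%:E * (a - b) = c%:E * a - c%:E * b)%E.
Proof.
rewrite -lte_fin => c0; case: a => [y||]; case: b => [z||];
  rewrite /= ?gt0_muley ?gt0_muleNy//=.
by rewrite -EFinD -EFinM mulrDr EFinD mulrN.
Qed.

End ereal_scaling.

(** * Lebesgue measure on row vectors *)

Section measurable_rV.
Context (R : realType) (d : nat).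
Local Notation E := 'rV[R]_d.

Lemma measurable_coord (i : 'I_d) : measurable_fun setT (fun x : E => x ord0 i).
Proof.
move=> _ Y mY; rewrite setTI; apply: sub_sigma_algebra.
rewrite -bigcup_seq; exists i; first by rewrite /= mem_index_enum.
by exists Y => //; rewrite setTI.
Qed.

Lemma measurable_fun_rVP d' (T : measurableType d') (f : T -> E) :
  (forall i, measurable_fun setT (fun t => f t ord0 i)) -> measurable_fun setT f.
Proof.
move=> mf _ Y mY; rewrite setTI.
have mX : preimage_set_system setT f (g_sigma_preimage (@row_coord R d))
    (f @^-1` Y) by exists Y => //; rewrite setTI.
move: mX; rewrite -g_sigma_preimage_comp.
apply: smallest_sub; first exact: sigma_algebra_measurable.
move=> A; rewrite -bigcup_seq => -[i _ [B mB <-]].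
exact: mf.
Qed.

(** Boxes with rational data form a countable base. The strict inequality at [x] serves the covering
    by open boxes, the closed box inside [A] serves to place the supports of bump functions. *)
Lemma open_rational_box (A : set E) x : open A -> A x ->
  exists z : d.-tuple rat * nat,
    (forall i, `|x ord0 i - ratr (tnth z.1 i)| < z.2.+1%:R^-1) /\
    [set y : E | forall i, `|y ord0 i - ratr (tnth z.1 i)| <= z.2.+1%:R^-1] `<=` A.
Proof.
move=> oA Ax; have /nbhs_ballP[e /= e0 eA] := oA _ Ax.
(* Both [x] and [y] lie within [1 / (n + 1)] of the centre, whence the factor 2. *)
have [n ne] : exists n : nat, 2 * n.+1%:R^-1 < e.
  have e20 : 0 < e / 2 by rewrite divr_gt0.
  have [n] := ltr_add_invr e20.
  rewrite add0r => ne; exists n.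
  by rewrite mulrC -ltr_pdivlMr.
have hq i : exists q : rat, `|x ord0 i - ratr q| < n.+1%:R^-1.
  have n0 : 0 < n.+1%:R^-1 :> R by rewrite invr_gt0.
  have hlt : x ord0 i - n.+1%:R^-1 < x ord0 i + n.+1%:R^-1 by rewrite ltrBlDr -addrA ltrDl addr_gt0.
  have [q] := rat_in_itvoo hlt.
  rewrite in_itv /= => /andP[q1 q2]; exists q.
  by rewrite distrC ltr_distl q1 q2.
have [q hqx] := choice hq.
exists ([tuple q i | i < d], n); split=> [i /=|y /= yb].
  by rewrite tnth_mktuple; exact: hqx.
apply: eA; rewrite -ball_normE /= /ball_ /= [ltLHS]/Num.norm /= mx_normrE.
apply: bigmax_lt => // -[j i] _ /=.
rewrite !mxE (ord1 j).
have := yb i; rewrite /= tnth_mktuple => yi.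
rewrite (_ : x ord0 i - y ord0 i = (x ord0 i - ratr (q i)) - (y ord0 i - ratr (q i))); last by ring.
apply: le_lt_trans (ler_normB _ _) _.
by apply: lt_trans ne; rewrite mulrDl !mul1r ltr_leD.
Qed.

Lemma open_measurable_rV (A : set E) : open A -> measurable A.
Proof.
move=> oA.
pose D := (d.-tuple rat * nat)%type.
pose box (z : D) : set E := [set x | forall i, `|x ord0 i - ratr (tnth z.1 i)| < z.2.+1%:R^-1].
have mbox z : measurable (box z).
  rewrite (_ : box z = \bigcap_(i in [set: 'I_d])
    ((fun x : E => x ord0 i) @^-1` ball (ratr (tnth z.1 i) : R) z.2.+1%:R^-1)).
    apply: fin_bigcap_measurable => // i _.
    rewrite -[X in measurable X]setTI; apply: measurable_coord => //.
    exact: measurable_ball.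
  apply/seteqP; split=> [x h i _|x h i] /=.
    by rewrite /ball /= distrC; exact: h.
  by have := h i I; rewrite /ball /= distrC.
rewrite (_ : A = \bigcup_(z in [set z | box z `<=` A]) box z).
  rewrite bigcup_mkcond.
  apply: countable_bigcupT_measurable => [|z].
    exact: (@countableP D).
  by case: ifP.
apply/seteqP; split=> [x Ax|x [z /= zA /zA]//].
have [z [zx zA]] := open_rational_box oA Ax.
by exists z => // y yz; apply: zA => i; exact/ltW/yz.
Qed.

Lemma continuous_measurable_rV (f : E -> R) : continuous f -> measurable_fun setT f.
Proof.
move=> cf; apply: (measurability _ (@RGenOpens.measurableE R)) => //.
move=> _ [_ [a [b ->] <-]]; rewrite setTI.
apply: open_measurable_rV; apply: open_comp => // ? _; exact: cf.
Qed.

End measurable_rV.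

Section lebesgue_tuple_theory.
Context (R : realType).
Local Notation leb := (@lebesgue_measure R).
Local Open Scope ereal_scope.

Lemma lebesgue_tuple_sigma_finite n : sigma_finite setT (lebesgue_tuple R n).
Proof.
elim: n => [|n /sigma_finiteP[F [FT ndF Foo]]].
  exists (fun=> setT); first by rewrite bigcup_const.
  by move=> k; split => //=; rewrite diracT ltry.
have /sigma_finiteP[G [GT ndG Goo]] := sigma_finiteT leb.
pose H k := [set t : n.+1.-tuple R | G k (thead t) /\ F k [tuple of behead t]].
have HE k : @tuple_cons R n @^-1` H k = G k `*` F k.
  apply/seteqP; split=> [[x t]|[x t]] /= [Gx Ft]; split => //=.
    by move: Ft; congr (F k); apply: val_inj.
  by move: Ft; congr (F k); apply: val_inj.
exists H.
  apply/seteqP; split => // t _.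
  have [i _ Gi] : (\bigcup_i G i) (thead t) by rewrite -GT.
  have [j _ Fj] : (\bigcup_i F i) [tuple of behead t] by rewrite -FT.
  exists (maxn i j) => //; split.
    by move: (thead t) Gi; apply/subsetPset/ndG/leq_maxl.
  by move: [tuple of behead t] Fj; apply/subsetPset/ndF/leq_maxr.
move=> k; have [mG Gk] := Goo k; have [mF Fk] := Foo k; split.
  have -> : H k = (fun t => (thead t, [tuple of behead t])) @^-1` (G k `*` F k).
    by apply/seteqP; split.
  rewrite -[X in measurable X]setTI.
  apply: measurable_fun_pair => //.
  - exact: measurable_tnth.
  - exact: measurable_behead.
  - exact: measurableX.
rewrite /= /pushforward HE.
by rewrite product_measure2E// lte_mul_pinfty// ge0_fin_numE.
Qed.

(** A separate name to which the sigma-finite structure required by Tonelli can be attached. *)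
Definition lebt (n : nat) : set (n.-tuple R) -> \bar R := lebesgue_tuple R n.
Arguments lebt : clear implicits.
HB.instance Definition _ (n : nat) := Measure.copy (lebt n) (lebesgue_tuple R n).
HB.instance Definition _ (n : nat) := Measure_isSigmaFinite.Build _ _ _ (lebt n)
  (lebesgue_tuple_sigma_finite n).

(** The head coordinate is integrated first, so that a one-dimensional fact applies under the outer
    integral and an induction hypothesis to it. *)
Lemma lebesgue_tupleS_integral n (f : n.+1.-tuple R -> \bar R) :
  measurable_fun setT f -> (forall t, 0 <= f t) ->
  \int[lebesgue_tuple R n.+1]_t f t =
  \int[lebesgue_tuple R n]_t \int[leb]_x f (tuple_cons (x, t)).
Proof.
move=> mf f0.
rewrite /= ge0_integral_pushforward//; last exact: measurable_tuple_cons.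
rewrite preimage_setT.
have mg : measurable_fun setT (f \o @tuple_cons R n).
  by apply: measurableT_comp => //; exact: measurable_tuple_cons.
have := @fubini_tonelli2 _ _ _ _ _ leb (lebt n) _ mg (fun x => f0 _).
rewrite /fubini_G /= => <-.
(* The definition uses [\x^] whereas Tonelli is stated for [\x]; the two measures agree on
   rectangles. *)
apply: eq_measure_integral => A mA _ /=; apply/esym.
rewrite (@product_measure_unique _ _ _ _ _ leb (lebt n)
  (leb \x^ lebesgue_tuple R n)%E)// => B C mB mC.
exact: (@product_measure2E _ _ _ _ _ leb (lebesgue_tuple R n)).
Qed.

(** By uniqueness of Lebesgue measure: [|e|] times its image under the affine map has the right
    value on half-open intervals. *)
Lemma lebesgue1_affine (f : R -> \bar R) (e v : R) : e != 0%R ->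
  measurable_fun setT f -> (forall t, 0 <= f t) ->
  \int[leb]_x f (e * x + v)%R = (`|e|^-1)%:E * \int[leb]_x f x.
Proof.
move=> e0 mf f0.
have mphi : measurable_fun setT ((fun x : R => e * x + v)%R : measurableTypeR R -> measurableTypeR R).
  by apply: measurable_funD => //; exact: measurable_funM.
have e1 : (0 <= `|e|)%R by [].
pose mu : {measure set (measurableTypeR R) -> \bar R} :=
  mscale (NngNum e1) (image_measure leb mphi).
have muE A : measurable A -> leb A = mu A.
  apply: lebesgue_measure_unique => {}A [[a b] _ <-] /=.
  rewrite /mscale /= /pushforward.
  have [ep|en] := ltP 0%R e.
    have -> : ((fun x : R => e * x + v) @^-1` `]a, b] = `](a - v) / e, (b - v) / e]%classic)%R.
      apply/seteqP; split => x /=; rewrite !in_itv /= ltr_pdivrMr// ler_pdivlMr//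
        (mulrC x) ltrBlDr lerBrDr //.
    rewrite !lebesgue_measure_itv /= !lte_fin ltr_pM2r ?invr_gt0// ltrD2r.
    case: ifP => ab; last by rewrite mule0.
    rewrite -!EFinB -EFinM gtr0_norm//; congr EFin.
    by field.
  (* A negative slope exchanges the open and the closed endpoint; the length does not see it. *)
  have {}en : (e < 0)%R by rewrite lt_neqAle e0.
  have -> : ((fun x : R => e * x + v) @^-1` `]a, b] = `[(b - v) / e, (a - v) / e[%classic)%R.
    apply/seteqP; split => x /=; rewrite !in_itv /= ltr_ndivlMr// ler_ndivrMr//
      (mulrC x) ltrBlDr lerBrDr andbC //.
  rewrite !lebesgue_measure_itv /= !lte_fin ltr_nM2r ?invr_lt0// ltrD2r.
  case: ifP => ab; last by rewrite mule0.
  rewrite -!EFinB -EFinM ltr0_norm//; congr EFin.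
  by field.
have -> : \int[leb]_x f x = \int[mu]_x f x.
  by apply: eq_measure_integral => A mA _; exact: muE.
rewrite ge0_integral_mscale//= ge0_integral_pushforward//= preimage_setT.
by rewrite muleA -EFinM mulVf ?normr_eq0// mul1e.
Qed.

Definition taffine n (e : R) (v t : n.-tuple R) : n.-tuple R :=
  [tuple (e * tnth t i + tnth v i)%R | i < n].

Lemma taffine_cons n (e x : R) (v : n.+1.-tuple R) (t : n.-tuple R) :
  taffine e v (tuple_cons (x, t)) =
  tuple_cons ((e * x + thead v)%R, taffine e [tuple of behead v] t).
Proof.
apply: eq_from_tnth => i; rewrite /taffine tnth_mktuple.
case: (unliftP ord0 i) => [j|] ->; last first.
  by rewrite /tuple_cons /=.
rewrite !tnthS tnth_mktuple; congr (_ + _)%R; last first.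
by rewrite [in LHS](tuple_eta v) tnthS.
Qed.

Lemma measurable_taffine n (e : R) (v : n.-tuple R) : measurable_fun setT (taffine e v).
Proof.
apply/measurable_fun_tnthP => i; rewrite /comp /=.
under eq_fun do rewrite tnth_mktuple.
apply: measurable_funD => //; apply: measurable_funM => //.
exact: measurable_tnth.
Qed.

(** Induction on the dimension, each coordinate contributing a factor [|e|^-1]. *)
Lemma lebesgue_tuple_affine n (f : n.-tuple R -> \bar R) (e : R) v : e != 0%R ->
  measurable_fun setT f -> (forall t, 0 <= f t) ->
  \int[lebesgue_tuple R n]_t f (taffine e v t) =
  (`|e|^-1 ^+ n)%:E * \int[lebesgue_tuple R n]_t f t.
Proof.
move=> e0; elim: n f v => [|n IH] f v mf f0.
  rewrite expr0 mul1e; apply: eq_integral => t _; congr f.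
  by rewrite [LHS]tuple0 [RHS]tuple0.
rewrite [LHS](@lebesgue_tupleS_integral _ (f \o taffine e v)); last 2 first.
- by apply: measurableT_comp => //; exact: measurable_taffine.
- by move=> t /=.
rewrite [in RHS]lebesgue_tupleS_integral//.
have mc : measurable_fun setT (fun z : R * n.-tuple R => f (tuple_cons z)).
  by apply: measurableT_comp => //; exact: measurable_tuple_cons.
have mF : measurable_fun setT (fun t : n.-tuple R => \int[leb]_x f (tuple_cons (x, t))).
  exact: (@measurable_fun_fubini_tonelli_G _ _ _ _ _ leb (fun z => f (tuple_cons z)) mc).
transitivity (\int[lebesgue_tuple R n]_t ((`|e|^-1)%:E *
    \int[leb]_x f (tuple_cons (x, taffine e [tuple of behead v] t)))).
  apply: eq_integral => t _ /=.
  under eq_integral do rewrite taffine_cons.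
  apply: (@lebesgue1_affine (fun x => f (tuple_cons (x, _)))) => //.
  exact: (measurableT_comp mc (pair2_measurable _)).
rewrite (@ge0_integralZl _ _ _ _ _ measurableT (fun t => \int[leb]_x f (tuple_cons (x, taffine e [tuple of behead v] t)))); last 3 first.
- exact: (measurableT_comp mF (measurable_taffine _ _)).
- by move=> t _; exact: integral_ge0.
- by rewrite lee_fin invr_ge0.
rewrite (IH (fun t => \int[leb]_x f (tuple_cons (x, t))))//; last first.
  by move=> t; exact: integral_ge0.
by rewrite muleA -EFinM -exprS.
Qed.

Lemma lebesgue_tuple_prod n (w : nat -> R -> R) :
  (forall i, measurable_fun setT (w i)) -> (forall i x, 0 <= w i x)%R ->
  \int[lebesgue_tuple R n]_t (\prod_(i < n) w i (tnth t i))%:E =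
  \prod_(i < n) \int[leb]_x (w i x)%:E.
Proof.
elim: n w => [|n IH] w mw w0.
  rewrite big_ord0 /=; under eq_integral do rewrite big_ord0.
  by rewrite integral_cst//= diracT mule1.
have mp m (u : nat -> R -> R) : (forall i, measurable_fun setT (u i)) ->
   measurable_fun setT (fun t : m.-tuple R => \prod_(i < m) u i (tnth t i))%R.
  move=> mu; apply: measurable_prod => i _.
  by apply: measurableT_comp => //; exact: measurable_tnth.
rewrite lebesgue_tupleS_integral//; last 2 first.
- by apply/measurable_EFinP; exact: mp.
- by move=> t; rewrite lee_fin; exact: prodr_ge0.
rewrite big_ord_recl -(IH (fun i => w i.+1))//.
transitivity (\int[lebesgue_tuple R n]_t
    (\int[leb]_x (w 0%N x)%:E * (\prod_(i < n) w i.+1 (tnth t i))%:E)).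
  apply: eq_integral => t _.
  transitivity (\int[leb]_x ((w 0%N x)%:E * (\prod_(i < n) w i.+1 (tnth t i))%:E)).
    apply: eq_integral => x _; rewrite -EFinM big_ord_recl; congr (_ * _)%:E.
    by apply: eq_bigr => i _; rewrite tnthS.
  rewrite ge0_integralZr//.
  - by apply/measurable_EFinP; exact: mw.
  - by move=> x _; rewrite lee_fin.
  - by rewrite lee_fin; exact: prodr_ge0.
rewrite ge0_integralZl//.
- by apply/measurable_EFinP; exact: (mp _ (fun i => w i.+1)).
- by move=> t _; rewrite lee_fin; exact: prodr_ge0.
- by apply: integral_ge0 => x _; rewrite lee_fin.
Qed.

End lebesgue_tuple_theory.

Section lebesgue_rV.
Context (R : realType) (d : nat).
Local Notation E := 'rV[R]_d.
Local Notation lam := (lebesgue R d).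
Local Notation leb := (@lebesgue_measure R).

Lemma lebesgue_sigma_finite : sigma_finite setT lam.
Proof.
have [F FT Foo] := lebesgue_tuple_sigma_finite R d.
have mrt : measurable_fun setT (fun x : E => [tuple x ord0 i | i < d]).
  apply/measurable_fun_tnthP => i; rewrite /comp /=.
  under eq_fun do rewrite tnth_mktuple.
  exact: measurable_coord.
have trK (t : d.-tuple R) : [tuple (tuple_row t) ord0 i | i < d] = t.
  by apply: eq_from_tnth => i; rewrite tnth_mktuple mxE.
exists (fun k => (fun x : E => [tuple x ord0 i | i < d]) @^-1` F k).
  by rewrite -preimage_bigcup -FT.
move=> k; have [mF Fk] := Foo k; split.
  by rewrite -[X in measurable X]setTI; exact: mrt.
rewrite /= /pushforward -comp_preimage.
rewrite (_ : _ \o _ = id) //.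
by apply/funext => t /=; exact: trK.
Qed.

(** The copy of [lam] that carries the sigma-finite structure and enters Fubini. *)
Definition slebesgue : set E -> \bar R := lam.
HB.instance Definition _ := Measure.copy slebesgue lam.
HB.instance Definition _ := Measure_isSigmaFinite.Build _ _ _ slebesgue
  lebesgue_sigma_finite.

Lemma lebesgue_affine_ge0 (f : E -> \bar R) (e : R) (v : E) : e != 0 ->
  measurable_fun setT f -> (forall t, 0 <= f t)%E ->
  (\int[lam]_x f (e *: x + v)%R = (`|e|^-1 ^+ d)%:E * \int[lam]_x f x)%E.
Proof.
move=> e0 mf f0.
have mA : measurable_fun setT (fun x : E => e *: x + v).
  apply: measurable_fun_rVP => i.
  under eq_fun do rewrite !mxE.
  by apply: measurable_funD => //; apply: measurable_funM => //; exact: measurable_coord.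
rewrite /= ge0_integral_pushforward//; last 2 first.
- exact: measurable_tuple_row.
- exact: (measurableT_comp mf mA).
rewrite [in RHS]ge0_integral_pushforward//; last exact: measurable_tuple_row.
rewrite !preimage_setT -(@lebesgue_tuple_affine _ _ _ _ [tuple v ord0 i | i < d]) //=; last first.
- by apply: measurableT_comp => //; exact: measurable_tuple_row.
apply: eq_integral => t _ /=; congr f.
by apply/rowP => i; rewrite !mxE tnth_mktuple tnth_mktuple.
Qed.

Lemma measurable_affine (e : R) (v : E) : measurable_fun setT (fun x : E => e *: x + v).
Proof.
apply: measurable_fun_rVP => i.
under eq_fun do rewrite !mxE.
by apply: measurable_funD => //; apply: measurable_funM => //; exact: measurable_coord.
Qed.

(** Positive and negative parts are rescaled separately and recombined by [pmuleBr], which tolerates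
    infinite parts. *)
Lemma lebesgue_affine (f : E -> \bar R) (e : R) (v : E) : e != 0 ->
  measurable_fun setT f ->
  (\int[lam]_x f (e *: x + v)%R = (`|e|^-1 ^+ d)%:E * \int[lam]_x f x)%E.
Proof.
move=> e0 mf; have c0 : `|e|^-1 ^+ d != 0 by rewrite expf_neq0// invr_eq0 normr_eq0.
have cp : 0 < `|e|^-1 ^+ d by rewrite exprn_gt0// invr_gt0 normr_gt0.
rewrite integralE [in RHS]integralE.
under [X in (X - _ = _)%E]eq_integral do rewrite (funepos_comp f).
under [X in (_ - X = _)%E]eq_integral do rewrite (funeneg_comp f).
rewrite (@lebesgue_affine_ge0 f^\+%E)//; last exact: measurable_funepos.
rewrite (@lebesgue_affine_ge0 f^\-%E)//; last exact: measurable_funeneg.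
exact/esym/pmuleBr.
Qed.

Lemma Rintegral_affine (f : E -> R) (e : R) (v : E) : e != 0 ->
  measurable_fun setT f ->
  \int[lam]_x f (e *: x + v) = `|e|^-1 ^+ d * \int[lam]_x f x.
Proof.
move=> e0 mf; rewrite /Rintegral.
rewrite (@lebesgue_affine (EFin \o f))//; last exact/measurable_EFinP.
have cp : 0 < `|e|^-1 ^+ d by rewrite exprn_gt0// invr_gt0 normr_gt0.
by rewrite fine_pmul.
Qed.

Lemma integrable_affine (f : E -> R) (e : R) (v : E) : e != 0 ->
  lam.-integrable setT (EFin \o f) ->
  lam.-integrable setT (EFin \o (fun x => f (e *: x + v))).
Proof.
move=> e0 /integrableP[mf foo]; apply/integrableP; split.
  exact: (measurableT_comp mf (measurable_affine _ _)).
rewrite [ltLHS](@lebesgue_affine (fun x => `|(f x)%:E|%E))//; last first.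
  exact: measurableT_comp.
by rewrite lte_mul_pinfty// lee_fin exprn_ge0// invr_ge0.
Qed.

Lemma Rintegral_shift (f : E -> R) (v : E) : measurable_fun setT f ->
  \int[lam]_x f (x + v) = \int[lam]_x f x.
Proof.
move=> mf; have := Rintegral_affine v (oner_neq0 R) mf.
rewrite normr1 invr1 expr1n mul1r => <-.
by under [in RHS]eq_Rintegral do rewrite scale1r.
Qed.

Lemma integrable_shift (f : E -> R) (v : E) :
  lam.-integrable setT (EFin \o f) ->
  lam.-integrable setT (EFin \o (fun x => f (x + v))).
Proof.
move=> /(integrable_affine v (oner_neq0 R)); congr (lam.-integrable _ _).
by apply/funext => x /=; rewrite scale1r.
Qed.

Lemma Rintegral_opp (f : E -> R) : measurable_fun setT f ->
  \int[lam]_x f (- x) = \int[lam]_x f x.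
Proof.
have n1 : (-1 : R) != 0 by rewrite oppr_eq0 oner_neq0.
move=> mf; have := Rintegral_affine 0 n1 mf.
rewrite normrN1 invr1 expr1n mul1r => <-.
by under [in RHS]eq_Rintegral do rewrite scaleN1r addr0.
Qed.

Lemma integrable_opp (f : E -> R) :
  lam.-integrable setT (EFin \o f) ->
  lam.-integrable setT (EFin \o (fun x => f (- x))).
Proof.
have n1 : (-1 : R) != 0 by rewrite oppr_eq0 oner_neq0.
move=> /(integrable_affine 0 n1); congr (lam.-integrable _ _).
by apply/funext => x /=; rewrite scaleN1r addr0.
Qed.

Lemma lebesgue_prod (w : nat -> R -> R) :
  (forall i, measurable_fun setT (w i)) -> (forall i x, 0 <= w i x) ->
  (\int[lam]_x (\prod_(i < d) w i (x ord0 i))%:E =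
  \prod_(i < d) \int[leb]_x (w i x)%:E)%E.
Proof.
move=> mw w0; rewrite -lebesgue_tuple_prod//.
rewrite /= ge0_integral_pushforward//=; last 3 first.
- exact: measurable_tuple_row.
- apply/measurable_EFinP; apply: measurable_prod => i _.
  by apply: measurableT_comp => //; exact: measurable_coord.
- by move=> t _; rewrite lee_fin; exact: prodr_ge0.
rewrite preimage_setT; apply: eq_integral => t _ /=; congr EFin.
by apply: eq_bigr => i _; rewrite mxE.
Qed.

Lemma integrable_prod_weight (w : nat -> R -> R) :
  (forall i, measurable_fun setT (w i)) -> (forall i x, 0 <= w i x) ->
  (forall i, \int[leb]_x (w i x)%:E < +oo)%E ->
  lam.-integrable setT (EFin \o (fun x => \prod_(i < d) w i (x ord0 i))).
Proof.
move=> mw w0 woo; apply/integrableP; split.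
  apply/measurable_EFinP; apply: measurable_prod => i _.
  by apply: measurableT_comp => //; exact: measurable_coord.
under eq_integral do rewrite /= ger0_norm ?prodr_ge0//.
rewrite lebesgue_prod//.
suff /andP[] : (0 <= \prod_(i < d) \int[leb]_x (w i x)%:E < +oo)%E by [].
elim/big_ind : _ => [|x y /andP[x0 xoo] /andP[y0 yoo]|i _]; first by rewrite lee01 ltry.
  by rewrite mule_ge0// lte_mul_pinfty// ge0_fin_numE.
by rewrite woo andbT; apply: integral_ge0 => x _; rewrite lee_fin.
Qed.

End lebesgue_rV.

(** * Integrable weights on the line *)

Section weights.
Context (R : realType).
Local Notation leb := (@lebesgue_measure R).

(** The integrand is even and has the primitive [atan], with a finite limit at infinity. *)
Lemma integral_oneDsqrV_lty : (\int[leb]_x ((1 + x ^+ 2)^-1)%R%:E < +oo)%E.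
Proof.
have cf : continuous (fun x : R => (1 + x ^+ 2)^-1)%R.
  exact: continuous_oneDsqrV.
rewrite ge0_symfun_integralT//; last 2 first.
- by move=> x; rewrite invr_ge0 addr_ge0// sqr_ge0.
- by move=> x /=; rewrite sqrrN.
rewrite -set_itvcy.
rewrite (@ge0_continuous_FTC2y _ _ (@atan R) 0 (pi / 2)).
- by rewrite atan0 sube0 -EFinM ltry.
- by move=> x _; rewrite invr_ge0 addr_ge0// sqr_ge0.
- by apply: continuous_subspaceT => x; exact: cf.
- exact: cvgy_atan.
- by move=> x _; exact: derivable_atan.
- by apply: cvg_at_right_filter; exact: continuous_atan.
- by move=> x _; rewrite derive1_atan.
Qed.


Lemma integral_powR01 (b e : R) : 0 < e -> e < 1 -> b < 1 ->
  (\int[leb]_(x in `[e, 1%R]) (x `^ (- b))%:E = ((1 - e `^ (1 - b)) / (1 - b))%:E)%E.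
Proof.
move=> e0 e1 b1.
have b0 : 1 - b != 0 by rewrite subr_eq0 gt_eqF.
have dP (x : R) : 0 < x -> is_derive x 1 (fun x : R => x `^ (1 - b) / (1 - b)) (x `^ (- b)).
  move=> x0; have H := is_deriveM (is_derive1_powR (1 - b) x0) (is_derive_cst (1-b)^-1 x 1).
  rewrite (_ : x `^ (- b) = x `^ (1 - b) *: (0 : R) +
    (1 - b)^-1 *: ((1 - b) * x `^ (1 - b - 1))); first exact: H.
  rewrite scaler0 add0r /GRing.scale /= mulrA mulVf// mul1r; congr (_ `^ _).
  by ring.
have cP (c x : R) : 0 < x -> {for x, continuous (fun x : R => x `^ c)}.
  move=> x0; apply: differentiable_continuous; apply/derivable1_diffP.
  by have [] := is_derive1_powR c x0.
rewrite (@continuous_FTC2 _ _ (fun x : R => x `^ (1 - b) / (1 - b)))//.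
- by rewrite powR1 -EFinB mulrBl mul1r.
- apply: continuous_in_subspaceT => x; rewrite inE /= in_itv /= => /andP[ex _].
  by apply: cP; exact: lt_le_trans ex.
- split.
  + by move=> x; rewrite in_itv /= => /andP[ex _]; have [] := dP x (lt_trans e0 ex).
  + by apply: cvg_at_right_filter; apply: cvgMr_tmp; exact: cP.
  + by apply: cvg_at_left_filter; apply: cvgMr_tmp; exact: cP.
- move=> x; rewrite in_itv /= => /andP[ex _]; have [_ dE] := dP x (lt_trans e0 ex).
  by rewrite derive1E.
Qed.

(** Monotone convergence along [[1 / (n + 2), 1]], where the integrals stay below [1 / (1 - b)]. *)
Lemma integral_powR01_lty (b : R) : b < 1 ->
  (\int[leb]_x (\1_(`]0, 1]%classic : set R) x * x `^ (- b))%:E < +oo)%E.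
Proof.
move=> b1.
(* The shift by 2 keeps the left endpoint strictly below 1, as [integral_powR01] demands. *)
pose I (n : nat) : set R := `[n.+2%:R^-1, 1]%classic.
pose g (n : nat) (x : R) := (\1_(I n) x * x `^ (- b))%:E.
have g0 n x : (0 <= g n x)%E by rewrite lee_fin mulr_ge0// powR_ge0.
have mg n : measurable_fun setT (g n).
  apply/measurable_EFinP; apply: measurable_funM; last exact: measurable_powR.
  by apply: measurable_indic; exact: measurable_itv.
have ndg x : {homo g ^~ x : n m / (n <= m)%N >-> (n <= m)%E}.
  move=> n m nm; rewrite lee_fin ler_wpM2r ?powR_ge0// !indicE ler_nat.
  rewrite /I !mem_setE !in_itv /=; case: (x <= 1); rewrite ?andbF ?andbT//.
  case: leP => // nx; rewrite (le_trans _ nx)// lef_pV2 ?posrE//.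
  by rewrite ler_nat !ltnS.
have gE x : (\1_(`]0, 1]%classic : set R) x * x `^ (- b))%:E = limn (g ^~ x).
  apply/esym/cvg_lim => //.
  have [x0|x0] := leP x 0.
    rewrite (_ : g ^~ x = cst ((\1_(`]0, 1]%classic : set R) x * x `^ (- b))%:E)); first exact: cvg_cst.
    apply/funext => n; rewrite /g /=; congr (_ * _)%:E; rewrite !indicE.
    rewrite /I !mem_setE !in_itv /= ltNge x0 /=.
    by rewrite leNgt (le_lt_trans x0)// invr_gt0.
  have [n nx] := ltr_add_invr x0; rewrite add0r in nx.
  apply: cvg_near_cst; exists n => // m /= nm.
  rewrite /g; congr (_ * _)%:E; rewrite !indicE.
  rewrite /I !mem_setE !in_itv /= x0 /=.
  rewrite [X in X && _](_ : _ = true)//.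
  apply/ltW; apply: le_lt_trans nx.
  by rewrite lef_pV2 ?posrE// ler_nat; exact: leqW.
under eq_integral do rewrite gE.
rewrite monotone_convergence//.
apply: (@le_lt_trans _ _ ((1 - b)^-1)%:E); last exact: ltry.
apply: lime_le.
  apply: ereal_nondecreasing_is_cvgn => n m nm.
  apply: ge0_le_integral => //; [exact: mg|exact: mg|].
  by move=> x _; exact: ndg.
apply: nearW => n.
rewrite (_ : (\int[leb]_x g n x)%E = \int[leb]_(x in I n) (x `^ (- b))%:E)%E; last first.
  rewrite [RHS]integral_mkcond; apply: eq_integral => x _.
  rewrite /g patchE indicE; case: (x \in I n); by rewrite ?mul1r ?mul0r.
rewrite integral_powR01//.
  by rewrite lee_fin ler_pdivrMr ?subr_gt0// mulVf ?subr_eq0 ?gt_eqF// gerBl powR_ge0.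
by rewrite invf_lt1// ltr1n.
Qed.

(** A majorant on the line, integrable when [b < 1]: the first term controls infinity, the other two
    carry [|x|^(- b)] on either side of the origin. *)
Definition sing_weight (b : R) (x : R) : R :=
  (1 + x ^+ 2)^-1 + (\1_(`]0, 1]%classic : set R) x * x `^ (- b) +
  \1_(`]0, 1]%classic : set R) (- x) * (- x) `^ (- b)).

Lemma sing_weight_ge0 b x : 0 <= sing_weight b x.
Proof.
by rewrite !addr_ge0 ?mulr_ge0 ?powR_ge0// invr_ge0 addr_ge0// sqr_ge0.
Qed.

Lemma measurable_sing_weight b : measurable_fun setT (sing_weight b).
Proof.
have m1 : measurable_fun setT (fun x : R => \1_(`]0, 1]%classic : set R) x * x `^ (- b)).
  exact: measurable_funM.
apply: measurable_funD; last apply: measurable_funD => //.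
  by apply: continuous_measurable_fun; exact: continuous_oneDsqrV.
exact: (measurableT_comp m1 (@oppr_measurable R setT)).
Qed.

Lemma integral_sing_weight b : b < 1 -> (\int[leb]_x (sing_weight b x)%:E < +oo)%E.
Proof.
move=> b1.
have m0 : measurable_fun setT (fun x : R => (1 + x ^+ 2)^-1).
  by apply: continuous_measurable_fun; exact: continuous_oneDsqrV.
have m1 : measurable_fun setT (fun x : R => \1_(`]0, 1]%classic : set R) x * x `^ (- b)).
  exact: measurable_funM.
have m2 := measurableT_comp m1 (@oppr_measurable R setT).
have p0 x : 0 <= (1 + x ^+ 2)^-1 :> R by rewrite invr_ge0 addr_ge0// sqr_ge0.
have p1 (x : R) : 0 <= \1_(`]0, 1]%classic : set R) x * x `^ (- b) by rewrite mulr_ge0 ?powR_ge0.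
under eq_integral do rewrite /sing_weight EFinD EFinD.
rewrite ge0_integralD//; last 4 first.
- by move=> x _; rewrite lee_fin.
- by apply/measurable_EFinP.
- by move=> x _; rewrite adde_ge0// lee_fin.
- by apply: emeasurable_funD; apply/measurable_EFinP.
rewrite ge0_integralD//; last 4 first.
- by move=> x _; rewrite lee_fin.
- by apply/measurable_EFinP.
- by move=> x _; rewrite lee_fin.
- by apply/measurable_EFinP.
rewrite lte_add_pinfty//; first exact: integral_oneDsqrV_lty.
rewrite lte_add_pinfty//; first exact: integral_powR01_lty.
have n1 : (-1 : R) != 0 by rewrite oppr_eq0 oner_neq0.
rewrite (_ : integral _ _ _ = (\int[leb]_x
    ((\1_(`]0, 1]%classic : set R) (-1 * x + 0) * (-1 * x + 0) `^ (- b)))%:E)%E); last first.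
  by apply: eq_integral => x _; rewrite mulN1r addr0.
rewrite (@lebesgue1_affine _ (fun x : R => (\1_(`]0, 1]%classic : set R) x * x `^ (- b))%:E) _ 0 n1)//; last 1 first.
- by apply/measurable_EFinP.
by rewrite normrN1 invr1 mul1e; exact: integral_powR01_lty.
Qed.

End weights.

(** * The Euclidean norm *)

Section euclid.
Context (R : realType) (d : nat).
Local Notation E := 'rV[R]_d.
Implicit Types (x y : E) (t : R).

Lemma dotC x y : dot x y = dot y x.
Proof. by apply: eq_bigr => i _; rewrite mulrC. Qed.

Lemma dotDl x y z : dot (x + y) z = dot x z + dot y z.
Proof. by rewrite /dot -big_split /=; apply: eq_bigr => i _; rewrite mxE mulrDl. Qed.

Lemma dotZl t x y : dot (t *: x) y = t * dot x y.
Proof. by rewrite /dot mulr_sumr; apply: eq_bigr => i _; rewrite mxE mulrA. Qed.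

Lemma dotDr x y z : dot z (x + y) = dot z x + dot z y.
Proof. by rewrite dotC dotDl !(dotC z). Qed.

Lemma dotZr t x y : dot x (t *: y) = t * dot x y.
Proof. by rewrite dotC dotZl dotC. Qed.

Lemma dotNl x y : dot (- x) y = - dot x y.
Proof. by rewrite -scaleN1r dotZl mulN1r. Qed.

Lemma dotNr x y : dot x (- y) = - dot x y.
Proof. by rewrite dotC dotNl dotC. Qed.

Lemma dotBl x y z : dot (x - y) z = dot x z - dot y z.
Proof. by rewrite dotDl dotNl. Qed.

Lemma dotBr x y z : dot z (x - y) = dot z x - dot z y.
Proof. by rewrite dotDr dotNr. Qed.

Lemma dot0r x : dot x 0 = 0.
Proof. by rewrite -(scale0r 0) dotZr mul0r. Qed.

Lemma dot_delta i x : dot x (delta_mx ord0 i) = x ord0 i.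
Proof.
rewrite /dot (bigD1 i)//= mxE !eqxx mulr1 big1 ?addr0// => j ji.
by rewrite mxE (negbTE ji) andbF mulr0.
Qed.

Lemma dot_ge0 x : 0 <= dot x x.
Proof. by apply: sumr_ge0 => i _; rewrite -expr2 sqr_ge0. Qed.

Lemma enorm_ge0 x : 0 <= enorm x.
Proof. exact: sqrtr_ge0. Qed.

Lemma sqr_enorm x : enorm x ^+ 2 = dot x x.
Proof. by rewrite sqr_sqrtr// dot_ge0. Qed.

Lemma enorm0 : enorm (0 : E) = 0.
Proof. by rewrite /enorm dot0r sqrtr0. Qed.

Lemma ler_coord_enorm x i : `|x ord0 i| <= enorm x.
Proof.
rewrite -sqrtr_sqr ler_wsqrtr// /dot (bigD1 i)//= -expr2 lerDl.
by apply: sumr_ge0 => j _; rewrite -expr2 sqr_ge0.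
Qed.

Lemma enorm_eq0 x : (enorm x == 0) = (x == 0).
Proof.
apply/idP/eqP => [/eqP x0|->]; last by rewrite enorm0.
apply/rowP => i; rewrite mxE; apply/eqP; rewrite -normr_eq0 eq_le normr_ge0 andbT.
by rewrite -x0 ler_coord_enorm.
Qed.

Lemma enorm_gt0 x : (0 < enorm x) = (x != 0).
Proof. by rewrite lt_neqAle enorm_ge0 andbT eq_sym enorm_eq0. Qed.

(** The square of [dot y y *: x - dot x y *: y] is [dot y y] times the defect of the inequality. *)
Lemma cauchy_schwarz x y : `|dot x y| <= enorm x * enorm y.
Proof.
have [->|y0] := eqVneq y 0; first by rewrite dot0r normr0 enorm0 mulr0.
have yy : 0 < dot y y by rewrite -sqr_enorm exprn_gt0// enorm_gt0.
rewrite -(@ler_pXn2r _ 2)// ?nnegrE ?mulr_ge0 ?enorm_ge0//.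
rewrite exprMn !sqr_enorm real_normK ?num_real//.
have := dot_ge0 (dot y y *: x - dot x y *: y).
rewrite !(dotBl, dotBr, dotZl, dotZr) (dotC y x).
rewrite (_ : _ - _ = dot y y * (dot x x * dot y y - dot x y ^+ 2)); last by ring.
by rewrite pmulr_rge0// subr_ge0.
Qed.

Lemma ler_enormD x y : enorm (x + y) <= enorm x + enorm y.
Proof.
rewrite -(@ler_pXn2r _ 2)// ?nnegrE ?addr_ge0 ?enorm_ge0//.
rewrite sqrrD !sqr_enorm dotDl !dotDr (dotC y x).
have := le_trans (ler_norm _) (cauchy_schwarz x y); lra.
Qed.

Lemma enormZ t x : enorm (t *: x) = `|t| * enorm x.
Proof. by rewrite /enorm dotZl dotZr mulrA -expr2 sqrtrM ?sqr_ge0// sqrtr_sqr. Qed.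

Lemma enormN x : enorm (- x) = enorm x.
Proof. by rewrite -scaleN1r enormZ normrN1 mul1r. Qed.

Lemma ler_enormB x y : enorm (x - y) <= enorm x + enorm y.
Proof. by rewrite (le_trans (ler_enormD _ _))// enormN. Qed.

Lemma ler_dist_enorm x y : `|enorm x - enorm y| <= enorm (x - y).
Proof.
have h (u v : E) : enorm u - enorm v <= enorm (u - v).
  by rewrite lerBlDr -{1}(subrK v u) ler_enormD.
rewrite ler_norml h andbT lerNl opprB; apply: le_trans (h _ _) _.
by rewrite -(enormN (y - x)) opprB.
Qed.

Lemma ler_norm_enorm x : `|x| <= enorm x.
Proof.
rewrite [leLHS]/Num.norm /= mx_normrE; apply: bigmax_le; first exact: enorm_ge0.
by move=> [i j] _ /=; rewrite (ord1 i) ler_coord_enorm.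
Qed.

Lemma ler_enorm_norm x : enorm x <= d%:R * `|x|.
Proof.
have xi i : `|x ord0 i| <= `|x|.
  by rewrite [leRHS]/Num.norm /= mx_normrE; apply: (le_bigmax_cond _ (fun ij => `|x ij.1 ij.2|) (j := (ord0, i))).
apply: (@le_trans _ _ (\sum_(i < d) `|x ord0 i|)).
  rewrite -(@ler_pXn2r _ 2)// ?nnegrE ?enorm_ge0 ?sumr_ge0// sqr_enorm.
  rewrite expr2 mulr_suml ler_sum// => i _.
  rewrite -expr2 -real_normK ?num_real// expr2 ler_wpM2l// (bigD1 i)//= lerDl.
  exact: sumr_ge0.
apply: (@le_trans _ _ (\sum_(i < d) `|x|)); first exact: ler_sum.
by rewrite sumr_const card_ord mulr_natl.
Qed.

Lemma continuous_dotl y : continuous (fun x => dot x y).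
Proof.
apply: (@continuous_big R 'I_d +%R 0 xpredT _ E) => [|i _ x]; first exact: add_continuous.
have h : {for x, continuous (fun x : E => x ord0 i)} by exact: coord_continuous.
by have := continuousM h (@cst_continuous E R (y ord0 i) x).
Qed.

Lemma continuous_enorm : continuous (@enorm R d).
Proof.
have c2 : continuous (fun x : E => dot x x).
  apply: (@continuous_big R 'I_d +%R 0 xpredT _ E) => [|i _ x]; first exact: add_continuous.
  have h : {for x, continuous (fun x : E => x ord0 i)} by exact: coord_continuous.
  exact: (continuousM h h).
by move=> x; apply: (@continuous_comp _ _ _ (fun x : E => dot x x)); [exact: c2|exact: sqrt_continuous].
Qed.

Lemma measurable_enorm : measurable_fun setT (@enorm R d).
Proof. by apply: continuous_measurable_rV; exact: continuous_enorm. Qed.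

End euclid.

(** * Integrability from decay at infinity *)

Section integrable_decay.
Context (R : realType) (d : nat).
Local Notation E := 'rV[R]_d.
Local Notation lam := (lebesgue R d).
Hypothesis d0 : (0 < d)%N.
Let i0 : 'I_d := Ordinal d0.

(** The product formula with the indicator of 0 in one coordinate and 1 in the others: the factor 0
    absorbs the infinite ones. It is the null set in which the origin is discarded later. *)
Lemma lebesgue_hyperplane : lam [set x | x ord0 i0 = 0] = 0%E.
Proof.
pose w (i : nat) : R -> R := if i == 0%N then \1_[set 0] else cst 1.
have mw i : measurable_fun setT (w i).
  rewrite /w; case: (i == 0%N) => //.
have w0 i x : 0 <= w i x by rewrite /w; case: (i == 0%N).
have mA : measurable [set x : E | x ord0 i0 = 0].
  rewrite (_ : mkset _ = (fun x : E => x ord0 i0) @^-1` [set 0])//.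
  by rewrite -[X in measurable X]setTI; exact: measurable_coord.
rewrite -[X in lam X](setIT [set x : E | x ord0 i0 = 0]) -integral_indic//.
transitivity (\int[lam]_x (\prod_(i < d) w i (x ord0 i))%:E)%E; last first.
  rewrite lebesgue_prod// (bigD1 i0)//= {1}/w /= integral_indic// setIT.
  rewrite [X in (X * _)%E](_ : _ = 0%E) ?mul0e//; exact: lebesgue_measure_set1.
apply: eq_integral => x _; congr EFin.
rewrite (bigD1 i0)//= big1 ?mulr1.
  by rewrite /w /= !indicE; congr (_ %:R); apply/idP/idP; rewrite !inE.
move=> i ii0; rewrite /w ifF//; apply/negbTE; move: ii0; apply: contra => /eqP i00.
by apply/eqP/val_inj.
Qed.

(** As [|x| >= |x_0|], the whole singularity is charged to one coordinate, so that [b < 1] is enough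
    in every dimension. The power [2 * d] leaves one factor [1 / (1 + x_i^2)] per coordinate. *)
Lemma decay_weight_le (b : R) (x : E) : 0 <= b -> x ord0 i0 != 0 ->
  enorm x `^ (- b) * (1 + enorm x) ^- (2 * d) <= \prod_(i < d) sing_weight b (x ord0 i).
Proof.
move=> b0 x0.
have e0 := enorm_ge0 x.
have h i : (1 + enorm x) ^- 2 <= (1 + x ord0 i ^+ 2)^-1.
  rewrite lef_pV2 ?posrE ?exprn_gt0 ?ltr_pwDl ?sqr_ge0//.
  rewrite sqrrD expr1n mul1r -addrA lerD2l.
  rewrite -[x ord0 i ^+ 2]real_normK ?num_real// ler_wpDl ?mulrn_wge0//.
  by rewrite lerXn2r ?nnegrE// ler_coord_enorm.
have p i : 0 <= (1 + x ord0 i ^+ 2)^-1 by rewrite invr_ge0 addr_ge0// sqr_ge0.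
have q : 0 <= (1 + enorm x) ^- 2 by rewrite invr_ge0 exprn_ge0// addr_ge0.
have iq (t : R) : 0 <= \1_(`]0, 1]%classic : set R) t * t `^ (- b) by rewrite mulr_ge0 ?powR_ge0.
rewrite exprM -exprVn.
have -> : ((1 + enorm x) ^- 2) ^+ d = \prod_(i < d) (1 + enorm x) ^- 2.
  by rewrite prodr_const card_ord.
rewrite (bigD1 i0)//= [leRHS](bigD1 i0)//= mulrA.
have x0p : 0 < `|x ord0 i0| by rewrite normr_gt0.
apply: ler_pM.
- by rewrite mulr_ge0// powR_ge0.
- by apply: prodr_ge0.
- apply: (@le_trans _ _ (`|x ord0 i0| `^ (- b) * (1 + x ord0 i0 ^+ 2)^-1)).
    apply: ler_pM => //; first exact: powR_ge0.
    rewrite !powRN lef_pV2 ?posrE ?powR_gt0//.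
      by rewrite ge0_ler_powR// ?nnegrE// ler_coord_enorm.
    by apply: lt_le_trans x0p _; exact: ler_coord_enorm.
  rewrite /sing_weight.
  (* The weight is singular on [|x_0| <= 1] only; beyond, [|x_0|^(- b)] is at most 1. *)
  have [x1|x1] := leP `|x ord0 i0| 1; last first.
    apply: ler_wpDr; first exact: addr_ge0.
    rewrite ler_piMl// powRN invf_le1 ?powR_gt0//.
    by rewrite -(powRr0 `|x ord0 i0|) ler_powR// ltW.
  apply: ler_wpDl => //.
  apply: (@le_trans _ _ (`|x ord0 i0| `^ (- b))).
    by rewrite ler_piMr ?powR_ge0// invf_le1 ?ltr_pwDl ?sqr_ge0// lerDl sqr_ge0.
  have [xp|xn] := ltP 0 (x ord0 i0).
    apply: ler_wpDr => //.
    by move: x1; rewrite gtr0_norm// indicE mem_setE in_itv /= xp => ->; rewrite mul1r.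
  have {}xn : x ord0 i0 < 0 by rewrite lt_neqAle x0.
  apply: ler_wpDl => //.
  by move: x1; rewrite ltr0_norm// indicE mem_setE in_itv /= oppr_gt0 xn => ->; rewrite mul1r.
- apply: ler_prod => i _; rewrite q /=; apply: le_trans (h i) _.
  by rewrite /sing_weight lerDl addr_ge0.
Qed.

Lemma integrable_decay_sing (b C : R) (f : E -> R) : 0 <= b -> b < 1 ->
  measurable_fun setT f ->
  (forall x, `|f x| <= C * (enorm x `^ (- b) * (1 + enorm x) ^- (2 * d))) ->
  lam.-integrable setT (EFin \o f).
Proof.
move=> b0 b1 mf fC.
have mA : measurable [set x : E | x ord0 i0 = 0].
  rewrite (_ : mkset _ = (fun x : E => x ord0 i0) @^-1` [set 0])//.
  by rewrite -[X in measurable X]setTI; exact: measurable_coord.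
apply/(@negligible_integrable _ _ _ _ _ [set x : E | x ord0 i0 = 0]) => //.
- exact/measurable_EFinP.
- exact: lebesgue_hyperplane.
(* Read off the bound at a coordinate vector, where the weight is positive. *)
have C0 : 0 <= C.
  have h : 0 < enorm (delta_mx ord0 i0 : E) `^ (- b) * (1 + enorm (delta_mx ord0 i0 : E)) ^- (2 * d).
    have en0 : 0 < enorm (delta_mx ord0 i0 : E).
      by apply: lt_le_trans (ler_coord_enorm _ i0); rewrite mxE !eqxx normr1.
    by rewrite mulr_gt0 ?powR_gt0// invr_gt0 exprn_gt0// addr_gt0.
  by rewrite -(pmulr_lge0 _ h); apply: le_trans (fC (delta_mx ord0 i0)).
apply: (@le_integrable _ _ _ lam _ (measurableD measurableT mA) _
  (fun x => (C * \prod_(i < d) sing_weight b (x ord0 i))%:E)).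
- by apply: measurable_funS (measurableT) _ _ => //; exact/measurable_EFinP.
- move=> x [_ /= /eqP x0]; rewrite lee_fin.
  apply: le_trans (fC x) _; apply: le_trans (ler_norm _).
  by rewrite ler_wpM2l// decay_weight_le.
- apply: (@integrableS _ _ _ lam setT) => //; first exact: measurableD.
  under eq_fun do rewrite EFinM.
  apply: integrableZl => //.
  apply: (@integrable_prod_weight _ _ (fun=> sing_weight b)).
  + by move=> i; exact: measurable_sing_weight.
  + by move=> i x; exact: sing_weight_ge0.
  + by move=> i; exact: integral_sing_weight.
Qed.

Lemma integrable_decay (C : R) (f : E -> R) : measurable_fun setT f ->
  (forall x, (1 + enorm x) ^+ (2 * d) * `|f x| <= C) ->
  lam.-integrable setT (EFin \o f).
Proof.
move=> mf fC; apply: (@integrable_decay_sing 0 C) => // x.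
rewrite oppr0 powRr0 mul1r ler_pdivlMr ?exprn_gt0 ?ltr_pwDl ?enorm_ge0//.
by rewrite mulrC.
Qed.

End integrable_decay.

(** * Smooth and Schwartz functions *)

Section gradient.
Context (R : realType) (d : nat).
Local Notation E := 'rV[R]_d.
Implicit Types (f g h : E -> R) (x : E).

(** Partial derivatives alone do not give differentiability, which [smooth] requires at each order;
    the two are propagated together. *)
Definition grad_at f x (u : 'I_d -> R) : Prop :=
  differentiable f x /\ forall i, partial i f x = u i.

Lemma grad_at_partial f x : differentiable f x -> grad_at f x (fun i => partial i f x).
Proof. by []. Qed.

Lemma grad_at_eq f x u v : grad_at f x u -> (forall i, u i = v i) -> grad_at f x v.
Proof. by move=> [df fu] uv; split => // i; rewrite fu. Qed.

Lemma grad_at_cst (c : R) x : grad_at (fun=> c) x (fun=> 0).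
Proof.
split; first exact: differentiable_cst.
by move=> i; rewrite /partial derive_cst.
Qed.

Lemma grad_atD f g x u v : grad_at f x u -> grad_at g x v ->
  grad_at (fun y => f y + g y) x (fun i => u i + v i).
Proof.
move=> [df fu] [dg gv]; split; first exact: differentiableD.
move=> i; rewrite -fu -gv /partial.
by rewrite (_ : (fun y => f y + g y) = f + g)// deriveD//; exact: diff_derivable.
Qed.

Lemma grad_atM f g x u v : grad_at f x u -> grad_at g x v ->
  grad_at (fun y => f y * g y) x (fun i => u i * g x + f x * v i).
Proof.
move=> [df fu] [dg gv]; split; first exact: differentiableM.
move=> i; rewrite -fu -gv /partial.
rewrite (_ : (fun y => f y * g y) = f * g)// deriveM//; try exact: diff_derivable.
by rewrite addrC /GRing.scale /= mulrC.
Qed.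

Lemma grad_atZ (c : R) f x u : grad_at f x u ->
  grad_at (fun y => c * f y) x (fun i => c * u i).
Proof.
move=> fu; apply: grad_at_eq (grad_atM (grad_at_cst c x) fu) _ => i.
by rewrite mul0r add0r.
Qed.

Lemma grad_atN f x u : grad_at f x u -> grad_at (fun y => - f y) x (fun i => - u i).
Proof.
move=> [df fu]; split; first exact: differentiableN.
by move=> i; rewrite -fu /partial (_ : (fun y => - f y) = - f)// deriveN//; exact: diff_derivable.
Qed.

Lemma grad_at_sum (I : Type) (r : seq I) (F : I -> E -> R) (u : I -> 'I_d -> R) x :
  (forall k, grad_at (F k) x (u k)) ->
  grad_at (fun y => \sum_(k <- r) F k y) x (fun i => \sum_(k <- r) u k i).
Proof.
move=> FP; elim: r => [|k r IH].
  rewrite (_ : (fun y => _) = fun=> 0).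
    by apply: grad_at_eq (grad_at_cst 0 x) _ => i; rewrite big_nil.
  by apply/funext => y; rewrite big_nil.
rewrite (_ : (fun y => _) = fun y => F k y + \sum_(j <- r) F j y).
  by apply: grad_at_eq (grad_atD (FP k) IH) _ => i; rewrite big_cons.
by apply/funext => y; rewrite big_cons.
Qed.

Lemma grad_at_coord j x : grad_at (fun y : E => y ord0 j) x (fun i => (i == j)%:R).
Proof.
have dc : differentiable (fun y : E => y ord0 j) x by exact: differentiable_coord.
split => // i; rewrite /partial.
have @f : {linear 'rV[R]_d -> R}.
  by exists (fun N : E => N ord0 j); do 2![eexists]; do ?[constructor];
     rewrite ?mxE// => ? *; rewrite ?mxE//; move=> ?; rewrite !mxE.
rewrite deriveE// (_ : (fun _ => _) = f)// diff_lin; last exact: coord_continuous.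
by rewrite /= mxE eqxx /= eq_sym.
Qed.

Lemma grad_at_dotl y x : grad_at (fun z => dot z y) x (fun i => y ord0 i).
Proof.
apply: grad_at_eq (grad_at_sum _ _) _.
  by move=> k; exact: (grad_atM (grad_at_coord k x) (grad_at_cst (y ord0 k) x)).
move=> i; rewrite (bigD1 i)//= eqxx mul1r mulr0 addr0 big1 ?addr0// => j ji.
by rewrite eq_sym (negbTE ji) mul0r mulr0 addr0.
Qed.

Lemma grad_at_sqr x : grad_at (fun z => dot z z) x (fun i => 2 * x ord0 i).
Proof.
apply: grad_at_eq (grad_at_sum _ _) _.
  by move=> k; exact: (grad_atM (grad_at_coord k x) (grad_at_coord k x)).
move=> i; rewrite (bigD1 i)//= eqxx mul1r mulr1 big1 ?addr0.
  by rewrite mulr_natl mulr2n.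
by move=> j ji; rewrite eq_sym (negbTE ji) mul0r mulr0 addr0.
Qed.

Lemma grad_at_comp (h : R -> R) (h' : R) f x u : is_derive (f x) 1 h h' -> grad_at f x u ->
  grad_at (fun y => h (f y)) x (fun i => h' * u i).
Proof.
move=> [dh hE] [df fu].
have dh' : differentiable h (f x) by exact/derivable1_diffP.
split; first exact: (differentiable_comp df dh').
move=> i; rewrite -fu /partial deriveE; last exact: (differentiable_comp df dh').
rewrite (_ : (fun y => h (f y)) = h \o f)// (diff_comp df dh') /=.
rewrite -hE !deriveE//; set t := 'd f x _.
by rewrite -{1}[t]mulr1 -[t * 1]/(t *: (1 : R)) linearZ /= /GRing.scale /= mulrC.
Qed.

(** The parameter [v] comes first so that the form can be declared linear. *)
Definition dotr (v x : E) : R := dot x v.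

Let dotr_linear v : linear_for *:%R (dotr v : E -> R^o).
Proof. by move=> c x y; rewrite /dotr dotDl dotZl. Qed.

HB.instance Definition _ v := GRing.isLinear.Build R E R^o *:%R (dotr v : E -> R^o) (dotr_linear v).

(** One first-order expansion encodes both components of [grad_at]. It makes the notion local and
    accessible to functions given by integrals. *)
Lemma grad_atP f x u : grad_at f x u <->
  forall e, 0 < e -> \forall h \near (0 : E),
    `|f (h + x) - f x - \sum_i u i * h ord0 i| <= e * `|h|.
Proof.
pose v : E := \row_i u i.
have sE (h : E) : \sum_i u i * h ord0 i = dotr v h.
  by apply: eq_bigr => i _; rewrite mxE mulrC.
have cv : continuous (dotr v) by exact: continuous_dotl.
split=> [[df fu] e e0|H].
  have := df; move=> /diff_locallyP[_ /eqaddoP/(_ e e0)].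
  apply: filterS => h /=.
  rewrite /cst /= !fctE /= /shift /= opprD addrA.
  rewrite sE.
  suff -> : 'd f x h = dotr v h by [].
  rewrite {1}(row_sum_delta h) linear_sum /dotr /dot; apply: eq_bigr => i _.
  by rewrite linearZ /= mxE -fu /partial deriveE.
have H' (e : R) : 0 < e -> \forall h \near (0 : E),
    `|(f \o shift x - (cst (f x) + dotr v)) h| <= e * `|id h|.
  move=> e0; have := H _ e0; apply: filterS => h.
  by rewrite /= !fctE /= /shift /= sE opprD addrA.
have dE : 'd f x = dotr v :> (E -> R).
  by apply: (@diff_unique _ E R^o f (dotr v)) => //; apply/eqaddoP.
have df : differentiable f x.
  apply/diff_locallyP; rewrite dE; split => //.
  by apply/eqaddoP.
split => // i; rewrite /partial deriveE// dE /dotr dotC dot_delta mxE //.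
Qed.

Lemma grad_at_near f g x u : (\forall y \near x, f y = g y) -> grad_at f x u -> grad_at g x u.
Proof.
move=> fg /grad_atP H; apply/grad_atP => e e0.
have fgx : f x = g x by exact: nbhs_singleton fg.
have fgh : \forall h \near (0 : E), f (h + x) = g (h + x).
  by have := fg; rewrite (near_shift 0 x) /= ; apply: filterS => h /=; rewrite subr0.
by apply: filterS2 fgh (H _ e0) => h <-; rewrite fgx.
Qed.

Lemma grad_at_near0 f x : (\forall y \near x, f y = 0) -> grad_at f x (fun=> 0).
Proof.
move=> f0; apply: grad_at_near (grad_at_cst 0 x).
by apply: filterS f0 => y ->.
Qed.

Lemma grad_at_affine f (t : R) (v x : E) u : grad_at f (t *: x + v) u ->
  grad_at (fun y => f (t *: y + v)) x (fun i => t * u i).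
Proof.
move=> /grad_atP H; apply/grad_atP => e e0.
(* The added 1 also covers [t = 0]. *)
have e1 : 0 < e / (`|t| + 1) by rewrite divr_gt0// ltr_pwDr.
have th : (fun h : E => t *: h) h @[h --> (0 : E)] --> (0 : E).
  by have := @scaler_continuous _ E t (0 : E); rewrite /continuous_at (scaler0 E t).
have Q : \forall h \near (0 : E), `|f (t *: h + (t *: x + v)) - f (t *: x + v) -
    \sum_i u i * (t *: h) ord0 i| <= e / (`|t| + 1) * `|t *: h| := th _ (H _ e1).
apply: filterS Q => h /= hh.
rewrite scalerDr -[t *: h + _ + _]addrA.
rewrite (_ : \sum_i _ = \sum_i u i * (t *: h) ord0 i); last first.
  by apply: eq_bigr => i _; rewrite mxE; ring.
apply: le_trans hh _; rewrite normrZ mulrA ler_wpM2r//.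
by rewrite mulrAC ler_pdivrMr ?ltr_pwDr// ler_wpM2l ?lerDl// ltW.
Qed.

End gradient.

Section smooth.
Context (R : realType) (d : nat).
Local Notation E := 'rV[R]_d.
Implicit Types (f g h : E -> R) (x : E) (s : seq 'I_d) (P S : (E -> R) -> Prop).

Lemma partials_rcons s i f : partials (rcons s i) f = partials s (partial i f).
Proof. by rewrite /partials -cats1 foldr_cat. Qed.

(** Smoothness by coinduction: a class of differentiable functions stable under partial derivatives
    suffices. The innermost derivative is peeled off, so the class need only be stable under one
    derivative at a time. *)
Lemma smooth_coind P :
  (forall f, P f -> (forall x, differentiable f x) /\ forall i, P (partial i f)) ->
  forall f, P f -> smooth f.
Proof.
move=> H f Pf s; elim/last_ind: s f Pf => [|s i IH] f Pf x; first exact: (H f Pf).1.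
by rewrite partials_rcons; apply: IH; exact: (H f Pf).2.
Qed.

Lemma smooth_diff f x : smooth f -> differentiable f x.
Proof. by move=> /(_ [::]). Qed.

Lemma smooth_partial i f : smooth f -> smooth (partial i f).
Proof. by move=> sf s x; rewrite -partials_rcons. Qed.

Lemma smooth_partials s f : smooth f -> smooth (partials s f).
Proof. by elim: s f => //= i s IH f sf; apply: smooth_partial; exact: IH. Qed.

Lemma smooth_continuous f : smooth f -> continuous f.
Proof. by move=> sf x; apply: differentiable_continuous; exact: smooth_diff. Qed.

Lemma smooth_measurable f : smooth f -> measurable_fun setT f.
Proof. by move=> /smooth_continuous; exact: continuous_measurable_rV. Qed.

(** The Leibniz and chain rules lead out of a class [S] but stay in the algebra that it generates;
    this algebra is the class to which coinduction is applied. *)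
Inductive alg S : (E -> R) -> Prop :=
| alg_base f : S f -> alg S f
| alg_cst c : alg S (fun=> c)
| alg_add f g : alg S f -> alg S g -> alg S (fun x => f x + g x)
| alg_mul f g : alg S f -> alg S g -> alg S (fun x => f x * g x).

Lemma alg_opp S f : alg S f -> alg S (fun x => - f x).
Proof.
move=> af; rewrite (_ : (fun x => - f x) = fun x => -1 * f x).
  by apply: alg_mul => //; exact: alg_cst.
by apply/funext => x; rewrite mulN1r.
Qed.

Lemma alg_sum S (I : Type) (r : seq I) (F : I -> E -> R) :
  (forall k, alg S (F k)) -> alg S (fun x => \sum_(k <- r) F k x).
Proof.
move=> aF; elim: r => [|k r IH].
  rewrite (_ : (fun x => _) = fun=> 0); first exact: alg_cst.
  by apply/funext => x; rewrite big_nil.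
rewrite (_ : (fun x => _) = fun x => F k x + \sum_(j <- r) F j x); first exact: alg_add.
by apply/funext => x; rewrite big_cons.
Qed.

Lemma alg_grad S : (forall f, S f -> forall x, differentiable f x) ->
  (forall f i, S f -> alg S (partial i f)) ->
  forall f, alg S f -> (forall x, differentiable f x) /\ forall i, alg S (partial i f).
Proof.
move=> dS pS f; elim => {f} [f Sf|c|f g _ [df pf] _ [dg pg]|f g af [df pf] ag [dg pg]].
- by split=> [x|i]; [exact: dS|exact: pS].
- split=> [x|i]; first by have [] := grad_at_cst c x.
  rewrite (_ : partial i _ = fun=> 0); first exact: alg_cst.
  by apply/funext => x; have [_ ->] := grad_at_cst c x.
- have h x := grad_atD (grad_at_partial (df x)) (grad_at_partial (dg x)).
  split=> [x|i]; first by have [] := h x.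
  rewrite (_ : partial i _ = fun x => partial i f x + partial i g x); first exact: alg_add.
  by apply/funext => x; have [_ ->] := h x.
- have h x := grad_atM (grad_at_partial (df x)) (grad_at_partial (dg x)).
  split=> [x|i]; first by have [] := h x.
  rewrite (_ : partial i _ = fun x => partial i f x * g x + f x * partial i g x).
    by apply: alg_add; apply: alg_mul.
  by apply/funext => x; have [_ ->] := h x.
Qed.

Lemma alg_smooth S : (forall f, S f -> forall x, differentiable f x) ->
  (forall f i, S f -> alg S (partial i f)) -> forall f, alg S f -> smooth f.
Proof. by move=> dS pS; apply: smooth_coind; exact: alg_grad. Qed.

Lemma alg_smooth_smooth f : alg (@smooth R d) f -> smooth f.
Proof.
apply: alg_smooth => [g sg x|g i sg]; first exact: smooth_diff.
by apply: alg_base; exact: smooth_partial.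
Qed.

Lemma smoothD f g : smooth f -> smooth g -> smooth (fun x => f x + g x).
Proof. by move=> sf sg; apply: alg_smooth_smooth; apply: alg_add; exact: alg_base. Qed.

Lemma smoothM f g : smooth f -> smooth g -> smooth (fun x => f x * g x).
Proof. by move=> sf sg; apply: alg_smooth_smooth; apply: alg_mul; exact: alg_base. Qed.

Lemma smooth_cst c : smooth (fun _ : E => c).
Proof. by apply: alg_smooth_smooth; exact: alg_cst. Qed.

Lemma smoothN f : smooth f -> smooth (fun x => - f x).
Proof. by move=> sf; apply: alg_smooth_smooth; apply: alg_opp; exact: alg_base. Qed.

Lemma smooth_affine f (t : R) (v : E) : smooth f -> smooth (fun x => f (t *: x + v)).
Proof.
(* The constant [c] collects the factor [t] produced by each derivative. *)
move=> sf; pose P g := exists c h, smooth h /\ g = fun x => c * h (t *: x + v).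
apply: (@smooth_coind P); last first.
  by exists 1, f; split => //; apply/funext => x; rewrite mul1r.
move=> _ [c [h [sh ->]]].
have H x := grad_atZ c (grad_at_affine (grad_at_partial (smooth_diff (t *: x + v) sh))).
split=> [x|i]; first by have [] := H x.
exists (c * t), (partial i h); split; first exact: smooth_partial.
by apply/funext => x; have [_ ->] := H x; rewrite mulrA.
Qed.

Lemma partial_add i f g : (forall x, differentiable f x) -> (forall x, differentiable g x) ->
  partial i (fun x => f x + g x) = fun x => partial i f x + partial i g x.
Proof.
move=> df dg; apply/funext => x.
by have [_ ->] := grad_atD (grad_at_partial (df x)) (grad_at_partial (dg x)).
Qed.

Lemma partial_mul i f g : (forall x, differentiable f x) -> (forall x, differentiable g x) ->
  partial i (fun x => f x * g x) = fun x => partial i f x * g x + f x * partial i g x.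
Proof.
move=> df dg; apply/funext => x.
by have [_ ->] := grad_atM (grad_at_partial (df x)) (grad_at_partial (dg x)).
Qed.

Lemma partials_add s f g : smooth f -> smooth g ->
  partials s (fun x => f x + g x) = fun x => partials s f x + partials s g x.
Proof.
move=> sf sg; elim: s => //= i s ->.
by apply: partial_add => x; apply: smooth_diff; exact: smooth_partials.
Qed.

Lemma partials_scale s (c : R) f : smooth f ->
  partials s (fun x => c * f x) = fun x => c * partials s f x.
Proof.
move=> sf; elim: s => //= i s ->; apply/funext => x.
by have [_ ->] := grad_atZ c (grad_at_partial (smooth_diff x (smooth_partials s sf))).
Qed.

End smooth.

(** * Growth, decay and Schwartz multipliers *)

Section growth.
Context (R : realType) (d : nat).
Local Notation E := 'rV[R]_d.
Implicit Types (f g h : E -> R) (x : E) (s : seq 'I_d) (P S : (E -> R) -> Prop).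

Definition tame f : Prop :=
  exists N C, forall x, `|f x| <= C * (1 + enorm x) ^+ N.

Definition rapid f : Prop :=
  forall k, exists C, forall x, (1 + enorm x) ^+ k * `|f x| <= C.

(* The multipliers of the Schwartz space. *)
Definition OM f : Prop := smooth f /\ forall s, tame (partials s f).

Lemma enorm1_ge1 x : 1 <= 1 + enorm x.
Proof. by rewrite lerDl enorm_ge0. Qed.

Lemma enorm1_gt0 x : 0 < 1 + enorm x.
Proof. by rewrite (lt_le_trans ltr01)// enorm1_ge1. Qed.

Lemma tame_cst c : tame (fun=> c).
Proof. by exists 0%N, `|c| => x; rewrite expr0 mulr1. Qed.

Lemma tame_coord i : tame (fun x => x ord0 i).
Proof.
exists 1%N, 1 => x; rewrite mul1r expr1 (le_trans (ler_coord_enorm x i))//.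
by rewrite lerDr.
Qed.

Lemma tameM f g : tame f -> tame g -> tame (fun x => f x * g x).
Proof.
move=> [N [C fC]] [M [D gD]]; exists (N + M)%N, (C * D) => x.
by rewrite normrM exprD mulrACA ler_pM.
Qed.

Lemma tame_ge0 f : tame f -> exists N C, 0 <= C /\ forall x, `|f x| <= C * (1 + enorm x) ^+ N.
Proof.
move=> [N [C fC]]; exists N, `|C|; split => // x.
by apply: le_trans (fC x) _; rewrite ler_wpM2r ?ler_norm// exprn_ge0// ltW ?enorm1_gt0.
Qed.

Lemma tameD f g : tame f -> tame g -> tame (fun x => f x + g x).
Proof.
move=> /tame_ge0[N [C [C0 fC]]] /tame_ge0[M [D [D0 gD]]]; exists (N + M)%N, (C + D) => x.
apply: le_trans (ler_normD _ _) _; rewrite mulrDl; apply: lerD.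
  by apply: le_trans (fC x) _; rewrite ler_wpM2l// ler_weXn2l ?enorm1_ge1// leq_addr.
by apply: le_trans (gD x) _; rewrite ler_wpM2l// ler_weXn2l ?enorm1_ge1// leq_addl.
Qed.

Lemma tame_rapid f g : tame f -> rapid g -> rapid (fun x => f x * g x).
Proof.
move=> /tame_ge0[N [C [C0 fC]]] rg k; have [D gD] := rg (k + N)%N.
exists (C * D) => x; rewrite normrM.
apply: (@le_trans _ _ (C * ((1 + enorm x) ^+ (k + N) * `|g x|))); last by rewrite ler_wpM2l.
rewrite exprD [leRHS](_ : _ = (1 + enorm x) ^+ k * ((C * (1 + enorm x) ^+ N) * `|g x|)); last by ring.
apply: ler_wpM2l; first by rewrite exprn_ge0// ltW// enorm1_gt0.
exact: ler_wpM2r.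
Qed.

Lemma rapidD f g : rapid f -> rapid g -> rapid (fun x => f x + g x).
Proof.
move=> rf rg k; have [C fC] := rf k; have [D gD] := rg k; exists (C + D) => x.
apply: le_trans (lerD (fC x) (gD x)); rewrite -mulrDr ler_wpM2l ?ler_normD//.
by rewrite exprn_ge0// ltW ?enorm1_gt0.
Qed.

Lemma rapid_tame f : rapid f -> tame f.
Proof. by move=> /(_ 0%N)[C fC]; exists 0%N, C => x; have := fC x; rewrite expr0 mul1r mulr1. Qed.

Lemma alg_tame S f : (forall g, S g -> tame g) -> alg S f -> tame f.
Proof.
move=> tS; elim => {f} [f /tS//|c|f g _ + _|f g _ + _]; first exact: tame_cst.
  exact: tameD.
exact: tameM.
Qed.

Lemma OM_coind P : (forall f, P f -> tame f) ->
  (forall f, P f -> (forall x, differentiable f x) /\ forall i, P (partial i f)) ->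
  forall f, P f -> OM f.
Proof.
move=> tP H f Pf; split; first exact: smooth_coind H _ Pf.
suff: forall s, P (partials s f) by move=> h s; exact: tP.
by elim=> //= i s /H[].
Qed.

Lemma alg_OM S : (forall f, S f -> tame f) -> (forall f, S f -> forall x, differentiable f x) ->
  (forall f i, S f -> alg S (partial i f)) -> forall f, alg S f -> OM f.
Proof.
move=> tS dS pS; apply: OM_coind; first by move=> f; exact: alg_tame.
exact: alg_grad.
Qed.

Lemma OM_partial f i : OM f -> OM (partial i f).
Proof.
move=> [sf tf]; split; first exact: smooth_partial.
by move=> s; rewrite -partials_rcons.
Qed.

Lemma OM_alg f : alg OM f -> OM f.
Proof.
apply: alg_OM => [g [_ /(_ [::])]//|g [sg _] x|g i Og]; first exact: smooth_diff.
by apply: alg_base; exact: OM_partial.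
Qed.

Lemma OMD f g : OM f -> OM g -> OM (fun x => f x + g x).
Proof. by move=> Of Og; apply: OM_alg; apply: alg_add; exact: alg_base. Qed.

Lemma OMM f g : OM f -> OM g -> OM (fun x => f x * g x).
Proof. by move=> Of Og; apply: OM_alg; apply: alg_mul; exact: alg_base. Qed.

Lemma OM_cst c : OM (fun=> c).
Proof. by apply: OM_alg; exact: alg_cst. Qed.

Lemma OM_sum (I : Type) (r : seq I) (F : I -> E -> R) :
  (forall k, OM (F k)) -> OM (fun x => \sum_(k <- r) F k x).
Proof. by move=> OF; apply: OM_alg; apply: alg_sum => k; exact: alg_base. Qed.

Lemma OM_coord j : OM (fun x => x ord0 j).
Proof.
pose S g := g = fun x : E => x ord0 j.
apply: (@alg_OM S) => [f ->|f -> x|f i ->|]; last by apply: alg_base.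
- exact: tame_coord.
- by have [] := grad_at_coord j x.
- rewrite (_ : partial i _ = fun=> (i == j)%:R); first exact: alg_cst.
  by apply/funext => x; have [_ ->] := grad_at_coord j x.
Qed.

Lemma OM_sqr : OM (fun x => dot x x).
Proof. by apply: OM_sum => k; apply: OMM; exact: OM_coord. Qed.

Lemma OM_exp f n : OM f -> OM (fun x => f x ^+ n).
Proof.
move=> Of; elim: n => [|n IH].
  by rewrite (_ : (fun x => _) = fun=> 1); [exact: OM_cst|apply/funext => x; rewrite expr0].
by rewrite (_ : (fun x => _) = fun x => f x * f x ^+ n); [exact: OMM|apply/funext => x; rewrite exprS].
Qed.

(** Each function occurs in the derivatives of the other, so both are treated in one class. *)
Lemma OM_cos_sin y : OM (fun x => cos (dot x y)) /\ OM (fun x => sin (dot x y)).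
Proof.
pose S g := g = (fun x : E => cos (dot x y)) \/ g = (fun x : E => sin (dot x y)).
have tS f : S f -> tame f.
  by move=> [->|->]; exists 0%N, 1 => x; rewrite expr0 mulr1;
    [exact: cos_max|exact: sin_max].
have gc x := grad_at_comp (f := fun z => dot z y) (is_derive_cos (dot x y)) (grad_at_dotl y x).
have gs x := grad_at_comp (f := fun z => dot z y) (is_derive_sin (dot x y)) (grad_at_dotl y x).
have dS f : S f -> forall x, differentiable f x.
  by move=> [->|->] x; [have [] := gc x|have [] := gs x].
have pS f i : S f -> alg S (partial i f).
  move=> [->|->].
    rewrite (_ : partial i _ = fun x => - sin (dot x y) * y ord0 i).
      by apply: alg_mul; [apply: alg_opp; apply: alg_base; right|exact: alg_cst].
    by apply/funext => x; have [_ ->] := gc x.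
  rewrite (_ : partial i _ = fun x => cos (dot x y) * y ord0 i).
    by apply: alg_mul; [apply: alg_base; left|exact: alg_cst].
  by apply/funext => x; have [_ ->] := gs x.
by split; apply: (@alg_OM S) => //; apply: alg_base; [left|right].
Qed.

Lemma schwartz_coind P : (forall f, P f -> rapid f) ->
  (forall f, P f -> (forall x, differentiable f x) /\ forall i, P (partial i f)) ->
  forall f, P f -> schwartz f.
Proof.
move=> rP H f Pf; split; first exact: smooth_coind H _ Pf.
suff: forall s, P (partials s f) by move=> h k s; exact: rP.
by elim=> //= i s /H[].
Qed.

Lemma schwartz_smooth f : schwartz f -> smooth f.
Proof. by case. Qed.

Lemma schwartz_rapid f : schwartz f -> rapid f.
Proof. by move=> [_ h] k; exact: h k [::]. Qed.

Lemma schwartz_partial i f : schwartz f -> schwartz (partial i f).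
Proof.
move=> [sf h]; split; first exact: smooth_partial.
by move=> k s; rewrite -partials_rcons.
Qed.

Lemma schwartz_OM f : schwartz f -> OM f.
Proof.
move=> [sf h]; split => // s; apply: rapid_tame => k; exact: h.
Qed.

(** A derivative of a product is a sum of two products of the same kind, hence the closure under
    sums. *)
Inductive OMspan : (E -> R) -> Prop :=
| OMspan_base f g : OM f -> schwartz g -> OMspan (fun x => f x * g x)
| OMspan_add f g : OMspan f -> OMspan g -> OMspan (fun x => f x + g x).

Lemma OMspan_schwartz f : OMspan f -> schwartz f.
Proof.
apply: schwartz_coind => {}f.
  elim => {f} [f g [_ /(_ [::]) tf] /schwartz_rapid rg|f g _ + _]; first exact: tame_rapid.
  exact: rapidD.
elim => {f} [f g Of Sg|f g _ [df pf] _ [dg pg]].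
- have df x : differentiable f x by apply: smooth_diff; case: Of.
  have dg x : differentiable g x by apply: smooth_diff; case: Sg.
  split=> [x|i].
    by have [] := grad_atM (grad_at_partial (df x)) (grad_at_partial (dg x)).
  rewrite partial_mul//; apply: OMspan_add; apply: OMspan_base => //.
    exact: OM_partial.
  exact: schwartz_partial.
- split=> [x|i].
    by have [] := grad_atD (grad_at_partial (df x)) (grad_at_partial (dg x)).
  by rewrite partial_add//; exact: OMspan_add.
Qed.

Lemma schwartz_mul f g : OM f -> schwartz g -> schwartz (fun x => f x * g x).
Proof. by move=> Of Sg; apply: OMspan_schwartz; exact: OMspan_base. Qed.

Lemma schwartz_scale c g : schwartz g -> schwartz (fun x => c * g x).
Proof. by apply: schwartz_mul; exact: OM_cst. Qed.

Lemma schwartzN g : schwartz g -> schwartz (fun x => - g x).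
Proof.
move=> Sg; rewrite (_ : (fun x => - g x) = fun x => -1 * g x); first exact: schwartz_scale.
by apply/funext => x; rewrite mulN1r.
Qed.

Lemma schwartzD f g : schwartz f -> schwartz g -> schwartz (fun x => f x + g x).
Proof.
move=> Sf Sg; rewrite (_ : (fun x => _) = fun x => 1 * f x + 1 * g x).
  by apply: OMspan_schwartz; apply: OMspan_add; apply: OMspan_base => //; exact: OM_cst.
by apply/funext => x; rewrite !mul1r.
Qed.

Lemma schwartz0 : schwartz (fun _ : E => 0).
Proof.
apply: (@schwartz_coind (fun f => f = fun=> 0)) => // f ->.
  by move=> k; exists 0 => x; rewrite normr0 mulr0.
split=> [x|i]; first by have [] := grad_at_cst 0 x.
by apply/funext => x; have [_ ->] := grad_at_cst 0 x.
Qed.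

Lemma schwartz_sum (I : Type) (r : seq I) (F : I -> E -> R) :
  (forall k, schwartz (F k)) -> schwartz (fun x => \sum_(k <- r) F k x).
Proof.
move=> aF; elim: r => [|k r IH].
  rewrite (_ : (fun x => _) = fun=> 0); first exact: schwartz0.
  by apply/funext => x; rewrite big_nil.
rewrite (_ : (fun x => _) = fun x => F k x + \sum_(j <- r) F j x); first exact: schwartzD.
by apply/funext => x; rewrite big_cons.
Qed.

End growth.

(** * Compactly supported functions *)

Section compact_support.
Context (R : realType) (d : nat).
Local Notation E := 'rV[R]_d.
Implicit Types (f g h : E -> R) (x : E) (s : seq 'I_d).

(** Equivalent to the compactness of [supp f], and easier to propagate through sums, products and
    derivatives. *)
Definition far_zero f : Prop := exists M : R, forall x, M < enorm x -> f x = 0.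

Lemma open_enorm_gt (M : R) : open [set x : E | M < enorm x].
Proof.
rewrite (_ : mkset _ = @enorm R d @^-1` [set t | M < t])//.
apply: open_comp; last exact: open_gt.
by move=> x _; exact: continuous_enorm.
Qed.

Lemma open_enorm_lt (M : R) : open [set x : E | enorm x < M].
Proof.
rewrite (_ : mkset _ = @enorm R d @^-1` [set t | t < M])//.
apply: open_comp; last exact: open_lt.
by move=> x _; exact: continuous_enorm.
Qed.

Lemma closed_enorm_le (M : R) : closed [set x : E | enorm x <= M].
Proof.
rewrite (_ : mkset _ = ~` [set x : E | M < enorm x]); first exact/open_closedC/open_enorm_gt.
by apply/seteqP; split => x /=; rewrite leNgt => /negP.
Qed.

Lemma compact_enorm_le (M : R) : compact [set x : E | enorm x <= M].
Proof.
apply: bounded_closed_compact; last exact: closed_enorm_le.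
exists M; split; first exact: num_real.
by move=> N MN x /= xM; apply: le_trans (ler_norm_enorm x) _; exact: le_trans xM (ltW MN).
Qed.

Lemma far_zero_partial f i : far_zero f -> far_zero (partial i f).
Proof.
move=> [M fM]; exists M => x Mx.
have [_ ->//] : grad_at f x (fun=> 0).
apply: grad_at_near0; have := open_enorm_gt Mx.
rewrite -/(nbhs x [set y : E | M < enorm y]) => h.
by apply: filterS h => y; exact: fM.
Qed.

Lemma continuous_far_zero_rapid f : continuous f -> far_zero f -> rapid f.
Proof.
move=> cf [M fM] k.
pose g x := (1 + enorm x) ^+ k * `|f x|.
have cg : continuous g.
  move=> x; apply: (@continuousM _ E).
    apply: (@continuous_comp _ _ _ (@enorm R d) (fun t => (1 + t) ^+ k)).
      exact: continuous_enorm.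
    apply: (@continuous_comp _ _ _ (fun t : R => 1 + t) (fun t => t ^+ k)).
      by apply: continuousD; [exact: cst_continuous|exact: cvg_id].
    exact: exprn_continuous.
  apply: (@continuous_comp _ _ _ f (fun t => `|t|)); first exact: cf.
  exact: norm_continuous.
have cgK : {within [set x : E | enorm x <= M], continuous g} by exact: continuous_subspaceT.
have := compact_bounded (continuous_compact cgK (@compact_enorm_le M)).
move=> [C [_ CP]]; exists (`|C| + 1) => x.
have C1 : C < `|C| + 1 by rewrite (le_lt_trans (ler_norm C))// ltrDl.
have [xM|xM] := leP (enorm x) M; last by rewrite fM// normr0 mulr0.
apply: le_trans (ler_norm _) _; apply: (CP _ C1); exists x => //.
Qed.

Lemma far_zero_schwartz f : smooth f -> far_zero f -> schwartz f.
Proof.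
move=> sf zf; apply: (@schwartz_coind _ _ (fun g => smooth g /\ far_zero g)) => // g [sg zg].
  by apply: continuous_far_zero_rapid => //; exact: smooth_continuous.
split=> [x|i]; first exact: smooth_diff.
by split; [exact: smooth_partial|exact: far_zero_partial].
Qed.

Lemma compact_supp_far_zero f : compact (supp f) -> far_zero f.
Proof.
move=> /compact_bounded[M [_ MP]].
have M1 : M < `|M| + 1 by rewrite (le_lt_trans (ler_norm M))// ltrDl.
exists (d%:R * (`|M| + 1)) => x Mx; apply/eqP/negPn/negP => fx.
have sx : supp f x by apply: subset_closure.
have /= xM := MP _ M1 x sx.
move: Mx; rewrite ltNge => /negP; apply.
by apply: le_trans (ler_enorm_norm x) _; rewrite ler_wpM2l.
Qed.

Lemma far_zero_compact_supp f : far_zero f -> compact (supp f).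
Proof.
move=> [M fM]; apply: (subclosed_compact _ (@compact_enorm_le M)); first exact: closed_closure.
rewrite [X in _ `<=` X](closure_id _).1; last exact: closed_enorm_le.
apply: closure_subset => x /=; apply: contraNP => /negP; rewrite -ltNge => Mx.
by rewrite fM.
Qed.

Lemma test_schwartz (Omega : set E) f : test_on Omega f -> schwartz f.
Proof. by move=> [sf /compact_supp_far_zero zf _]; exact: far_zero_schwartz. Qed.

Lemma supp_sub_closed f (A : set E) : closed A -> (forall x, ~ A x -> f x = 0) -> supp f `<=` A.
Proof.
move=> cA fA; rewrite [X in _ `<=` X](closure_id _).1//; apply: closure_subset => x /=.
by apply: contraNP => /fA ->.
Qed.

End compact_support.

(** * Dominated convergence for real-valued integrals *)

Section dct.
Context (R : realType) d (T : measurableType d) (mu : {measure set T -> \bar R}).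
Implicit Types (f g : T -> R).

(** Stated for sequences: limits at [0^'+] are converted by [cvg_at_rightP] before it is applied. *)
Lemma Rintegral_dct (f_ : nat -> T -> R) f g :
  (forall n, measurable_fun setT (f_ n)) -> measurable_fun setT f ->
  {ae mu, forall x, f_ ^~ x @ \oo --> f x} ->
  mu.-integrable setT (EFin \o g) -> (forall n x, `|f_ n x| <= g x) ->
  mu.-integrable setT (EFin \o f) /\
  (fun n => \int[mu]_x f_ n x) @ \oo --> \int[mu]_x f x.
Proof.
move=> mf_ mf fcvg ig fg.
have [||||i _ c] := @dominated_convergence _ _ _ mu setT measurableT
   (fun n => EFin \o f_ n) (EFin \o f) (EFin \o g) _ _ _ ig.
- by move=> n; exact/measurable_EFinP.
- exact/measurable_EFinP.
- by apply: filterS fcvg => x fx _; apply: cvg_EFin => //; exact: nearW.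
- by apply: aeW => x n _; rewrite lee_fin.
split => //.
have fi : (\int[mu]_x (EFin \o f) x)%E \is a fin_num by exact: integrable_fin_num.
rewrite -(fineK fi) in c.
exact: fine_cvg c.
Qed.

Lemma integrable_le f g : measurable_fun setT f -> mu.-integrable setT (EFin \o g) ->
  (forall x, `|f x| <= g x) -> mu.-integrable setT (EFin \o f).
Proof.
move=> mf ig fg; apply: le_integrable ig => //; first exact/measurable_EFinP.
by move=> x _; rewrite lee_fin (le_trans (fg x))// ler_norm.
Qed.

Lemma integrable_one : mu setT \is a fin_num -> mu.-integrable setT (EFin \o (cst 1 : T -> R)).
Proof.
move=> mufin; apply/integrableP; split; first exact/measurable_EFinP.
rewrite (_ : (fun x => _) = cst 1%E); last by apply/funext => x /=; rewrite normr1.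
by rewrite integral_cst// mul1e ltey_eq mufin.
Qed.

Lemma integrable_measurable f : mu.-integrable setT (EFin \o f) -> measurable_fun setT f.
Proof. by move=> /measurable_int/measurable_EFinP. Qed.

Lemma integrable_scale (c : R) f : mu.-integrable setT (EFin \o f) ->
  mu.-integrable setT (EFin \o (fun x => c * f x)).
Proof. by move=> fi; have := integrableZl measurableT c fi; congr (mu.-integrable _ _). Qed.

Lemma integrable_add f g : mu.-integrable setT (EFin \o f) ->
  mu.-integrable setT (EFin \o g) -> mu.-integrable setT (EFin \o (fun x => f x + g x)).
Proof. by move=> fi gi; have := integrableD measurableT fi gi; congr (mu.-integrable _ _). Qed.

Lemma integrable_abs f : mu.-integrable setT (EFin \o f) ->
  mu.-integrable setT (EFin \o (fun x => `|f x|)).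
Proof. by move=> fi; have := integrable_abse fi; congr (mu.-integrable _ _). Qed.

Lemma integrable_sub f g : mu.-integrable setT (EFin \o f) ->
  mu.-integrable setT (EFin \o g) -> mu.-integrable setT (EFin \o (fun x => f x - g x)).
Proof. by move=> fi gi; have := integrableB measurableT fi gi; congr (mu.-integrable _ _). Qed.

Lemma Rintegral_sum (I : Type) (r : seq I) (F : I -> T -> R) :
  (forall k, mu.-integrable setT (EFin \o F k)) ->
  \int[mu]_x (\sum_(k <- r) F k x) = \sum_(k <- r) \int[mu]_x F k x.
Proof.
move=> iF; have h s : mu.-integrable setT (EFin \o (fun x => \sum_(k <- s) F k x)).
  elim: s => [|k s IH].
    rewrite (_ : EFin \o _ = cst 0%E); first exact: integrable0.
    by apply/funext => x /=; rewrite big_nil.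
  rewrite (_ : EFin \o _ = EFin \o (fun x => F k x + \sum_(j <- s) F j x)).
    exact: integrable_add.
  by apply/funext => x /=; rewrite big_cons.
elim: r => [|k r IH].
  by under eq_Rintegral do rewrite big_nil; rewrite big_nil Rintegral_cst// mul0r.
under eq_Rintegral do rewrite big_cons.
by rewrite RintegralD// big_cons IH.
Qed.

End dct.

Section mvt.
Context (R : realType).

(** Increments of either sign occur below, so no order is imposed on the endpoints and [c] is
    located by a distance. *)
Lemma mvt_line (f df : R -> R) (a b : R) : (forall x : R, is_derive x (1 : R) f (df x)) ->
  exists2 c, `|c - a| <= `|b - a| & f b - f a = df c * (b - a).
Proof.
move=> H.
have cf (u v : R) : {within `[u, v], continuous f}.
  apply: continuous_subspaceT => x; apply: differentiable_continuous.
  by apply/derivable1_diffP; have [] := H x.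
have [ab|ba] := leP a b.
  have [c cab ->] := MVT_segment ab (fun x _ => H x) (cf _ _).
  exists c => //; move: cab; rewrite in_itv /= => /andP[ac cb].
  by rewrite !ger0_norm ?subr_ge0// lerD2r.
have [c cab E] := MVT_segment (ltW ba) (fun x _ => H x) (cf _ _).
exists c; last by rewrite -opprB E -mulrN opprB.
move: cab; rewrite in_itv /= => /andP[bc ca].
by rewrite !ler0_norm ?subr_le0// ?(ltW ba)// lerN2 lerD2r.
Qed.

Lemma sin_lip (a b : R) : `|sin b - sin a| <= `|b - a|.
Proof.
have [c _ ->] := @mvt_line sin cos a b (@is_derive_sin R).
by rewrite normrM ler_piMl// cos_max.
Qed.

Lemma cos_lip (a b : R) : `|cos b - cos a| <= `|b - a|.
Proof.
have [c _ ->] := @mvt_line cos (fun x => - sin x) a b (@is_derive_cos R).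
by rewrite normrM normrN ler_piMl// sin_max.
Qed.

(** The mean value theorem followed by the Lipschitz bound of the derivative. The quadratic
    remainder is what differentiation under the integral consumes. *)
Lemma cos_taylor (t u : R) : `|cos (u + t) - cos t + u * sin t| <= u ^+ 2.
Proof.
have [c ca ->] := @mvt_line cos (fun x => - sin x) t (u + t) (@is_derive_cos R).
rewrite addrK in ca *; rewrite (_ : _ + _ = - u * (sin c - sin t)); last by ring.
rewrite normrM normrN -[u ^+ 2]real_normK ?num_real// expr2 ler_wpM2l//.
by apply: le_trans (sin_lip _ _) _.
Qed.

Lemma sin_taylor (t u : R) : `|sin (u + t) - sin t - u * cos t| <= u ^+ 2.
Proof.
have [c ca ->] := @mvt_line sin cos t (u + t) (@is_derive_sin R).
rewrite addrK in ca *; rewrite (_ : _ - _ = u * (cos c - cos t)); last by ring.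
rewrite normrM -[u ^+ 2]real_normK ?num_real// expr2 ler_wpM2l//.
by apply: le_trans (cos_lip _ _) _.
Qed.

End mvt.

Section lines.
Context (R : realType) (d : nat).
Local Notation E := 'rV[R]_d.
Local Notation dx i := (delta_mx ord0 i : E).
Implicit Types (f g q : E -> R).

Lemma is_derive_line f (x v : E) (t : R) : differentiable f (x + t *: v) ->
  is_derive t 1 (fun t => f (x + t *: v)) ('D_v f (x + t *: v)).
Proof.
move=> df; have D : derivable f (x + t *: v) v by exact: diff_derivable.
have e : (fun s : R => s^-1 *: (f (x + (s *: (1 : R) + t) *: v) - f (x + t *: v))) =
     fun s : R => s^-1 *: (f (s *: v + (x + t *: v)) - f (x + t *: v)).
  apply/funext => s; congr (_ *: (f _ - _)).
  by rewrite scalerDl addrCA /GRing.scale /= mulr1.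
split; first by rewrite /derivable /= e; exact: D.
by rewrite /derive /= e.
Qed.

Lemma mvt_partial f i (x : E) (t : R) : (forall x, differentiable f x) ->
  exists2 c, `|c| <= `|t| & f (x + t *: dx i) - f x = partial i f (x + c *: dx i) * t.
Proof.
move=> df.
have [|c ca E] := @mvt_line R (fun t => f (x + t *: dx i))
  (fun t => partial i f (x + t *: dx i)) 0 t.
  by move=> s; exact: is_derive_line.
by exists c; move: ca E; rewrite !subr0 scale0r addr0.
Qed.

Lemma enorm_delta i : enorm (dx i) = 1.
Proof. by rewrite /enorm dot_delta mxE !eqxx sqrtr1. Qed.

Lemma scale_cvg0 (v : E) (t_ : nat -> R) : t_ @ \oo --> (0 : R) ->
  (fun n => t_ n *: v) @ \oo --> (0 : E).
Proof. by move=> t0; rewrite -(scale0r v); exact: cvgZr_tmp. Qed.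

Lemma partial_cvg_seq f i (x : E) (t_ : nat -> R) : differentiable f x ->
  t_ @ \oo --> (0 : R) -> (forall n, t_ n != 0) ->
  (fun n => (f (x + t_ n *: dx i) - f x) / t_ n) @ \oo --> partial i f x.
Proof.
move=> df t0 tn0; apply/cvgrPdist_le => e e0.
have /grad_atP/(_ e e0) H := grad_at_partial df.
have Q : \forall n \near \oo, `|f (t_ n *: dx i + x) - f x -
    \sum_j partial j f x * (t_ n *: dx i) ord0 j| <= e * `|t_ n *: dx i|.
  exact: (scale_cvg0 (dx i) t0 H).
apply: filterS Q => n Hn.
rewrite distrC -[X in `|_ - X|](mulfK (tn0 n)) -mulrBl normrM normfV ler_pdivrMr ?normr_gt0//.
move: Hn; rewrite [t_ n *: dx i + x]addrC (bigD1 i)//= big1 ?addr0; last first.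
  by move=> j ji; rewrite !mxE (negbTE ji) andbF !mulr0.
rewrite !mxE !eqxx mulr1; move/le_trans; apply.
rewrite ler_wpM2l ?(ltW e0)//; apply: le_trans (ler_norm_enorm _) _.
by rewrite enormZ enorm_delta mulr1.
Qed.

Lemma harmonic_neq0 n : n.+1%:R^-1 != 0 :> R.
Proof. by rewrite invr_eq0 pnatr_eq0. Qed.

Lemma ler_enorm1_shift (x v : E) : enorm v <= 1 -> 1 + enorm x <= 2 * (1 + enorm (x + v)).
Proof.
move=> v1; have := ler_enormB (x + v) v; rewrite addrK; have := enorm_ge0 (x + v); lra.
Qed.

Lemma ler_enorm1_shiftr (x v : E) : enorm v <= 1 -> 1 + enorm (x + v) <= 2 * (1 + enorm x).
Proof. by move=> v1; have := ler_enormD x v; have := enorm_ge0 x; lra. Qed.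

(** Uniformity in [v] yields one integrable majorant for all difference quotients with step at most
    1. *)
Lemma rapid_shift f k : rapid f -> exists C, forall x v, enorm v <= 1 ->
  (1 + enorm x) ^+ k * `|f (x + v)| <= C.
Proof.
move=> /(_ k)[C fC]; exists (2 ^+ k * C) => x v v1.
apply: (@le_trans _ _ ((2 * (1 + enorm (x + v))) ^+ k * `|f (x + v)|)).
  by rewrite ler_wpM2r// lerXn2r ?nnegrE ?mulr_ge0 ?ler_enorm1_shift// ltW// enorm1_gt0.
by rewrite exprMn -mulrA ler_wpM2l// exprn_ge0.
Qed.

Lemma tame_shift f : tame f -> exists N C, 0 <= C /\ forall x v, enorm v <= 1 ->
  `|f (x + v)| <= C * (1 + enorm x) ^+ N.
Proof.
move=> /tame_ge0[N [C [C0 fC]]]; exists N, (C * 2 ^+ N); split.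
  by rewrite mulr_ge0// exprn_ge0.
move=> x v v1; apply: le_trans (fC _) _; rewrite -mulrA ler_wpM2l// -exprMn.
by rewrite lerXn2r ?nnegrE ?mulr_ge0 ?ler_enorm1_shiftr// ltW// enorm1_gt0.
Qed.

Lemma partial_shift_bound f i (x : E) (t c : R) : (forall x, differentiable f x) ->
  `|t| <= 1 -> t != 0 -> (forall v, enorm v <= 1 -> `|partial i f (x + v)| <= c) ->
  `|(f (x + t *: dx i) - f x) / t| <= c.
Proof.
move=> df t1 t0 H; have [s st ->] := mvt_partial i x t df.
rewrite mulfK//; apply: H; rewrite enormZ enorm_delta mulr1; exact: le_trans st t1.
Qed.

End lines.

(** * Integration by parts with a kernel singular at the origin *)

Section ibp.
Context (R : realType) (d : nat).
Local Notation E := 'rV[R]_d.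
Local Notation lam := (lebesgue R d).
Local Notation dx i := (delta_mx ord0 i : E).
Hypothesis d0 : (0 < d)%N.
Implicit Types (f g q : E -> R).

Lemma tame_rapid_integrable q f : measurable_fun setT q -> measurable_fun setT f ->
  tame q -> rapid f -> lam.-integrable setT (EFin \o (fun x => q x * f x)).
Proof.
move=> mq mf tq rf; have [C fC] := tame_rapid tq rf (2 * d)%N.
by apply: (integrable_decay d0 _ fC); exact: measurable_funM.
Qed.

Lemma tame_schwartz_integrable q f : measurable_fun setT q -> tame q -> schwartz f ->
  lam.-integrable setT (EFin \o (fun x => q x * f x)).
Proof.
move=> mq tq Sf; apply: tame_rapid_integrable => //; last exact: schwartz_rapid.
by apply: smooth_measurable; exact: schwartz_smooth.
Qed.

Lemma schwartz_integrable f : schwartz f -> lam.-integrable setT (EFin \o f).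
Proof.
move=> Sf; have := @tame_schwartz_integrable (fun=> 1) f _ (@tame_cst R d 1) Sf.
rewrite (_ : (fun x => 1 * f x) = f); last by apply/funext => x; rewrite mul1r.
exact.
Qed.

Lemma negligible_origin : {ae lam, forall x, x != 0}.
Proof.
exists [set x : E | x ord0 (Ordinal d0) = 0]; split.
- rewrite (_ : mkset _ = (fun x : E => x ord0 (Ordinal d0)) @^-1` [set 0])//.
  by rewrite -[X in measurable X]setTI; exact: measurable_coord.
- exact: lebesgue_hyperplane.
- by move=> x /= /negP; rewrite negbK => /eqP ->; rewrite mxE.
Qed.

(* The origin is exempted because [psi sigma] need not be differentiable there. *)
Definition quotient_limit i q q' : Prop :=
  (forall x : E, x != 0 -> forall t_ : nat -> R, t_ @ \oo --> (0 : R) ->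
    (forall n, t_ n != 0) ->
    (fun n => (q (x + t_ n *: dx i) - q x) / t_ n) @ \oo --> q' x) /\
  exists N C, forall x t, `|t| <= 1 -> t != 0 ->
    `|(q (x + t *: dx i) - q x) / t| <= C * (1 + enorm x) ^+ N.

Lemma OM_quotient_limit i q : OM q -> quotient_limit i q (partial i q).
Proof.
move=> Oq; have dq x : differentiable q x by apply: smooth_diff; case: Oq.
split=> [x _ t_ t0 tn0|]; first exact: partial_cvg_seq.
have [_ /(_ [::]) /tame_shift[N [C [_ H]]]] := OM_partial i Oq.
exists N, C => x t t1 t0; apply: partial_shift_bound => // v; exact: H.
Qed.

(** Translation invariance moves a difference quotient from [f] to [q], reversing the step; both
    sides then converge by domination. As only quotients of [q] appear, their convergence away from
    the null set at the origin is enough. *)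
Lemma integration_by_parts_rV i q q' f : measurable_fun setT q -> measurable_fun setT q' ->
  tame q -> quotient_limit i q q' -> schwartz f ->
  lam.-integrable setT (EFin \o (fun x => q' x * f x)) /\
  \int[lam]_x (q x * partial i f x) = - \int[lam]_x (q' x * f x).
Proof.
move=> mq mq' tq [qc [N [C qC]]] Sf.
pose t_ (n : nat) : R := n.+1%:R^-1.
have t0 : t_ @ \oo --> (0 : R) by exact: cvg_harmonic.
have tn0 n : t_ n != 0 by exact: harmonic_neq0.
have t1 n : `|t_ n| <= 1 by rewrite ger0_norm ?invr_ge0// invf_le1 ?ler1n.
have Nt1 n : `|- t_ n| <= 1 by rewrite normrN.
have Nt0 : (fun n => - t_ n) @ \oo --> (0 : R) by rewrite -(oppr0 R); exact: cvgN.
have Ntn0 n : - t_ n != 0 by rewrite oppr_eq0.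
have mf : measurable_fun setT f by apply: smooth_measurable; exact: schwartz_smooth.
have df x : differentiable f x by apply: smooth_diff; exact: schwartz_smooth.
have msh (h : E -> R) (v : E) : measurable_fun setT h -> measurable_fun setT (fun x : E => h (x + v)).
  move=> mh; have := measurableT_comp mh (measurable_affine 1 v).
  by rewrite (_ : h \o _ = fun x => h (x + v))//; apply/funext => x /=; rewrite scale1r.
have enx (t : R) : `|t| <= 1 -> enorm (t *: dx i) <= 1.
  by rewrite enormZ enorm_delta mulr1.
have decay g : rapid g -> exists K, forall x v, enorm v <= 1 ->
    (1 + enorm x) ^+ (2 * d) * (`|q x| * `|g (x + v)|) <= K.
  move=> rg; have [M [B [B0 qB]]] := tame_ge0 tq.
  have [D gD] := rapid_shift (M + 2 * d) rg.
  exists (B * D) => x v v1; apply: (@le_trans _ _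
      (B * ((1 + enorm x) ^+ (M + 2 * d) * `|g (x + v)|))); last by rewrite ler_wpM2l// gD.
  rewrite exprD [leRHS](_ : _ = (1 + enorm x) ^+ (2 * d) *
    ((B * (1 + enorm x) ^+ M) * `|g (x + v)|)); last by ring.
  apply: ler_wpM2l; first by rewrite exprn_ge0// ltW// enorm1_gt0.
  exact: ler_wpM2r.
(* The common shape of the integrable majorants. *)
pose W (K : R) (x : E) := K * (1 + enorm x) ^- (2 * d).
have mW K : measurable_fun setT (W K).
  apply: measurable_funM => //; apply: (@continuous_measurable_rV _ _ (fun x => (1 + enorm x) ^- (2 * d))).
  move=> x; apply: (@continuousV _ E); first by rewrite gt_eqF// exprn_gt0// enorm1_gt0.
  apply: (@continuous_comp _ _ _ (@enorm R d) (fun t => (1 + t) ^+ (2 * d))).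
    exact: continuous_enorm.
  apply: (@continuous_comp _ _ _ (fun t : R => 1 + t) (fun t => t ^+ (2 * d))).
    by apply: continuousD; [exact: cst_continuous|exact: cvg_id].
  exact: exprn_continuous.
have iW K : lam.-integrable setT (EFin \o W K).
  apply: (@integrable_decay _ _ d0 `|K|) => // x; rewrite /W normrM normfV.
  have ep : 0 < (1 + enorm x) ^+ (2 * d) by rewrite exprn_gt0// enorm1_gt0.
  by rewrite (gtr0_norm ep) mulrCA divff ?mulr1// gt_eqF.
have leW K c (x : E) : (1 + enorm x) ^+ (2 * d) * c <= K -> c <= W K x.
  by rewrite /W ler_pdivlMr ?exprn_gt0 ?enorm1_gt0// mulrC.
(* [A] has the forward quotient of [f], [B] the backward quotient of [q]. *)
pose A n x := q x * ((f (x + t_ n *: dx i) - f x) / t_ n).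
pose B n x := (q (x + - t_ n *: dx i) - q x) / - t_ n * f x.
have mA n : measurable_fun setT (A n).
  apply: measurable_funM => //; apply: measurable_funM => //.
  by apply: measurable_funB => //; exact: msh.
have mB n : measurable_fun setT (B n).
  apply: measurable_funM => //; apply: measurable_funM => //.
  by apply: measurable_funB => //; exact: msh.
have mpf : measurable_fun setT (partial i f).
  by apply: smooth_measurable; apply: schwartz_smooth; exact: schwartz_partial.
have [K1 HK1] := decay _ (schwartz_rapid (schwartz_partial i Sf)).
have [_ cA] : lam.-integrable setT (EFin \o (fun x => q x * partial i f x)) /\
   (fun n => \int[lam]_x A n x) @ \oo --> \int[lam]_x (q x * partial i f x).
  apply: (@Rintegral_dct _ _ _ lam A _ (W K1)) => //.
  - exact: measurable_funM.
  - apply: aeW => x; rewrite /A; apply: cvgMl_tmp; exact: partial_cvg_seq.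
  - move=> n x; rewrite /A normrM; apply: leW.
    have h : 0 <= (1 + enorm x) ^+ (2 * d) by rewrite exprn_ge0// ltW// enorm1_gt0.
    have [c ct ->] := mvt_partial i x (t_ n) df.
    by rewrite mulfK//; apply: HK1; apply: enx; exact: le_trans ct (t1 n).
have tq0 : tame (fun x : E => C * (1 + enorm x) ^+ N).
  exists N, `|C| => x; rewrite normrM ler_wpM2l// ger0_norm//.
  by rewrite exprn_ge0// ltW// enorm1_gt0.
have [K2 HK2] := tame_rapid tq0 (schwartz_rapid Sf) (2 * d)%N.
have [iB cB] : lam.-integrable setT (EFin \o (fun x => q' x * f x)) /\
   (fun n => \int[lam]_x B n x) @ \oo --> \int[lam]_x (q' x * f x).
  apply: (@Rintegral_dct _ _ _ lam B _ (W K2)) => //.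
  - exact: measurable_funM.
  - apply: filterS negligible_origin => x x0; rewrite /B; apply: cvgMr_tmp; exact: qc.
  - move=> n x; rewrite /B normrM; apply: leW; apply: le_trans (HK2 x).
    apply: ler_wpM2l; first by rewrite exprn_ge0// ltW// enorm1_gt0.
    rewrite [leRHS]normrM; apply: ler_wpM2r => //.
    exact: le_trans (qC _ _ (Nt1 n) (Ntn0 n)) (ler_norm _).
split => //.
have [K3 HK3] := decay _ (schwartz_rapid Sf).
have iqf (v : E) : enorm v <= 1 -> lam.-integrable setT (EFin \o (fun x => q x * f (x + v))).
  move=> v1; apply: (@integrable_le _ _ _ _ _ (W K3)) => //.
    by apply: measurable_funM => //; exact: msh.
  by move=> x; apply: leW; rewrite normrM; exact: HK3.
have iqf0 : lam.-integrable setT (EFin \o (fun x => q x * f x)).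
  have h : enorm (0 : E) <= 1 by rewrite enorm0.
  by have := iqf 0 h; congr (lam.-integrable _ _); apply/funext => x /=; rewrite addr0.
(* Discrete integration by parts, exact at each step by the change of variable [x + v]. *)
have AB n : \int[lam]_x A n x = - \int[lam]_x B n x.
  have v1 := enx _ (t1 n); set v := t_ n *: dx i in v1 *.
  have mF : measurable_fun setT (fun x : E => q (x - v) * f x).
    by apply: measurable_funM => //; exact: msh.
  have iF : lam.-integrable setT (EFin \o (fun x : E => q (x - v) * f x)).
    have := integrable_shift (- v) (iqf v v1).
    by congr (lam.-integrable _ _); apply/funext => x /=; rewrite subrK.
  have -> : \int[lam]_x A n x = (t_ n)^-1 * (\int[lam]_x (q x * f (x + v)) - \int[lam]_x (q x * f x)).
    rewrite -RintegralB//; last exact: iqf.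
    rewrite -RintegralZl//; last exact: (integrable_sub (iqf v v1) iqf0).
    by apply: eq_Rintegral => x _; rewrite /A -/v; ring.
  have -> : \int[lam]_x B n x = (- t_ n)^-1 * (\int[lam]_x (q (x - v) * f x) - \int[lam]_x (q x * f x)).
    rewrite -RintegralB// -RintegralZl//; last exact: (integrable_sub iF iqf0).
    by apply: eq_Rintegral => x _; rewrite /B scaleNr -/v; ring.
  rewrite invrN mulNr opprK; congr (_ * (_ - _)).
  rewrite -(Rintegral_shift v mF); apply: eq_Rintegral => x _; by rewrite addrK.
have := cvg_unique _ cA; apply => //.
rewrite (_ : (fun n => \int[lam]_x A n x) = fun n => - \int[lam]_x B n x).
  exact: cvgN.
by apply/funext => n; exact: AB.
Qed.

End ibp.

(** * Fourier transform *)

Section fourier_transform.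
Context (R : realType) (d : nat).
Local Notation E := 'rV[R]_d.
Local Notation lam := (lebesgue R d).
Hypothesis d0 : (0 < d)%N.
Implicit Types (f g q : E -> R) (x xi : E) (k : R -> R).

(* [k] stands for [cos], [sin] or [fun t => - sin t]. *)
Definition ft k f xi : R := \int[lam]_x (f x * k (dot x xi)).

Definition wave k : Prop := continuous k /\ forall t, `|k t| <= 1.

Lemma wave_cos : wave (@cos R).
Proof. by split; [exact: continuous_cos|exact: cos_max]. Qed.

Lemma wave_sin : wave (@sin R).
Proof. by split; [exact: continuous_sin|exact: sin_max]. Qed.

Lemma waveN k : wave k -> wave (fun t => - k t).
Proof.
move=> [ck k1]; split; last by move=> t; rewrite normrN.
by move=> t; apply: (@continuousN _ R R); exact: ck.
Qed.

Lemma ftN k f xi : ft (fun t => - k t) f xi = ft k (fun x => - f x) xi.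
Proof. by apply: eq_Rintegral => x _; rewrite mulrN mulNr. Qed.

Lemma measurable_wave k xi : wave k -> measurable_fun setT (fun x : E => k (dot x xi)).
Proof.
move=> [ck _]; apply: continuous_measurable_rV => x.
by apply: (@continuous_comp _ _ _ (fun x : E => dot x xi) k); [exact: continuous_dotl|exact: ck].
Qed.

Lemma integrable_wave k f xi : wave k -> lam.-integrable setT (EFin \o f) ->
  lam.-integrable setT (EFin \o (fun x => f x * k (dot x xi))).
Proof.
move=> wk fi; apply: integrable_le (integrable_abs fi) _.
  apply: measurable_funM; first exact: integrable_measurable fi.
  exact: measurable_wave.
by move=> x; rewrite normrM ler_piMr// wk.2.
Qed.

Lemma ft_add k f g xi : wave k -> schwartz f -> schwartz g ->
  ft k (fun x => f x + g x) xi = ft k f xi + ft k g xi.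
Proof.
move=> wk Sf Sg; rewrite /ft -RintegralD//;
  try by apply: integrable_wave => //; exact: schwartz_integrable.
by apply: eq_Rintegral => x _; rewrite mulrDl.
Qed.

Lemma ft_scale k f (c : R) xi : wave k -> schwartz f ->
  ft k (fun x => c * f x) xi = c * ft k f xi.
Proof.
move=> wk Sf; rewrite /ft -RintegralZl//.
  by apply: eq_Rintegral => x _; rewrite mulrA.
by apply: integrable_wave => //; exact: schwartz_integrable.
Qed.

Lemma ft_bound k f xi : wave k -> schwartz f -> `|ft k f xi| <= \int[lam]_x `|f x|.
Proof.
move=> wk Sf; have fi := schwartz_integrable d0 Sf.
apply: le_trans (le_normr_Rintegral _ _) _ => //; first exact: integrable_wave.
apply: le_Rintegral => //; first exact: integrable_abs (integrable_wave _ wk fi).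
  exact: integrable_abs.
by move=> x _; rewrite normrM ler_piMr// wk.2.
Qed.

Lemma schwartz_coord_mul f i : schwartz f -> schwartz (fun x => x ord0 i * f x).
Proof. by apply: schwartz_mul; exact: OM_coord. Qed.

(** The quadratic remainder of [k] bounds the error of the expansion by [|h|^2] times the second
    moment of [|f|]. *)
Lemma ft_grad k k' f xi : wave k -> wave k' ->
  (forall t u, `|k (u + t) - k t - u * k' t| <= u ^+ 2) -> schwartz f ->
  grad_at (ft k f) xi (fun i => ft k' (fun x => x ord0 i * f x) xi).
Proof.
move=> wk wk' tk Sf; apply/grad_atP => e e0.
pose g x := dot x x * f x.
have Sg : schwartz g by apply: schwartz_mul => //; exact: OM_sqr.
have ig := integrable_abs (schwartz_integrable d0 Sg).
pose M := \int[lam]_x `|g x|.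
have M0 : 0 <= M by exact: Rintegral_ge0.
(* For [|h| <= 1 / c] one has [d^2 M |h|^2 <= e |h|]. The factor [d^2] compares the Euclidean norm
   with the sup norm, and the added 1 keeps [c] positive. *)
pose c := (d%:R ^+ 2 * M + 1) / e.
have c0 : 0 < c by rewrite divr_gt0// ltr_pwDr// mulr_ge0// exprn_ge0.
have nh : \forall h \near (0 : E), `|h| <= c^-1.
  by apply: nbhs0_le; rewrite invr_gt0.
apply: filterS nh => h hc.
have ifc eta := integrable_wave eta wk (schwartz_integrable d0 Sf).
have ifs i := integrable_wave xi wk' (schwartz_integrable d0 (schwartz_coord_mul i Sf)).
pose F x := f x * (k (dot x h + dot x xi) - k (dot x xi) - dot x h * k' (dot x xi)).
have mF : measurable_fun setT F.
  apply: measurable_funM; first exact: (smooth_measurable (schwartz_smooth Sf)).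
  apply: measurable_funB; first apply: measurable_funB; last apply: measurable_funM.
  - under eq_fun do rewrite -dotDr; exact: measurable_wave.
  - exact: measurable_wave.
  - by apply: continuous_measurable_rV; exact: continuous_dotl.
  - exact: measurable_wave.
have -> : ft k f (h + xi) - ft k f xi - \sum_i ft k' (fun x => x ord0 i * f x) xi * h ord0 i =
    \int[lam]_x F x.
  have ish (r : seq 'I_d) : lam.-integrable setT (EFin \o
      (fun x => \sum_(i <- r) h ord0 i * (x ord0 i * f x * k' (dot x xi)))).
    elim: r => [|j r IH].
      rewrite (_ : EFin \o _ = cst 0%E); first exact: integrable0.
      by apply/funext => x /=; rewrite big_nil.
    rewrite (_ : EFin \o _ = EFin \o (fun x => h ord0 j * (x ord0 j * f x * k' (dot x xi)) +
       \sum_(i <- r) h ord0 i * (x ord0 i * f x * k' (dot x xi)))).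
      by apply: integrable_add => //; exact: integrable_scale.
    by apply/funext => x /=; rewrite big_cons.
  have -> : \sum_i ft k' (fun x => x ord0 i * f x) xi * h ord0 i =
      \int[lam]_x (\sum_i h ord0 i * (x ord0 i * f x * k' (dot x xi))).
    rewrite Rintegral_sum; last by move=> i; exact: integrable_scale.
    by apply: eq_bigr => i _; rewrite RintegralZl// mulrC.
  rewrite /ft -RintegralB// -RintegralB//; last exact: (integrable_sub (ifc _) (ifc _)).
  apply: eq_Rintegral => x _; rewrite /F dotDr !mulrBr; congr (_ - _).
  by rewrite {1}/dot mulr_suml mulr_sumr; apply: eq_bigr => i _; ring.
apply: (@le_trans _ _ (enorm h ^+ 2 * M)).
  have bnd x : `|F x| <= enorm h ^+ 2 * `|g x|.
    rewrite /F normrM /g normrM (ger0_norm (dot_ge0 x)) -sqr_enorm mulrC mulrA ler_wpM2r//.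
    apply: le_trans (tk _ _) _.
    rewrite -exprMn -real_normK ?num_real// lerXn2r ?nnegrE ?mulr_ge0 ?enorm_ge0//.
    by rewrite mulrC; exact: cauchy_schwarz.
  rewrite /M -RintegralZl//.
  have ii := integrable_le mF (integrable_scale (enorm h ^+ 2) ig) bnd.
  apply: le_trans (le_normr_Rintegral _ ii) _ => //.
  by apply: le_Rintegral => //; [exact: integrable_abs|exact: integrable_scale].
apply: (@le_trans _ _ ((d%:R * `|h|) ^+ 2 * M)).
  rewrite ler_wpM2r// lerXn2r ?nnegrE ?enorm_ge0 ?mulr_ge0//.
  exact: ler_enorm_norm.
rewrite exprMn mulrAC expr2 mulrA -/(_ ^+ 2) ler_wpM2r//.
have : `|h| * c <= 1 by rewrite -ler_pdivlMr// mul1r.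
rewrite /c mulrA ler_pdivrMr// mul1r; apply: le_trans.
by rewrite mulrC ler_wpM2l// lerDl.
Qed.

Lemma ft_cos_grad f xi : schwartz f ->
  grad_at (ft cos f) xi (fun i => ft sin (fun x => - (x ord0 i * f x)) xi).
Proof.
move=> Sf; have H := @ft_grad cos (fun t => - sin t) f xi wave_cos (waveN wave_sin).
apply: grad_at_eq (H _ Sf) _ => [t u|i]; last by rewrite ftN.
by rewrite mulrN opprK; exact: cos_taylor.
Qed.

Lemma ft_sin_grad f xi : schwartz f ->
  grad_at (ft sin f) xi (fun i => ft cos (fun x => x ord0 i * f x) xi).
Proof.
move=> Sf; apply: ft_grad => //; [exact: wave_sin|exact: wave_cos|exact: sin_taylor].
Qed.

Lemma ft_cos_partial f i xi : schwartz f ->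
  ft cos (partial i f) xi = xi ord0 i * ft sin f xi.
Proof.
move=> Sf; have [Oc Os] := @OM_cos_sin R d xi.
have [ic E1] := integration_by_parts_rV d0 (smooth_measurable Oc.1)
  (smooth_measurable (smooth_partial i Oc.1)) (Oc.2 [::]) (OM_quotient_limit i Oc) Sf.
rewrite /ft; under eq_Rintegral do rewrite mulrC.
rewrite E1 -RintegralZl//; last first.
  by apply: integrable_wave (schwartz_integrable d0 Sf); exact: wave_sin.
rewrite -[LHS]mulN1r -RintegralZl//; apply: eq_Rintegral => x _.
have [_ ->] := grad_at_comp (f := fun z => dot z xi) (is_derive_cos (dot x xi)) (grad_at_dotl xi x).
by ring.
Qed.

Lemma ft_sin_partial f i xi : schwartz f ->
  ft sin (partial i f) xi = - (xi ord0 i * ft cos f xi).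
Proof.
move=> Sf; have [Oc Os] := @OM_cos_sin R d xi.
have [ic E1] := integration_by_parts_rV d0 (smooth_measurable Os.1)
  (smooth_measurable (smooth_partial i Os.1)) (Os.2 [::]) (OM_quotient_limit i Os) Sf.
rewrite /ft; under eq_Rintegral do rewrite mulrC.
rewrite E1 -RintegralZl//; last first.
  by apply: integrable_wave (schwartz_integrable d0 Sf); exact: wave_cos.
congr (- _); apply: eq_Rintegral => x _.
have [_ ->] := grad_at_comp (f := fun z => dot z xi) (is_derive_sin (dot x xi)) (grad_at_dotl xi x).
by ring.
Qed.

Lemma ler_enorm_sum (x : E) : enorm x <= \sum_(i < d) `|x ord0 i|.
Proof.
rewrite -(@ler_pXn2r _ 2)// ?nnegrE ?enorm_ge0 ?sumr_ge0// sqr_enorm.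
rewrite expr2 mulr_suml ler_sum// => i _.
rewrite -expr2 -real_normK ?num_real// expr2 ler_wpM2l// (bigD1 i)//= lerDl.
exact: sumr_ge0.
Qed.

(** A factor [xi_i] is traded for a derivative of [f], which exchanges cosine and sine; the
    induction on the power therefore carries both. *)
Lemma ft_rapid f : schwartz f -> rapid (ft cos f) /\ rapid (ft sin f).
Proof.
suff H n : forall f, schwartz f -> exists C, forall xi,
    (1 + enorm xi) ^+ n * `|ft cos f xi| <= C /\ (1 + enorm xi) ^+ n * `|ft sin f xi| <= C.
  by move=> Sf; split=> n; have [C fC] := H n _ Sf; exists C => xi; have [] := fC xi.
elim: n => [|n IH] {}f Sf.
  exists (\int[lam]_x `|f x|) => xi; rewrite expr0 !mul1r.
  by split; apply: ft_bound => //; [exact: wave_cos|exact: wave_sin].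
have [C0 H0] := IH f Sf.
have /choice[C HC] : forall i : 'I_d, exists C, forall xi,
    (1 + enorm xi) ^+ n * `|ft cos (partial i f) xi| <= C /\
    (1 + enorm xi) ^+ n * `|ft sin (partial i f) xi| <= C.
  by move=> i; apply: IH; exact: schwartz_partial.
exists (C0 + \sum_i C i) => xi.
have e0 : 0 <= (1 + enorm xi) ^+ n by rewrite exprn_ge0// ltW// enorm1_gt0.
have step (u : R) (v : 'I_d -> R) : (1 + enorm xi) ^+ n * `|u| <= C0 ->
    (forall i, (1 + enorm xi) ^+ n * (`|xi ord0 i| * `|u|) <= C i) ->
    (1 + enorm xi) ^+ n.+1 * `|u| <= C0 + \sum_i C i.
  move=> u0 ui; rewrite exprS -mulrA mulrDl mul1r lerD//.
  apply: (@le_trans _ _ (\sum_i `|xi ord0 i| * ((1 + enorm xi) ^+ n * `|u|))).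
    by rewrite -mulr_suml ler_wpM2r ?ler_enorm_sum// mulr_ge0.
  by apply: ler_sum => i _; rewrite mulrCA; exact: ui.
have [hc hs] := H0 xi.
split; apply: step => // i; have [pc ps] := HC i xi.
  by move: ps; rewrite ft_sin_partial// normrN normrM.
by move: pc; rewrite ft_cos_partial// normrM.
Qed.

(** Coinduction on the class of all transforms: a derivative of a transform is again the transform
    of a Schwartz function. *)
Lemma schwartz_ft f : schwartz f -> schwartz (ft cos f) /\ schwartz (ft sin f).
Proof.
pose P g := exists2 f, schwartz f & g = ft cos f \/ g = ft sin f.
move=> Sf; have rP g : P g -> rapid g.
  by move=> [h Sh [->|->]]; have [] := ft_rapid Sh.
have cP g : P g -> (forall x, differentiable g x) /\ forall i, P (partial i g).
  move=> [h Sh [->|->]]; split=> [x|i].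
  - by have [] := ft_cos_grad x Sh.
  - exists (fun x => - (x ord0 i * h x)); first exact/schwartzN/schwartz_coord_mul.
    by right; apply/funext => x; have [_ ->] := ft_cos_grad x Sh.
  - by have [] := ft_sin_grad x Sh.
  - exists (fun x => x ord0 i * h x); first exact/schwartz_coord_mul.
    by left; apply/funext => x; have [_ ->] := ft_sin_grad x Sh.
by split; apply: (schwartz_coind rP cP); exists f => //; [left|right].
Qed.

End fourier_transform.

(** * Fubini under a product majorant *)

Section fubini_bound.
Context (R : realType) d1 d2 (T1 : measurableType d1) (T2 : measurableType d2).
Context (m1 : {sigma_finite_measure set T1 -> \bar R}).
Context (m2 : {sigma_finite_measure set T2 -> \bar R}).
Variables (F : T1 * T2 -> R) (a : T1 -> R) (b : T2 -> R).
Hypotheses (mF : measurable_fun setT F) (ia : m1.-integrable setT (EFin \o a))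
  (ib : m2.-integrable setT (EFin \o b)) (Fab : forall x y, `|F (x, y)| <= a x * b y).

Lemma integrable_section1 x : m2.-integrable setT (EFin \o (fun y => F (x, y))).
Proof.
apply: integrable_le (integrable_scale (a x) ib) (Fab x).
exact: (measurableT_comp mF (pair1_measurable _)).
Qed.

Lemma integrable_section2 y : m1.-integrable setT (EFin \o (fun x => F (x, y))).
Proof.
apply: integrable_le (integrable_scale (b y) ia) _.
  exact: (measurableT_comp mF (pair2_measurable _)).
by move=> x; rewrite mulrC.
Qed.

(** Domination by [a x * b y] gives integrability of all sections and, after a second integration,
    on the product. *)
Lemma integrable_prod_bound : (m1 \x m2)%E.-integrable setT (EFin \o F).
Proof.
apply/integrable12ltyP; first exact/measurable_EFinP.
apply: (@le_lt_trans _ _ (\int[m1]_x (`|a x| * \int[m2]_y `|b y|)%:E)%E).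
  apply: ge0_le_integral => //.
  - by move=> x _; apply: integral_ge0.
  - have mabs : measurable_fun setT (abse \o (EFin \o F)).
      by apply: measurableT_comp => //; exact/measurable_EFinP.
    by apply: (@measurable_fun_fubini_tonelli_F _ _ _ _ _ m2 (abse \o (EFin \o F)) mabs) => //= z.
  - apply/measurable_EFinP; apply: measurable_funM => //.
    by apply: measurableT_comp => //; exact: integrable_measurable ia.
  - move=> x _; rewrite -RintegralZl//; last exact: integrable_abs.
    rewrite /Rintegral fineK; last first.
      apply: integrable_fin_num => //; apply: integrable_scale; exact: integrable_abs.
    apply: ge0_le_integral => //.
    + by apply: measurableT_comp => //; exact/measurable_EFinP/(integrable_measurable (integrable_section1 x)).
    + apply/measurable_EFinP; apply: measurable_funM => //.
      by apply: measurableT_comp => //; exact: integrable_measurable ib.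
    + move=> y _; rewrite lee_fin; apply: le_trans (Fab x y) _.
      by rewrite -normrM ler_norm.
have ii : m1.-integrable setT (EFin \o (fun x => `|a x| * \int[m2]_y `|b y|)).
  have := integrable_scale (\int[m2]_y `|b y|) (integrable_abs ia).
  by congr (m1.-integrable _ _); apply/funext => x /=; rewrite mulrC.
have := integrableP _ _ _ ii => -[_]; apply: le_lt_trans.
apply: ge0_le_integral => //.
- by move=> x _; rewrite lee_fin mulr_ge0// Rintegral_ge0.
- exact: measurable_int ii.
- by apply: measurableT_comp => //; exact: measurable_int ii.
- by move=> x _; rewrite /= lee_fin ler_norm.
Qed.

Lemma Rfubini_bound :
  \int[m1]_x \int[m2]_y F (x, y) = \int[m2]_y \int[m1]_x F (x, y).
Proof.
rewrite /Rintegral.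
have E1 : (\int[m1]_x (fine (\int[m2]_y (F (x, y))%:E))%:E = \int[m1]_x \int[m2]_y (EFin \o F) (x, y))%E.
  apply: eq_integral => x _; rewrite fineK//.
  apply: integrable_fin_num => //; exact: integrable_section1.
have E2 : (\int[m2]_y (fine (\int[m1]_x (F (x, y))%:E))%:E = \int[m2]_y \int[m1]_x (EFin \o F) (x, y))%E.
  apply: eq_integral => y _; rewrite fineK//.
  apply: integrable_fin_num => //; exact: integrable_section2.
by rewrite E1 E2 (Fubini integrable_prod_bound).
Qed.

Lemma integrable_Rintegral1 : m1.-integrable setT (EFin \o (fun x => \int[m2]_y F (x, y))).
Proof.
have := integrable_fubini_F integrable_prod_bound.
congr (m1.-integrable _ _); apply/funext => x; rewrite /fubini_F /= /Rintegral fineK//.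
apply: integrable_fin_num => //; exact: integrable_section1.
Qed.

End fubini_bound.

Section line_constant.
Context (R : realType) (d : nat).
Local Notation E := 'rV[R]_d.

Lemma grad_at_derive (f : E -> R) x v u : grad_at f x u -> 'D_v f x = \sum_i u i * v ord0 i.
Proof.
move=> [df fu]; rewrite deriveE// {1}(row_sum_delta v) linear_sum.
by apply: eq_bigr => i _; rewrite linearZ /= -fu /partial deriveE// mulrC.
Qed.

Lemma grad0_constant (f : E -> R) : (forall x, grad_at f x (fun=> 0)) -> forall x, f x = f 0.
Proof.
move=> H x; have [|c _] := @mvt_line R (fun t => f (0 + t *: x)) (fun=> 0) 0 1.
  move=> t; have df : differentiable f (0 + t *: x) by have [] := H (0 + t *: x).
  have := is_derive_line df; rewrite (grad_at_derive x (H _)) big1 // => i _.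
  by rewrite mul0r.
by rewrite scale1r scale0r addr0 add0r mul0r => /eqP; rewrite subr_eq0 => /eqP.
Qed.

End line_constant.

(** * Gaussians *)

Section gaussian.
Context (R : realType) (d : nat).
Local Notation E := 'rV[R]_d.
Local Notation lam := (lebesgue R d).
Hypothesis d0 : (0 < d)%N.

Definition gauss (c : R) (x : E) : R := expR (- (c * dot x x)).

Lemma gauss_gt0 c x : 0 < gauss c x. Proof. exact: expR_gt0. Qed.

Lemma gauss_le1 c x : 0 <= c -> gauss c x <= 1.
Proof. by move=> c0; rewrite /gauss -expR0 ler_expR oppr_le0 mulr_ge0// dot_ge0. Qed.

Lemma gauss0 c : gauss c 0 = 1.
Proof. by rewrite /gauss dot0r mulr0 oppr0 expR0. Qed.

Lemma gauss_grad c x : grad_at (gauss c) x (fun i => - (2 * c * x ord0 i) * gauss c x).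
Proof.
have H := grad_atN (grad_atZ c (grad_at_sqr x)).
apply: grad_at_eq (grad_at_comp (is_derive_expR _) H) _ => i.
by rewrite mulrC; congr (_ * _); ring.
Qed.

(** [gauss c] is the [k]-th power of [exp (- (c / k) |x|^2)], so it is enough to bound [1 + |x|] by
    [D (1 + (c / k) |x|^2)]. The choice of [D] gives [D >= 2] and [D c / k >= 1]. *)
Lemma gauss_rapid c : 0 < c -> rapid (gauss c).
Proof.
move=> c0 k; pose D : R := 2 + (k%:R / c).
exists (D ^+ k) => x; rewrite ger0_norm ?(ltW (gauss_gt0 _ _))//.
have [->|k0] := eqVneq k 0%N; first by rewrite !expr0 mul1r gauss_le1// ltW.
have kp : 0 < k%:R :> R by rewrite ltr0n lt0n.
have D0 : 0 <= D by rewrite addr_ge0// divr_ge0// ltW.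
have -> : gauss c x = expR (- (c / k%:R * dot x x)) ^+ k.
  rewrite /gauss -expRM_natl; congr expR; rewrite -mulr_natl mulrN mulrA; congr (- (_ * _)).
  by rewrite mulrCA divff ?mulr1 ?gt_eqF.
rewrite -exprMn; apply: lerXn2r; rewrite ?nnegrE//.
  by rewrite mulr_ge0 ?expR_ge0// ltW// enorm1_gt0.
rewrite expRN ler_pdivrMr ?expR_gt0//.
have h := expR_ge1Dx (c / k%:R * dot x x).
apply: (@le_trans _ _ (D * (1 + c / k%:R * dot x x))); last by rewrite ler_wpM2l.
rewrite mulrDr mulr1 mulrA.
have h2 : 1 <= D * (c / k%:R).
  rewrite (_ : D * _ = 2 * (c / k%:R) + 1); last by rewrite /D; field; rewrite !gt_eqF.
  by rewrite lerDr mulr_ge0// divr_ge0// ltW.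
have h3 : dot x x <= D * (c / k%:R) * dot x x by rewrite ler_peMl// dot_ge0.
have h4 : 0 <= k%:R / c by rewrite divr_ge0// ltW.
have h5 : enorm x <= 1 + dot x x.
  by rewrite -sqr_enorm; have := sqr_ge0 (enorm x - 1); have := enorm_ge0 x; nra.
rewrite /D in h3 *; lra.
Qed.

Lemma gauss_schwartz c : 0 < c -> schwartz (gauss c).
Proof.
move=> c0; pose P f := exists2 g, OM g & f = fun x => g x * gauss c x.
apply: (@schwartz_coind _ _ P); last first.
  by exists (fun=> 1); [exact: OM_cst|apply/funext => x; rewrite mul1r].
- move=> _ [g Og ->].
  have H x := grad_atM (grad_at_partial (smooth_diff x Og.1)) (gauss_grad c x).
  split=> [x|i]; first by have [] := H x.
  exists (fun x => partial i g x + g x * (- (2 * c) * x ord0 i)).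
    apply: OMD; first exact: OM_partial.
    by apply: OMM => //; apply: OMM; [exact: OM_cst|exact: OM_coord].
  by apply/funext => x; have [_ ->] := H x; ring.
- move=> _ [g Og ->]; apply: tame_rapid; first by have [_ /(_ [::])] := Og.
  exact: gauss_rapid.
Qed.

(** Since [x_i] times the Gaussian is a multiple of its [i]-th derivative, the transform solves a
    first-order linear equation. Its value [kappa] at 0 is positive by the product formula. *)
Lemma ft_gauss : exists2 kappa : R, 0 < kappa &
  forall xi, ft cos (gauss 1) xi = kappa * gauss (1/4) xi.
Proof.
have Sg : schwartz (gauss 1) by apply: gauss_schwartz.
(* [gauss (-(1/4))] is the growing function [exp (|xi|^2 / 4)], the reciprocal of the expected
   transform; the quotient has zero gradient. *)
pose G xi := ft cos (gauss 1) xi * gauss (-(1/4)) xi.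
have pg i : (fun x : E => - (x ord0 i * gauss 1 x)) = fun x => 2^-1 * partial i (gauss 1) x.
  by apply/funext => x; have [_ ->] := gauss_grad 1 x; field.
have gG xi : grad_at G xi (fun=> 0).
  apply: grad_at_eq (grad_atM (ft_cos_grad d0 xi Sg) (gauss_grad _ xi)) _ => i.
  rewrite pg ft_scale//; [|exact: wave_sin|exact: schwartz_partial].
  by rewrite ft_sin_partial//; field.
have GE xi : G xi = G 0 by exact: grad0_constant.
exists (ft cos (gauss 1) 0); last first.
  move=> xi; have := GE xi; rewrite /G gauss0 mulr1 => <-.
  by rewrite -mulrA /gauss -expRD mulNr opprK subrr expR0 mulr1.
rewrite /ft; under eq_Rintegral do rewrite dot0r cos0 mulr1.
rewrite /Rintegral.
have -> : (\int[lam]_x (gauss 1 x)%:E = \int[lam]_x (\prod_(i < d) gauss_fun (x ord0 i))%:E)%E.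
  apply: eq_integral => x _; congr EFin; rewrite /gauss mul1r /dot -sumrN expR_sum.
  by apply: eq_bigr => i _; rewrite /gauss_fun expr2.
rewrite (@lebesgue_prod _ _ (fun=> gauss_fun))//; last 2 first.
- by move=> i; exact: measurable_gauss_fun.
- by move=> i x; exact: gauss_fun_ge0.
under eq_bigr do rewrite integralT_gauss.
rewrite prodEFin /= prodr_const exprn_gt0// sqrtr_gt0; exact: pi_gt0.
Qed.

End gaussian.

(** * Fourier inversion *)

Section inversion.
Context (R : realType) (d : nat).
Local Notation E := 'rV[R]_d.
Local Notation lam := (lebesgue R d).
Local Notation slam := (@slebesgue R d).
Hypothesis d0 : (0 < d)%N.
Implicit Types (f g : E -> R).
Opaque lebesgue.

Lemma measurable_dot2 : measurable_fun setT (fun z : E * E => dot z.1 z.2).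
Proof.
apply: measurable_sum => i; apply: measurable_funM.
  exact: (measurableT_comp (@measurable_coord _ _ i) measurable_fst).
exact: (measurableT_comp (@measurable_coord _ _ i) measurable_snd).
Qed.

Lemma measurable_comp_fst (f : E -> R) : measurable_fun setT f ->
  measurable_fun setT (fun z : E * E => f z.1).
Proof. by move=> mf; exact: (measurableT_comp mf measurable_fst). Qed.

Lemma measurable_comp_snd (f : E -> R) : measurable_fun setT f ->
  measurable_fun setT (fun z : E * E => f z.2).
Proof. by move=> mf; exact: (measurableT_comp mf measurable_snd). Qed.

(** Fubini together with the addition formula for [cos (dot (x - y) xi)]: the real form of the rule
    that moves the summation factor [h] from the frequency side to a convolution. *)
Lemma ft_summation g h x : schwartz g -> schwartz h ->
  \int[lam]_xi ((ft cos g xi * cos (dot x xi) + ft sin g xi * sin (dot x xi)) * h xi) =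
  \int[lam]_y (g y * ft cos h (x - y)).
Proof.
move=> Sg Sh.
have ig := schwartz_integrable d0 Sg; have ih := schwartz_integrable d0 Sh.
have mg := integrable_measurable ig; have mh := integrable_measurable ih.
pose F (z : E * E) := h z.1 * g z.2 * cos (dot (x - z.2) z.1).
have mF : measurable_fun setT F.
  apply: measurable_funM; first apply: measurable_funM.
  - exact: measurable_comp_fst.
  - exact: measurable_comp_snd.
  rewrite (_ : (fun z => _) = fun z => cos (dot x z.1 - dot z.1 z.2)).
    apply: measurableT_comp; first by apply: continuous_measurable_fun; exact: continuous_cos.
    apply: measurable_funB; last exact: measurable_dot2.
    apply: (@measurable_comp_fst (fun z => dot x z)).
    under eq_fun do rewrite dotC.
    by apply: continuous_measurable_rV; exact: continuous_dotl.
  by apply/funext => z; rewrite dotBl (dotC z.2).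
have Fb xi y : `|F (xi, y)| <= `|h xi| * `|g y|.
  by rewrite /F /= normrM -[leRHS]normrM ler_piMr// cos_max.
have := @Rfubini_bound R _ _ E E slam slam F _ _ mF (integrable_abs ih) (integrable_abs ig) Fb.
rewrite /slebesgue => H; clear mF Fb.
transitivity (\int[lam]_xi \int[lam]_y F (xi, y)).
  clear H; apply: eq_Rintegral => xi _.
  have ic := integrable_wave xi (wave_cos R) ig.
  have is_ := integrable_wave xi (wave_sin R) ig.
  pose u y := (cos (dot x xi) * h xi) * (g y * cos (dot y xi)).
  pose v y := (sin (dot x xi) * h xi) * (g y * sin (dot y xi)).
  have iu : lam.-integrable setT (EFin \o u) by exact: integrable_scale ic.
  have iv : lam.-integrable setT (EFin \o v) by exact: integrable_scale is_.
  have uE : \int[lam]_y u y = ft cos g xi * (cos (dot x xi) * h xi).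
    by rewrite RintegralZl// mulrC.
  have vE : \int[lam]_y v y = ft sin g xi * (sin (dot x xi) * h xi).
    by rewrite RintegralZl// mulrC.
  transitivity (\int[lam]_y (u y + v y)).
    by rewrite (RintegralD _ iu iv)// uE vE; ring.
  apply: eq_Rintegral => y _; rewrite /u /v /F /= dotBl cosB; ring.
rewrite {}H; apply: eq_Rintegral => y _; rewrite /ft -RintegralZl//.
  by apply: eq_Rintegral => xi _; rewrite /F /= (dotC (x - y)); ring.
by apply: integrable_wave => //; exact: wave_cos.
Qed.

Lemma gauss_scale (c e : R) (x : E) : gauss c (e *: x) = gauss (c * e ^+ 2) x.
Proof. by rewrite /gauss dotZl dotZr; congr (expR (- _)); ring. Qed.

(** Gaussian summation: with the factor [gauss 1 (e xi)] the double transform becomes an average of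
    [g] near [x]. Both expressions converge as [e] tends to 0. The constant found is [(2 pi)^d]. *)
Theorem fourier_inversion : exists2 K : R, 0 < K & forall g, schwartz g ->
  forall x, ft cos (ft cos g) x + ft sin (ft sin g) x = K * g x.
Proof.
have [kappa k0 kE] := ft_gauss R d0.
have q0 : (0 : R) < 1/4 by rewrite divr_gt0.
have Sq : schwartz (gauss (1/4) : E -> R) by exact: gauss_schwartz.
have S1 : schwartz (gauss 1 : E -> R) by apply: gauss_schwartz.
have iq := schwartz_integrable d0 Sq.
have i1 := schwartz_integrable d0 S1.
have half0 : 2^-1 != 0 :> R by rewrite invr_eq0.
have I1 : \int[lam]_x gauss 1 x = kappa.
  have := kE 0; rewrite /ft gauss0 mulr1 => <-.
  by apply: eq_Rintegral => x _; rewrite dot0r cos0 mulr1.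
(* Rescaling by 1/2 turns [gauss 1] into [gauss (1/4)]. *)
have Iq : \int[lam]_x gauss (1/4) x = 2 ^+ d * kappa.
  have := Rintegral_affine 0 half0 (integrable_measurable i1).
  rewrite I1 ger0_norm ?invr_ge0// invrK => <-.
  have q4 : 1 * 2^-1 ^+ 2 = 1/4 :> R by field.
  by apply: eq_Rintegral => x _; rewrite addr0 gauss_scale q4.
exists (kappa * (2 ^+ d * kappa)); first by rewrite !mulr_gt0// exprn_gt0.
move=> g Sg x.
have ig := schwartz_integrable d0 Sg; have mg := integrable_measurable ig.
have [Sc Ss] := schwartz_ft d0 Sg.
pose e_ (n : nat) : R := n.+1%:R^-1.
have e0 n : 0 < e_ n by rewrite invr_gt0.
have ec : e_ @ \oo --> (0 : R) by exact: cvg_harmonic.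
pose G xi := ft cos g xi * cos (dot x xi) + ft sin g xi * sin (dot x xi).
have iG : lam.-integrable setT (EFin \o G).
  by apply: integrable_add; under eq_fun do rewrite (dotC x);
   apply: integrable_wave; [exact: wave_cos|exact: schwartz_integrable|exact: wave_sin|exact: schwartz_integrable].
have mG := integrable_measurable iG.
pose A n := \int[lam]_xi (G xi * gauss 1 (e_ n *: xi)).
have cgauss : continuous (gauss 1 : E -> R) by exact: smooth_continuous S1.1.
have cA : A @ \oo --> \int[lam]_xi G xi.
  refine (@Rintegral_dct _ _ _ lam (fun n xi => G xi * gauss 1 (e_ n *: xi)) G (fun xi => `|G xi|) _ _ _ _ _).2.
  - move=> n; apply: measurable_funM => //.
    under eq_fun do rewrite gauss_scale.
    by apply: smooth_measurable; have [] := @gauss_schwartz R d (1 * e_ n ^+ 2) (mulr_gt0 ltr01 (exprn_gt0 _ (e0 n))).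
  - exact: mG.
  - apply: aeW => xi; rewrite -[X in _ --> X]mulr1; apply: cvgMl_tmp.
    rewrite [X in _ --> X](_ : 1 = gauss 1 (0 : E)); last by rewrite gauss0.
    by apply: (cvg_comp _ _ (scale_cvg0 xi ec)); exact: cgauss.
  - exact: integrable_abs.
  - move=> n xi; rewrite normrM ler_piMr// ger0_norm ?gauss_le1//.
    by rewrite ltW// gauss_gt0.
(* The transform of the wide Gaussian concentrates at scale [e_ n]; the substitution
   [y = x - e_ n *: z] removes the scale and its power. *)
have AE n : A n = \int[lam]_z (g (x - e_ n *: z) * (kappa * gauss (1/4) z)).
  have Se : schwartz (gauss (1 * e_ n ^+ 2) : E -> R).
    by apply: gauss_schwartz; rewrite mul1r exprn_gt0.
  rewrite /A; under eq_Rintegral do rewrite gauss_scale.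
  rewrite ft_summation//.
  have ftE (z : E) : ft cos (gauss (1 * e_ n ^+ 2)) z = (e_ n)^-1 ^+ d * ft cos (gauss 1) ((e_ n)^-1 *: z).
    have en0 : e_ n != 0 by rewrite gt_eqF.
    have mm : measurable_fun setT (fun xi : E => gauss 1 xi * cos (dot xi ((e_ n)^-1 *: z))).
      by apply: integrable_measurable; apply: integrable_wave => //; exact: wave_cos.
    have := Rintegral_affine 0 en0 mm.
    rewrite ger0_norm ?(ltW (e0 n))// => <-.
    by apply: eq_Rintegral => xi _; rewrite addr0 gauss_scale dotZl dotZr mulrA mulfV// !mul1r.
  under eq_Rintegral do rewrite ftE kE.
  have Nen0 : - e_ n != 0 by rewrite oppr_eq0 gt_eqF.
  pose H y := g y * (kappa * gauss (1/4) ((e_ n)^-1 *: (x - y))).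
  have mH : measurable_fun setT H.
    apply: measurable_funM => //; apply: measurable_funM => //.
    have := measurableT_comp (integrable_measurable iq) (measurable_affine (- (e_ n)^-1) ((e_ n)^-1 *: x)).
    congr (measurable_fun _ _); apply/funext => y /=; congr (gauss _ _).
    by rewrite scaleNr scalerBr addrC.
  have HE := Rintegral_affine x Nen0 mH.
  rewrite normrN ger0_norm ?(ltW (e0 n))// in HE.
  transitivity ((e_ n)^-1 ^+ d * \int[lam]_y H y).
    have iH : lam.-integrable setT (EFin \o H).
      have := integrable_scale kappa ig; rewrite /H.
      move=> /integrable_abs ik; apply: integrable_le ik _ => // y.
      rewrite (_ : g y * _ = kappa * g y * gauss (1/4) ((e_ n)^-1 *: (x - y))); last by ring.
      rewrite normrM ler_piMr// ger0_norm ?(ltW (gauss_gt0 _ _))// gauss_le1// ltW.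
    by rewrite -RintegralZl//; apply: eq_Rintegral => y _; rewrite /H; ring.
  rewrite -HE; apply: eq_Rintegral => z _; rewrite /H.
  have -> : - e_ n *: (z : E) + x = x - e_ n *: (z : E) by rewrite scaleNr addrC.
  by rewrite subKr scalerA mulVf ?scale1r// gt_eqF.
have [M HM] := schwartz_rapid Sg 0%N.
(* [g] is bounded and continuous, so the averages tend to [g x] times the mass of the kernel. *)
have cA2 : A @ \oo --> \int[lam]_z (g x * (kappa * gauss (1/4) z)).
  rewrite (_ : A = fun n => \int[lam]_z (g (x - e_ n *: z) * (kappa * gauss (1/4) z))); last exact/funext.
  refine (@Rintegral_dct _ _ _ lam
     (fun n z => g (x - e_ n *: z) * (kappa * gauss (1/4) z)) (fun z => g x * (kappa * gauss (1/4) z))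
     (fun z => (M * kappa) * gauss (1/4) z) _ _ _ _ _).2.
  - move=> n; apply: measurable_funM; last by apply: measurable_funM => //; exact: integrable_measurable iq.
    have := measurableT_comp mg (measurable_affine (- e_ n) x).
    by congr (measurable_fun _ _); apply/funext => y /=; rewrite scaleNr addrC.
  - by apply: measurable_funM => //; apply: measurable_funM => //; exact: integrable_measurable iq.
  - apply: aeW => z; apply: cvgMr_tmp.
    have cg : {for x, continuous g} by exact: smooth_continuous Sg.1 x.
    have : (fun n => x - e_ n *: z) @ \oo --> x.
      rewrite -[X in _ --> X]subr0; apply: cvgB; first exact: cvg_cst.
      exact: scale_cvg0.
    by move=> h; apply: (cvg_comp _ _ h); exact: cg.
  - exact: integrable_scale.
  - move=> n z; rewrite normrM -mulrA; apply: ler_pM => //.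
      by have := HM (x - e_ n *: z); rewrite expr0 mul1r.
    by rewrite ger0_norm// mulr_ge0 ?(ltW k0)// ltW// gauss_gt0.
have /= E1 := cvg_unique _ cA cA2.
rewrite /ft -RintegralD//; last 2 first.
- by apply: integrable_wave; [exact: wave_cos|exact: schwartz_integrable].
- by apply: integrable_wave; [exact: wave_sin|exact: schwartz_integrable].
transitivity (\int[lam]_xi G xi).
  by apply: eq_Rintegral => xi _; rewrite /G (dotC x).
rewrite E1; last by [].
under eq_Rintegral do rewrite mulrA.
by rewrite RintegralZl// Iq; ring.
Qed.

End inversion.

(** * Injectivity of the Fourier transform on tempered distributions *)

Section tempered_distributions.
Context (R : realType) (d : nat).
Local Notation E := 'rV[R]_d.
Implicit Types (f g : E -> R) (T U V W : dist R d).

Lemma temperedD T f g : tempered T -> schwartz f -> schwartz g ->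
  T (fun x => f x + g x) = T f + T g.
Proof.
move=> [lin _] Sf Sg; have := lin 1 f g Sf Sg; rewrite mul1r => <-.
by congr T; apply/funext => x; rewrite mul1r.
Qed.

Lemma tempered0 T : tempered T -> T (fun=> 0) = 0.
Proof.
move=> tT; have := temperedD tT (@schwartz0 R d) (@schwartz0 R d).
rewrite (_ : (fun=> 0 + 0) = fun=> 0); last by apply/funext => x; rewrite addr0.
by move=> /eqP; rewrite -{1}[T _]addr0 (inj_eq (addrI _)) => /eqP.
Qed.

Lemma temperedZ T (c : R) f : tempered T -> schwartz f -> T (fun x => c * f x) = c * T f.
Proof.
move=> tT Sf; have := tT.1 c f (fun=> 0) Sf (@schwartz0 R d).
rewrite tempered0// addr0 => <-.
by congr T; apply/funext => x; rewrite addr0.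
Qed.

Lemma temperedN T f : tempered T -> schwartz f -> T (fun x => - f x) = - T f.
Proof.
move=> tT Sf; rewrite -mulN1r -temperedZ//; congr T.
by apply/funext => x; rewrite mulN1r.
Qed.

Lemma fourier_distE T f : fourier_dist T f =
  complex.Complex (T (ft cos f)) (T (fun xi => - ft sin f xi)).
Proof. by []. Qed.

Hypothesis d0 : (0 < d)%N.

Lemma fourier_dist_eq T U : dist_eq T U -> forall f, schwartz f ->
  fourier_dist T f = fourier_dist U f.
Proof.
move=> TU f Sf; have [Sc Ss] := schwartz_ft d0 Sf.
by rewrite !fourier_distE TU// TU//; exact: schwartzN.
Qed.

(** By inversion each [g] is a multiple of the sum of a double cosine and a double sine transform.
    The real part of [fourier_dist T] at [ft cos g] is the value of [T] at the former, the imaginary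
    part at [ft sin g] gives the latter. *)
Lemma fourier_dist_inj T U : tempered T -> tempered U ->
  (forall f, schwartz f -> fourier_dist T f = fourier_dist U f) -> dist_eq T U.
Proof.
move=> tT tU TU g Sg; have [K K0 KE] := fourier_inversion R d0.
have [Sc Ss] := schwartz_ft d0 Sg.
have [Scc _] := schwartz_ft d0 Sc; have [_ Sss] := schwartz_ft d0 Ss.
have [E1 _] : T (ft cos (ft cos g)) = U (ft cos (ft cos g)) /\ True.
  by have := TU _ Sc; rewrite !fourier_distE => -[-> _].
have E2 : T (ft sin (ft sin g)) = U (ft sin (ft sin g)).
  have := TU _ Ss; rewrite !fourier_distE => -[_].
  by rewrite !temperedN// => /oppr_inj.
have -> : g = fun x => K^-1 * (ft cos (ft cos g) x + ft sin (ft sin g) x).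
  by apply/funext => x; rewrite KE// mulKf// gt_eqF.
by rewrite !temperedZ ?temperedD ?E1 ?E2//; exact: schwartzD.
Qed.

End tempered_distributions.

(** * Cutoffs and the du Bois-Reymond lemma *)

Section flat.
Context (R : realType).
Implicit Types (p : {poly R}) (t u : R).

(* The derivatives of [exp (- 1 / t)] are of this form. *)
Definition flat p t : R := if 0 < t then p.[t^-1] * expR (- t^-1) else 0.

Lemma expRN_poly_bound p : exists C, forall u, 0 <= u -> `|p.[u]| * expR (- u) <= C.
Proof.
have mono n : exists C, forall u, 0 <= u -> u ^+ n * expR (- u) <= C.
  case: n => [|n].
    by exists 1 => u u0; rewrite expr0 mul1r -expR0 ler_expR oppr_le0.
  (* From [u / (n + 1) <= exp (u / (n + 1))], raised to the power [n + 1]. *)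
  exists (n.+1%:R ^+ n.+1) => u u0.
  rewrite expRN ler_pdivrMr ?expR_gt0//.
  have -> : expR u = expR (u / n.+1%:R) ^+ n.+1.
    by rewrite -expRM_natl mulrCA divff ?mulr1.
  rewrite -exprMn lerXn2r ?nnegrE ?mulr_ge0 ?expR_ge0//.
  have h := expR_ge1Dx (u / n.+1%:R).
  apply: (@le_trans _ _ (n.+1%:R * (u / n.+1%:R))); first by rewrite mulrCA divff ?mulr1.
  by rewrite ler_wpM2l//; apply: le_trans h; rewrite lerDr.
have [C HC] := choice mono.
exists (\sum_(i < size p) `|p`_i| * C i) => u u0.
rewrite horner_coef; apply: (@le_trans _ _ ((\sum_(i < size p) `|p`_i| * u ^+ i) * expR (- u))).
  rewrite ler_wpM2r ?expR_ge0//; apply: le_trans (ler_norm_sum _ _ _) _.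
  by apply: ler_sum => i _; rewrite normrM normrX (ger0_norm u0).
by rewrite mulr_suml; apply: ler_sum => i _; rewrite -mulrA ler_wpM2l// HC.
Qed.

(** This is the bound of [u^2 p(u) exp (- u)] at [u = 1 / t]. Quadratic flatness makes the
    derivative at 0 exist and vanish. *)
Lemma flat_bound p : exists C, forall t, `|flat p t| <= C * t ^+ 2.
Proof.
have [C HC] := expRN_poly_bound ('X^2 * p); exists C => t; rewrite /flat.
case: ifPn => [t0|_]; last first.
  rewrite normr0 mulr_ge0 ?sqr_ge0//; apply: le_trans (HC 0 (lexx _)).
  by rewrite mulr_ge0// expR_ge0.
have ti : 0 <= t^-1 by rewrite invr_ge0 ltW.
have := HC _ ti; rewrite hornerM hornerXn normrM (ger0_norm (sqr_ge0 _)) -mulrA exprVn.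
by rewrite mulrC ler_pdivrMr ?exprn_gt0// normrM (ger0_norm (expR_ge0 _)).
Qed.

Lemma flat0 p : flat p 0 = 0.
Proof. by rewrite /flat ltxx. Qed.

(** The factor ['X^2] is the [t^(-2)] of the chain rule, [p] comes from the exponential and [- p']
    from the polynomial. *)
Lemma flat_derive p t : is_derive t (1 : R) (flat p) (flat ('X^2 * (p - p^`())) t).
Proof.
have [t0|t0|->] := ltgtP t 0.
- have -> : flat ('X^2 * (p - p^`())) t = 0 by rewrite /flat ltNge (ltW t0).
  have dc := is_derive_cst (0 : R) t (1 : R).
  apply: near_eq_is_derive dc.
  near=> s; rewrite /flat ifF//; apply/negbTE; rewrite -leNgt ltW//.
  by near: s; exact: lt_nbhsl.
- have tn0 : t != 0 by rewrite gt_eqF.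
  have dV : is_derive t (1:R) (fun s : R => s^-1) (- t ^- 2).
    by have := is_deriveV tn0 (is_derive_id t (1:R)); rewrite /GRing.scale /= mulr1.
  have dp : is_derive (t^-1) (1 : R) (horner p) p^`().[t^-1].
    split; first exact: derivable_horner.
    by rewrite -derive1E derivE.
  have d1 := is_derive1_comp dp dV.
  have d2 := is_derive1_comp (f := expR) (g := fun s => - s^-1) (is_derive_expR (- t^-1)) (is_deriveN dV).
  have d3 := is_deriveM d1 d2.
  rewrite /flat t0 hornerM hornerXn hornerD hornerN.
  rewrite (_ : _ * _ = p.[t^-1] *: (expR (- t^-1) * - - t ^- 2) + expR (- t^-1) *: (p^`().[t^-1] * - t ^- 2)).
    apply: near_eq_is_derive d3.
    by near=> s; rewrite /flat ifT//; near: s; exact: lt_nbhsr.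
  by rewrite /GRing.scale /= -exprVn; ring.
- rewrite flat0.
  have [C HC] := flat_bound p.
  have C0 : 0 <= C by have := HC 1; rewrite expr1n mulr1; apply: le_trans.
  have c0 : (fun h : R => h^-1 *: (flat p (h *: (1 : R) + 0) - flat p 0)) @ 0^' --> (0 : R).
    apply/cvgrPdist_le => e e0.
    have e1 : 0 < e / (C + 1) by rewrite divr_gt0// ltr_pwDr.
    near=> h.
    rewrite sub0r normrN flat0 subr0 addr0 /GRing.scale /= mulr1 normrM normfV.
    have h0 : 0 < `|h| by rewrite normr_gt0; near: h; exact: nbhs_dnbhs_neq.
    rewrite mulrC ler_pdivrMr//; apply: le_trans (HC h) _.
    rewrite -real_normK ?num_real// expr2 mulrA ler_wpM2r//.
    apply: (@le_trans _ _ (C * (e / (C + 1)))).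
      rewrite ler_wpM2l// ltW//; near: h.
      apply: dnbhs0_lt => //.
    rewrite mulrCA ger_pMr// ler_pdivrMr ?ltr_pwDr// mul1r lerDl//.
  split; first by apply/cvg_ex; exists 0; exact: c0.
  by apply/cvg_lim => //; exact: c0.
Unshelve. all: by end_near. Qed.

End flat.

Section smooth_bump.
Context (R : realType) (d : nat).
Local Notation E := 'rV[R]_d.
Implicit Types (f g l : E -> R) (x : E).

Lemma smooth_flat p l : smooth l -> smooth (fun x => flat p (l x)).
Proof.
move=> sl; pose S g := smooth g \/ exists q : {poly R}, g = fun x => flat q (l x).
have gq q x := grad_at_comp (flat_derive q (l x)) (grad_at_partial (smooth_diff x sl)).
apply: (@alg_smooth _ _ S); last by apply: alg_base; right; exists p.
- move=> f [sf x|[q ->] x]; first exact: smooth_diff.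
  by have [] := gq q x.
- move=> f i [sf|[q ->]]; first by apply: alg_base; left; exact: smooth_partial.
  rewrite (_ : partial i _ = fun x => flat ('X^2 * (q - q^`())) (l x) * partial i l x).
    apply: alg_mul; apply: alg_base; last by left; exact: smooth_partial.
    by right; eexists.
  by apply/funext => x; have [_ ->] := gq q x.
Qed.

Lemma smooth_inv f : smooth f -> (forall x, f x != 0) -> smooth (fun x => (f x)^-1).
Proof.
move=> sf f0; pose S g := smooth g \/ g = fun x => (f x)^-1.
have gi x : grad_at (fun x => (f x)^-1) x (fun i => - (f x ^- 2) * partial i f x).
  apply: (grad_at_comp (h := fun t => t^-1)); last exact: grad_at_partial (smooth_diff x sf).
  by have := is_deriveV (f0 x) (is_derive_id (f x) (1:R)); rewrite /GRing.scale /= mulr1.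
apply: (@alg_smooth _ _ S); last by apply: alg_base; right.
- move=> g [sg x|-> x]; first exact: smooth_diff.
  by have [] := gi x.
- move=> g i [sg|->]; first by apply: alg_base; left; exact: smooth_partial.
  rewrite (_ : partial i _ = fun x => - (((f x)^-1 * (f x)^-1)) * partial i f x).
    apply: alg_mul; last by apply: alg_base; left; exact: smooth_partial.
    by apply: alg_opp; apply: alg_mul; apply: alg_base; right.
  by apply/funext => x; have [_ ->] := gi x; rewrite -exprVn expr2.
Qed.

Lemma smooth_coord i : smooth (fun x : E => x ord0 i).
Proof. by have [] := @OM_coord R d i. Qed.

Lemma smooth_sum (I : Type) (r : seq I) (F : I -> E -> R) :
  (forall k, smooth (F k)) -> smooth (fun x => \sum_(k <- r) F k x).
Proof. by move=> SF; apply: alg_smooth_smooth; apply: alg_sum => k; exact: alg_base. Qed.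

Lemma smooth_prod (I : Type) (r : seq I) (F : I -> E -> R) :
  (forall k, smooth (F k)) -> smooth (fun x => \prod_(k <- r) F k x).
Proof.
move=> SF; elim: r => [|k r IH].
  by rewrite (_ : (fun x => _) = fun=> 1); [exact: smooth_cst|apply/funext => x; rewrite big_nil].
rewrite (_ : (fun x => _) = fun x => F k x * \prod_(j <- r) F j x); first exact: smoothM.
by apply/funext => x; rewrite big_cons.
Qed.

Lemma flat1_gt0 (t : R) : (0 < flat 1 t) = (0 < t).
Proof. by rewrite /flat; case: ifP => t0; rewrite ?ltxx// hornerC mul1r expR_gt0. Qed.

Lemma flat1_ge0 (t : R) : 0 <= flat 1 t.
Proof. by rewrite /flat; case: ifP => t0//; rewrite hornerC mul1r expR_ge0. Qed.

Lemma flat1_eq0 (t : R) : t <= 0 -> flat 1 t = 0.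
Proof. by rewrite /flat ltNge => ->. Qed.

(** The quotient [A / (A + B)], where [A] is positive exactly for [|x| < 2M] and [B] exactly for
    [|x| > M]; the denominator never vanishes and [B] vanishes on the ball of radius [M]. *)
Lemma cutoff_exists (M : R) : 0 < M -> exists theta : E -> R,
  [/\ smooth theta, far_zero theta, forall x, enorm x <= M -> theta x = 1 &
     forall x, 0 <= theta x <= 1].
Proof.
move=> M0; pose A x := flat 1 (4 * M ^+ 2 - dot x x).
pose B x := flat 1 (dot x x - M ^+ 2).
have sd : smooth (fun x : E => dot x x) by have [] := @OM_sqr R d.
have sA : smooth A.
  by apply: smooth_flat; apply: smoothD; [exact: smooth_cst|exact: smoothN].
have sB : smooth B by apply: smooth_flat; apply: smoothD => //; exact: smooth_cst.
have M2 : 0 < M ^+ 2 by rewrite exprn_gt0.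
have A0 x : 0 <= A x by exact: flat1_ge0.
have B0 x : 0 <= B x by exact: flat1_ge0.
have AB x : 0 < A x + B x.
  have [h|h] := ltP (M ^+ 2) (dot x x).
    by rewrite ltr_wpDl// flat1_gt0 subr_gt0.
  by rewrite ltr_pwDl// flat1_gt0; lra.
exists (fun x => A x * (A x + B x)^-1); split.
- apply: smoothM => //; apply: smooth_inv; first exact: smoothD.
  by move=> x; rewrite gt_eqF.
- exists (2 * M) => x xM; rewrite /A flat1_eq0 ?mul0r// subr_le0 -sqr_enorm.
  rewrite (_ : 4 * M ^+ 2 = (2 * M) ^+ 2); last by ring.
  by rewrite lerXn2r ?nnegrE ?enorm_ge0 ?mulr_ge0 ?ltW.
- move=> x xM; have hB : B x = 0.
    by rewrite /B flat1_eq0// subr_le0 -sqr_enorm lerXn2r ?nnegrE ?enorm_ge0 ?(ltW M0).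
  by have := AB x; rewrite hB addr0 => /gt_eqF/negbT; exact: divff.
- move=> x; rewrite mulr_ge0 ?invr_ge0 ?(ltW (AB x))//=.
  by rewrite ler_pdivrMr// mul1r lerDl.
Qed.

Lemma far_zeroD f g : far_zero f -> far_zero g -> far_zero (fun x => f x + g x).
Proof.
move=> [M fM] [N gN]; exists (Num.max M N) => x; rewrite gt_max => /andP[Mx Nx].
by rewrite fM// gN// addr0.
Qed.

Let box (z : d.-tuple rat * nat) : set E :=
  [set y : E | forall i, `|y ord0 i - ratr (tnth z.1 i)| <= z.2.+1%:R^-1].

(** Positive exactly on the open box with the centre and size of [box z]; the rational parameters
    make the family countable. *)
Let bump (z : d.-tuple rat * nat) x :=
  \prod_(i <- enum 'I_d) flat 1 (z.2.+1%:R^-1 ^+ 2 - (x ord0 i - ratr (tnth z.1 i)) ^+ 2).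

Let bump_ge0 z x : 0 <= bump z x.
Proof. by apply: prodr_ge0 => i _; exact: flat1_ge0. Qed.

Let bump_gt0 z x : (0 < bump z x) <-> forall i, `|x ord0 i - ratr (tnth z.1 i)| < z.2.+1%:R^-1.
Proof.
rewrite lt0r bump_ge0 andbT prodf_seq_neq0.
have e i : (flat 1 (z.2.+1%:R^-1 ^+ 2 - (x ord0 i - ratr (tnth z.1 i)) ^+ 2) != 0) =
    (`|x ord0 i - ratr (tnth z.1 i)| < z.2.+1%:R^-1).
  rewrite (_ : (_ != 0) = (0 < flat 1 (z.2.+1%:R^-1 ^+ 2 - (x ord0 i - ratr (tnth z.1 i)) ^+ 2))); last by rewrite lt0r flat1_ge0 andbT.
  rewrite flat1_gt0 subr_gt0 -[in LHS](real_normK (num_real (x ord0 i - _))).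
  by rewrite ltr_pXn2r ?nnegrE ?invr_ge0.
split=> [/allP h i|h].
  by rewrite -e; have := h i; rewrite mem_enum => /(_ isT).
by apply/allP => i _; rewrite e /= h.
Qed.

Let bump_smooth z : smooth (bump z).
Proof.
apply: smooth_prod => i; apply: smooth_flat; apply: smoothD; first exact: smooth_cst.
apply: smoothN; have sc : smooth (fun x : E => x ord0 i - ratr (tnth z.1 i)).
  by apply: smoothD; [exact: smooth_coord|exact: smooth_cst].
by under [X in smooth X]eq_fun do rewrite expr2; exact: smoothM.
Qed.

Let box_closed z : closed (box z).
Proof.
rewrite (_ : box z = \bigcap_i [set y : E | `|y ord0 i - ratr (tnth z.1 i)| <= z.2.+1%:R^-1]); last first.
  by apply/seteqP; split=> y yb i; [move=> _; exact: yb|exact: (yb i I)].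
apply: closed_bigI => i _.
have c : continuous (fun y : E => y ord0 i - ratr (tnth z.1 i)).
  by apply: smooth_continuous; apply: smoothD; [exact: smooth_coord|exact: smooth_cst].
apply: (@closed_comp _ _ (fun y : E => y ord0 i - ratr (tnth z.1 i)) [set t : R | `|t| <= _]).
  by move=> y _; exact: c.
apply: (@closed_comp _ _ (fun t : R => `|t|) [set t : R | t <= _]); last exact: closed_le.
by move=> t _; exact: (@norm_continuous R R^o).
Qed.

Let bump_far z : far_zero (bump z).
Proof.
exists (d%:R * (`|\row_i ratr (tnth z.1 i) : E| + z.2.+1%:R^-1)) => x xM.
apply/eqP; rewrite eq_le bump_ge0 andbT leNgt; apply/negP => /bump_gt0 xb.
move: xM; apply/negP; rewrite -leNgt; apply: le_trans (ler_enorm_norm x) _.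
rewrite ler_wpM2l// -[x](subrK (\row_i ratr (tnth z.1 i))) addrC.
apply: le_trans (ler_normD _ _) _; rewrite lerD2l.
rewrite [leLHS]/Num.norm /= mx_normrE; apply: bigmax_le; first by rewrite invr_ge0.
by move=> [i j] _ /=; rewrite (ord1 i) !mxE ltW.
Qed.

(** The bumps whose closed box lies in [A] are summed along the enumeration [unpickle]; finite sums
    keep the supports compact in [A], and a saturation sends them to the indicator. *)
Lemma open_test_approx (A : set E) : open A -> exists f_ : nat -> E -> R,
  [/\ forall n, test_on A (f_ n), forall n x, 0 <= f_ n x <= 1 &
     forall x, f_ ^~ x @ \oo --> (\1_A x : R)].
Proof.
move=> oA; pose b (k : nat) : E -> R :=
  if unpickle k is Some z then if `[< box z `<=` A >] then bump z else cst 0 else cst 0.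
(* [supp] is a closure, so its inclusion in [A] is carried by a closed set inside [A]. *)
pose P f := [/\ smooth f, far_zero f, forall x, 0 <= f x &
  exists C, [/\ closed C, C `<=` A & forall x, ~ C x -> f x = 0]].
have P0 : P (cst 0).
  split=> //; [exact: smooth_cst|by exists 0|exists set0; split => //; exact: closed0].
have PD f g : P f -> P g -> P (fun x => f x + g x).
  move=> [sf ff f0 [C [cC CA fC]]] [sg fg g0 [D [cD DA gD]]]; split.
  - exact: smoothD.
  - exact: far_zeroD.
  - by move=> x; rewrite addr_ge0.
  - exists (C `|` D); split; [exact: closedU|by rewrite subUset|].
    by move=> x /not_orP[nC nD]; rewrite fC// gD// addr0.
have Pb k : P (b k).
  rewrite /b; case: unpickle => [z|//]; case: asboolP => // zA; split => //.
  exists (box z); split => // x nx.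
  apply/eqP; rewrite eq_le bump_ge0 andbT leNgt.
  by apply/negP => /bump_gt0 h; apply: nx => i; exact/ltW/h.
pose Phi n x := \sum_(0 <= k < n) b k x.
have PPhi n : P (Phi n).
  elim: n => [|n IH].
    by rewrite (_ : Phi 0%N = cst 0)//; apply/funext => x; rewrite /Phi big_geq.
  rewrite (_ : Phi n.+1 = fun x => Phi n x + b n x); first exact: PD.
  by apply/funext => x; rewrite /Phi big_nat_recr.
have Phi0 n x : 0 <= Phi n x by have [] := PPhi n.
(* The map [t / (1 + t)] has values in [[0, 1]] and keeps zeros; the factor [n] drives every
   positive value to 1. *)
pose f_ n x := (n%:R * Phi n x) * (1 + n%:R * Phi n x)^-1.
have D0 n x : 0 < 1 + n%:R * Phi n x by rewrite ltr_pwDl// mulr_ge0.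
exists f_; split=> [n|n x|x].
- have [sP [M PM] _ [C [cC CA PC]]] := PPhi n; split.
  + have s1 : smooth (fun x => n%:R * Phi n x) by apply: smoothM => //; exact: smooth_cst.
    apply: smoothM => //; apply: smooth_inv => [|x]; last by rewrite gt_eqF.
    by apply: smoothD => //; exact: smooth_cst.
  + by apply: far_zero_compact_supp; exists M => x /PM; rewrite /f_ => ->; rewrite mulr0 mul0r.
  + apply: subset_trans CA; apply: supp_sub_closed => // x /PC; rewrite /f_ => ->.
    by rewrite mulr0 mul0r.
- apply/andP; split; first by rewrite divr_ge0 ?mulr_ge0// ltW.
  by rewrite /f_ ler_pdivrMr// mul1r lerDr.
- rewrite indicE; have [/set_mem Ax|nAx] := boolP (x \in A); last first.
    have h n : f_ n x = 0.
      have [_ _ _ [C [_ CA PC]]] := PPhi n; rewrite /f_ PC ?mulr0 ?mul0r//.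
      by move=> /CA Ax; rewrite mem_set in nAx.
    by under eq_fun do rewrite h; exact: cvg_cst.
  have [z [zx zA]] := open_rational_box oA Ax.
  have z0 : 0 < bump z x by apply/bump_gt0.
  (* Once [n] passes the code of a box around [x], the sum is bounded below by a fixed positive
     number. *)
  have hP n : (pickle z < n)%N -> bump z x <= Phi n x.
    move=> zn; rewrite /Phi big_mkord (bigD1 (Ordinal zn))//= /b pickleK.
    case: asboolP => // _; rewrite lerDl sumr_ge0// => k _.
    by have [_ _ + _] := Pb k; apply.
  apply/cvgrPdist_le => e e0.
  near=> n.
  have zn : (pickle z < n)%N by near: n; exact: nbhs_infty_gt.
  have nP : n%:R * bump z x <= n%:R * Phi n x by rewrite ler_wpM2l ?hP.
  rewrite /f_ /= (_ : 1 - _ = (1 + n%:R * Phi n x)^-1); last first.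
    by field; rewrite gt_eqF.
  rewrite ger0_norm ?invr_ge0 ?(ltW (D0 n x))// invf_ple ?posrE//.
  apply: le_trans (_ : n%:R * bump z x <= _); last first.
    by apply: le_trans nP _; rewrite lerDr.
  rewrite -ler_pdivrMr//; near: n; exact: nbhs_infty_ger.
Unshelve. all: by end_near. Qed.

End smooth_bump.

(** * The du Bois-Reymond lemma for a general measure *)

Section du_bois_reymond.
Context (R : realType) (d : nat) (mu : {measure set 'rV[R]_d -> \bar R}).
Local Notation E := 'rV[R]_d.
Implicit Types (f g h : E -> R) (x : E).

Lemma measurable_open_generated : @measurable _ E = <<s (open : set (set E)) >>.
Proof.
apply/seteqP; split; last first.
  apply: smallest_sub; first exact: sigma_algebra_measurable.
  by move=> A oA; exact: open_measurable_rV.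
apply: smallest_sub; first exact: smallest_sigma_algebra.
apply: (big_ind (fun F => F `<=` _)) => [|F G hF hG|i _]; first exact: sub0set.
  by rewrite subUset.
have mc : measurable_fun [set: g_sigma_algebraType (open : set (set E))]
    (@row_coord R d i : g_sigma_algebraType (open : set (set E)) -> R).
  apply: (measurability _ (RGenOInfty.measurableE R)) => // _ [_ [r ->] <-].
  rewrite setTI; apply: sub_sigma_algebra.
  apply: open_comp => [x _|]; first exact: coord_continuous.
  by rewrite set_itvE; exact: open_gt.
by move=> _ [B mB <-]; exact: mc.
Qed.

(** Test functions reach the indicators of open sets by domination; open sets are stable under
    intersection and generate the sigma-algebra, so Dynkin induction reaches all measurable sets. *)
Lemma integrable_test_eq0 h : mu.-integrable setT (EFin \o h) ->
  (forall f, test_on setT f -> \int[mu]_x (f x * h x) = 0) -> {ae mu, forall x, h x = 0}.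
Proof.
move=> ih h0; have mh := integrable_measurable ih.
have open0 A : open A -> (\int[mu]_(x in A) (h x)%:E = 0)%E.
  move=> oA; have mA := open_measurable_rV oA.
  have [f_ [tf f01 fA]] := open_test_approx oA.
  have [iA] : mu.-integrable setT (EFin \o (fun x => (\1_A x : R) * h x)) /\
      (fun n => \int[mu]_x (f_ n x * h x)) @ \oo --> \int[mu]_x ((\1_A x : R) * h x).
    apply: (@Rintegral_dct _ _ _ mu (fun n x => f_ n x * h x) _ (fun x => `|h x|)).
    - move=> n; apply: measurable_funM => //; have [sf _ _] := tf n.
      exact: smooth_measurable.
    - by apply: measurable_funM.
    - by apply/aeW => x; apply: cvgMl; exact: fA.
    - exact: integrable_abs.
    - move=> n x; have /andP[p q] := f01 n x.
      by rewrite normrM ger0_norm// ler_piMl.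
  have f0 n : \int[mu]_x (f_ n x * h x) = 0.
    by apply: h0; have [sf cf _] := tf n; split.
  under eq_fun do rewrite f0.
  move=> /(cvg_unique (@norm_hausdorff _ R^o) (cvg_cst (0 : R))) /= e.
  rewrite integral_mkcond (_ : _ \_ _ = EFin \o (fun x => (\1_A x : R) * h x)); last first.
    apply/funext => x; rewrite /patch /= indicE; case: (x \in A); by rewrite ?mul1r ?mul0r.
  by rewrite -(fineK (integrable_fin_num measurableT iA)) -[fine _]e.
have all0 A : measurable A -> (\int[mu]_(x in A) (h x)%:E = 0)%E.
  rewrite measurable_open_generated; move: A.
  apply: (@dynkin_induction _ E (open : set (set E)) (fun A => \int[mu]_(x in A) (h x)%:E = 0)%E).
  - exact: measurable_open_generated.
  - exact: openI.
  - exact/open0/openT.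
  - exact: open0.
  (* The whole space is open, so its integral vanishes and additivity handles the complement. *)
  - move=> S mS S0; have := open0 _ openT.
    rewrite -(setUv S) integral_setU_EFin//; last first.
      - by rewrite disj_set2E setICr.
      - exact/measurable_funTS.
      - exact: measurableC.
    by rewrite S0 add0e.
  - move=> F mF tF F0; rewrite integral_bigcup//; last first.
      by apply: (integrableS measurableT) ih => //; exact: bigcupT_measurable.
    by rewrite eseries0// => n _ _; exact: F0.
have : ae_eq mu setT (EFin \o h) (cst 0%E).
  apply: integral_ae_eq => // A _ mA; rewrite integral0; exact: all0.
by move=> /filterS; apply => x /(_ I) [].
Qed.

(** Only the products of [h] with test functions are integrable here. The integrable case is applied
    to [chi n * h] for cutoffs that are 1 on growing balls. *)
Lemma test_eq0 h : measurable_fun setT h ->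
  (forall f, test_on setT f -> mu.-integrable setT (EFin \o (fun x => f x * h x)) /\
     \int[mu]_x (f x * h x) = 0) -> {ae mu, forall x, h x = 0}.
Proof.
move=> mh h0.
have /choice[chi Hchi] : forall n : nat, exists theta : E -> R,
  [/\ smooth theta, far_zero theta, forall x, enorm x <= n.+1%:R -> theta x = 1 &
     forall x, 0 <= theta x <= 1] by move=> n; exact: cutoff_exists.
have tchi n f : smooth f -> test_on setT (fun x => f x * chi n x).
  have [sc [M cM] _ _] := Hchi n => sf; split=> //; first exact: smoothM.
  by apply: far_zero_compact_supp; exists M => x /cM ->; rewrite mulr0.
have cn n : {ae mu, forall x, chi n x * h x = 0}.
  apply: integrable_test_eq0.
    have [+ _] := h0 _ (tchi n _ (@smooth_cst R d 1)).
    by under eq_fun do rewrite mul1r.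
  move=> f [sf _ _]; have [_ <-] := h0 _ (tchi n f sf).
  by apply: eq_Rintegral => x _; rewrite mulrA.
apply: filterS (ae_foralln cn) => x hx.
have [n nx] : exists n : nat, enorm x <= n.+1%:R.
  exists (Num.bound (enorm x)); apply: le_trans (ltW (archi_boundP (enorm_ge0 x))) _.
  by rewrite ler_nat.
have [_ _ c1 _] := Hchi n.
by have := hx n; rewrite c1// mul1r.
Qed.

Lemma test_measure_eq0 (A : set E) : open A -> mu setT \is a fin_num ->
  (forall f, test_on A f -> \int[mu]_x f x = 0) -> mu A = 0%E.
Proof.
move=> oA mufin f0; have mA := open_measurable_rV oA.
have [f_ [tf f01 fA]] := open_test_approx oA.
have i1 := integrable_one mufin.
have [iA] : mu.-integrable setT (EFin \o (\1_A : E -> R)) /\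
      (fun n => \int[mu]_x (f_ n x)) @ \oo --> \int[mu]_x (\1_A x : R).
  apply: (@Rintegral_dct _ _ _ mu f_ _ (cst 1)) => //.
  - by move=> n; have [sf _ _] := tf n; exact: smooth_measurable.
  - by apply/aeW => x; exact: fA.
  - by move=> n x; have /andP[p q] := f01 n x; rewrite ger0_norm.
under eq_fun => n do rewrite f0//.
move=> /(cvg_unique (@norm_hausdorff _ R^o) (cvg_cst (0 : R))) /= e.
have := integral_indic mu measurableT mA; rewrite setIT => <-.
by rewrite -(fineK (integrable_fin_num measurableT iA)) -[fine _]e.
Qed.

End du_bois_reymond.

(** * Riesz kernels and their potentials *)

Section powers.
Context (R : realType) (d : nat).
Local Notation E := 'rV[R]_d.
Implicit Types (f g : E -> R) (x y : E) (b s : R).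

Lemma measurable_enorm_powR b : measurable_fun setT (fun x : E => enorm x `^ b).
Proof. exact: (measurableT_comp (measurable_powR b) (@measurable_enorm R d)). Qed.

Lemma enorm_powR_dot b x : enorm x `^ b = dot x x `^ (b / 2).
Proof. by rewrite /enorm -powR12_sqrt ?dot_ge0// -powRrM mulrC. Qed.

Lemma enorm_powR_grad b x : x != 0 ->
  grad_at (fun y => enorm y `^ b) x (fun i => b * enorm x `^ (b - 2) * x ord0 i).
Proof.
move=> x0; have q0 : 0 < dot x x by rewrite -sqr_enorm exprn_gt0// enorm_gt0.
have -> : (fun y : E => enorm y `^ b) = fun y => dot y y `^ (b / 2).
  by apply/funext => y; rewrite enorm_powR_dot.
have H := grad_at_comp (f := fun y : E => dot y y) (h := fun t : R => t `^ (b / 2)) (is_derive1_powR (b / 2) q0) (grad_at_sqr x).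
apply: (grad_at_eq H) => i.
rewrite enorm_powR_dot (_ : (b - 2) / 2 = b / 2 - 1); last by field.
by field.
Qed.

Lemma enorm_powR_le b : 0 <= b -> exists n : nat, forall x, enorm x `^ b <= (1 + enorm x) ^+ n.
Proof.
move=> b0; exists (Num.bound b) => x.
have bn : b <= (Num.bound b)%:R by exact/ltW/archi_boundP.
have x1 : 0 <= 1 + enorm x by rewrite addr_ge0 ?enorm_ge0.
rewrite -powR_mulrn//; apply: (@le_trans _ _ ((1 + enorm x) `^ b)).
  by rewrite ge0_ler_powR ?nnegrE ?enorm_ge0// lerDr.
by apply: ler_powR => //; exact: enorm1_ge1.
Qed.

(** The power is unbounded at most near the origin, where [f] is 0. Away from it, for either sign of
    [b], the exponents [- |b|] and [|b|] bound it below and above radius 1. *)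
Lemma vanish_powR_tame f b : tame f -> (\forall x \near (0 : E), f x = 0) ->
  tame (fun x => f x * enorm x `^ b).
Proof.
move=> tf /nbhs_ballP[e /= e0 fe].
have fe' x : enorm x < e -> f x = 0.
  move=> xe; apply: fe; rewrite -ball_normE /ball_ /= sub0r normrN.
  exact: le_lt_trans (ler_norm_enorm x) xe.
have [n Hn] := enorm_powR_le (normr_ge0 b).
have p0 : 0 <= e `^ (- `|b|) by exact: powR_ge0.
have y0 x : 0 <= 1 + enorm x by rewrite addr_ge0 ?enorm_ge0.
have tq : tame (fun x : E => (1 + e `^ (- `|b|)) * (1 + enorm x) ^+ n).
  exists n, (1 + e `^ (- `|b|)) => x; rewrite ger0_norm//.
  by rewrite mulr_ge0 ?addr_ge0 ?exprn_ge0.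
have [N [C H]] := tameM tf tq; exists N, C => x; apply: le_trans (H x).
rewrite !normrM; have [xe|ex] := ltP (enorm x) e.
  by rewrite fe'// normr0 !mul0r.
have x0 : 0 < enorm x by exact: lt_le_trans ex.
rewrite ler_wpM2l// ger0_norm ?powR_ge0// -normrM ger0_norm; last first.
  by rewrite mulr_ge0 ?addr_ge0 ?exprn_ge0.
have en : 1 <= (1 + enorm x) ^+ n by rewrite exprn_ege1// lerDl enorm_ge0.
have lb : - `|b| <= b by rewrite lerNl -normrN ler_norm.
have [x1|x1] := leP 1 (enorm x).
  apply: (@le_trans _ _ (enorm x `^ `|b|)); first by rewrite ler_powR// ler_norm.
  apply: le_trans (Hn x) _; rewrite ler_peMl ?exprn_ge0//; lra.
apply: (@le_trans _ _ (enorm x `^ (- `|b|))); first by rewrite ger_powR// x0 (ltW x1).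
apply: (@le_trans _ _ (e `^ (- `|b|))).
  rewrite !powRN lef_pV2 ?posrE ?powR_gt0// ge0_ler_powR ?nnegrE//; exact: ltW.
apply: le_trans (_ : 1 + e `^ (- `|b|) <= _); first by rewrite lerDr.
by rewrite ler_peMr// addr_ge0.
Qed.

Lemma vanish_powR_OM f b : OM f -> (\forall x \near (0 : E), f x = 0) ->
  OM (fun x => f x * enorm x `^ b).
Proof.
move=> Of f0.
(* Each derivative also produces the exponent [c - 2], so the exponent must vary within the
   class. *)
pose S g := exists h c, [/\ OM h, \forall x \near (0 : E), h x = 0 & g = fun x => h x * enorm x `^ c].
have Sg h c x : OM h -> (\forall x \near (0 : E), h x = 0) ->
    grad_at (fun x => h x * enorm x `^ c) x
      (fun i => partial i h x * enorm x `^ c + (c * x ord0 i * h x) * enorm x `^ (c - 2)).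
  move=> [sh _] h0; have [->|x0] := eqVneq x 0.
    have h00 : h 0 = 0 by exact: nbhs_singleton h0.
    have dh : grad_at h 0 (fun=> 0) by exact: grad_at_near0.
    apply: grad_at_eq (grad_at_near0 _) _.
      by apply: filterS h0 => y ->; rewrite mul0r.
    by move=> i; have [_ ->] := dh; rewrite h00 !(mul0r, mulr0) addr0.
  apply: grad_at_eq (grad_atM (grad_at_partial (smooth_diff x sh)) (enorm_powR_grad c x0)) _ => i.
  by ring.
apply: (@alg_OM _ _ S) => [g [h [c [Oh h0 ->]]]|g [h [c [Oh h0 ->]]] x|g i [h [c [Oh h0 ->]]]|]; last first.
- by apply: alg_base; exists f, b.
- have -> : partial i (fun x => h x * enorm x `^ c) =
      fun x => partial i h x * enorm x `^ c + (c * x ord0 i * h x) * enorm x `^ (c - 2).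
    by apply/funext => x; have [_ ->] := Sg h c x Oh h0.
  apply: alg_add; apply: alg_base.
    exists (partial i h), c; split=> //; first exact: OM_partial.
    by apply: filterS (near_join h0) => x /grad_at_near0[_ ->].
  exists (fun x => c * x ord0 i * h x), (c - 2); split=> //.
    apply: OMM => //; apply: OMM; [exact: OM_cst|exact: OM_coord].
  by apply: filterS h0 => x ->; rewrite mulr0.
- by have [] := Sg h c x Oh h0.
- by apply: vanish_powR_tame => //; case: Oh => _ /(_ [::]).
Qed.

End powers.

(** * The kernels [psi] and [K] *)

Section kernels.
Context (R : realType) (d : nat).
Local Notation E := 'rV[R]_d.
Local Notation lam := (lebesgue R d).
Local Notation dx i := (delta_mx ord0 i : E).
Implicit Types (f g : E -> R) (x y : E) (s : R).

Lemma powR_le1D s (u : R) : 0 <= s -> s <= 1 -> 0 <= u -> u `^ s <= 1 + u.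
Proof.
move=> s0 s1 u0; have [u1|u1] := leP 1 u.
  apply: (@le_trans _ _ (u `^ 1)); first exact: ler_powR.
  by rewrite powRr1// lerDr.
apply: (@le_trans _ _ (1 `^ s)); last by rewrite powR1 lerDl.
by rewrite ge0_ler_powR ?nnegrE// ltW.
Qed.

Lemma powR1D_dist s (u v : R) : 0 <= s -> s < 1 -> 0 <= u -> 0 <= v ->
  `|u `^ (1 + s) - v `^ (1 + s)| <= 2 * (1 + u + v) * `|u - v|.
Proof.
move=> s0 s1.
wlog uv : u v / v <= u.
  move=> H u0 v0; have [/H|/ltW/H] := leP v u; first exact.
  by rewrite distrC (distrC v) addrAC; exact.
move=> u0 v0; have s10 : 1 + s != 0 by rewrite gt_eqF// ltr_pwDl.
have [uz|un0] := eqVneq u 0.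
  have vz : v = 0 by apply/eqP; rewrite eq_le v0 -uz uv.
  by rewrite uz vz !subrr normr0 mulr0.
have up : 0 < u by rewrite lt0r un0.
have sp w : 0 <= w -> w `^ (1 + s) = w * w `^ s.
  by move=> w0; rewrite powRD ?(negbTE s10)// powRr1.
rewrite !sp// (ger0_norm (_ : 0 <= u - v)) ?subr_ge0//.
have us := powR_le1D s0 (ltW s1) u0; have vs := powR_le1D s0 (ltW s1) v0.
have vu : v `^ s <= u `^ s by rewrite ge0_ler_powR ?nnegrE.
(* This is [v / u <= (v / u)^s], true since [v / u <= 1] and [s <= 1]. *)
have uvs : u * (u `^ s - v `^ s) <= u `^ s * (u - v).
  suff : u `^ s * v <= u * v `^ s by lra.
  have [->|vn0] := eqVneq v 0; first by rewrite mulr0 mulr_ge0// powR_ge0.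
  have vp : 0 < v by rewrite lt0r vn0.
  have -> : v = u * (v / u) by rewrite mulrCA divff ?mulr1.
  rewrite powRM ?divr_ge0// mulrCA ler_wpM2l// ler_wpM2l ?powR_ge0//.
  have q1 : 0 < v / u <= 1 by rewrite divr_gt0//= ler_pdivrMr ?mul1r.
  rewrite -{1}(powRr1 (_ : 0 <= v / u)) ?divr_ge0//.
  by apply: ger_powR => //; exact: ltW.
rewrite (_ : _ - _ = u * (u `^ s - v `^ s) + (u - v) * v `^ s); last by ring.
rewrite ger0_norm; last first.
  by rewrite addr_ge0 ?mulr_ge0 ?subr_ge0 ?powR_ge0.
have d0 : 0 <= u - v by rewrite subr_ge0.
nra.
Qed.

Lemma K_coord s x i : K s x ord0 i = (1 + s) * enorm x `^ (s - 1) * x ord0 i.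
Proof. by rewrite /K; case: eqP => [->|_]; rewrite ?mxE// mulr0. Qed.

Lemma measurable_K s i : measurable_fun setT (fun x : E => K s x ord0 i).
Proof.
under eq_fun do rewrite K_coord.
apply: measurable_funM; last exact: measurable_coord.
by apply: measurable_funM => //; exact: measurable_enorm_powR.
Qed.

(** [K s] has size [(1 + s) |x|^s]: bounded near the origin and of at most linear growth, uniformly
    in [s]. *)
Lemma K_bound s x i : 0 <= s -> s < 1 -> `|K s x ord0 i| <= 2 * (1 + enorm x).
Proof.
move=> s0 s1; rewrite K_coord.
have [->|x0] := eqVneq x 0; first by rewrite mxE mulr0 normr0 mulr_ge0// addr_ge0// enorm_ge0.
have e0 : enorm x != 0 by rewrite gt_eqF// enorm_gt0.
rewrite !normrM (ger0_norm (powR_ge0 _ _)) ger0_norm ?addr_ge0// -mulrA.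
apply: ler_pM; rewrite ?addr_ge0 ?mulr_ge0 ?powR_ge0//; first lra.
apply: (@le_trans _ _ (enorm x `^ (s - 1) * enorm x)).
  by rewrite ler_wpM2l ?powR_ge0// ler_coord_enorm.
rewrite -{2}(powRr1 (enorm_ge0 x)) -powRD; last by rewrite e0 implybT.
by rewrite subrK; apply: powR_le1D; rewrite ?enorm_ge0// ltW.
Qed.

Lemma K_odd s x i : K s (- x) ord0 i = - K s x ord0 i.
Proof. by rewrite !K_coord enormN mxE mulrN. Qed.

Lemma psi_grad s x : x != 0 -> grad_at (psi s) x (fun i => K s x ord0 i).
Proof.
move=> x0; apply: grad_at_eq (enorm_powR_grad (1 + s) x0) _ => i.
by rewrite K_coord (_ : 1 + s - 2 = s - 1)//; ring.
Qed.

Lemma K_continuous s i x : x != 0 -> {for x, continuous (fun y : E => K s y ord0 i)}.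
Proof.
move=> x0; have -> : (fun y : E => K s y ord0 i) = fun y => (1 + s) * enorm y `^ (s - 1) * y ord0 i.
  by apply/funext => y; rewrite K_coord.
have [df _] := grad_atM (grad_atZ (1 + s) (enorm_powR_grad (s - 1) x0)) (grad_at_coord i x).
exact: (differentiable_continuous df).
Qed.

Lemma measurable_psi s : measurable_fun setT (@psi R d s).
Proof. exact: measurable_enorm_powR. Qed.

Lemma psi_tame s : 0 <= s -> tame (@psi R d s).
Proof.
move=> s0; have [|n Hn] := @enorm_powR_le R d (1 + s); first by rewrite addr_ge0.
by exists n, 1 => x; rewrite mul1r /psi ger0_norm ?powR_ge0 ?Hn.
Qed.

Lemma psi_quotient_limit s i : 0 <= s -> s < 1 ->
  quotient_limit i (@psi R d s) (fun x => K s x ord0 i).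
Proof.
move=> s0 s1; split=> [x x0 t_ t0 tn0|].
  by have [df <-] := psi_grad s x0; exact: partial_cvg_seq.
(* By [powR1D_dist] and [|t| <= 1] the quotient is at most [2 (2 + 2 |x|)], below [6 (1 + |x|)]. *)
exists 1%N, 6 => x t t1 tn0; rewrite normrM normfV ler_pdivrMr ?normr_gt0// expr1.
have e1 : enorm (x + t *: dx i) <= enorm x + `|t|.
  by apply: le_trans (ler_enormD _ _) _; rewrite enormZ enorm_delta mulr1.
have e2 : `|enorm (x + t *: dx i) - enorm x| <= `|t|.
  by apply: le_trans (ler_dist_enorm _ _) _; rewrite addrAC subrr add0r enormZ enorm_delta mulr1.
apply: le_trans (powR1D_dist s0 s1 (enorm_ge0 _) (enorm_ge0 _)) _.
apply: ler_pM => //; first by rewrite mulr_ge0 ?addr_ge0 ?enorm_ge0.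
have := enorm_ge0 x; lra.
Qed.

Hypothesis d0 : (0 < d)%N.

Lemma measurable_translate y : measurable_fun [set: E] (fun x : E => x - y).
Proof. by have := @measurable_affine R d 1 (- y); under eq_fun do rewrite scale1r. Qed.

Lemma measurable_sub2 : measurable_fun setT (fun z : E * E => z.1 - z.2).
Proof.
apply: measurable_fun_rVP => i; under eq_fun do rewrite !mxE.
apply: measurable_funB; first exact: (measurable_comp_fst (@measurable_coord _ _ i)).
exact: (measurable_comp_snd (@measurable_coord _ _ i)).
Qed.

Lemma ler_enorm1B x y : 1 + enorm (x - y) <= (1 + enorm x) * (1 + enorm y).
Proof.
have := ler_enormB x y; have := enorm_ge0 x; have := enorm_ge0 y.
have := mulr_ge0 (enorm_ge0 x) (enorm_ge0 y); lra.
Qed.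

Lemma tame_translate f y : tame f -> tame (fun x => f (x - y)).
Proof.
move=> /tame_ge0[N [C [C0 fC]]]; exists N, (C * (1 + enorm y) ^+ N) => x.
apply: le_trans (fC _) _; rewrite -mulrA ler_wpM2l// -exprMn.
by rewrite lerXn2r ?nnegrE ?mulr_ge0 ?addr_ge0 ?enorm_ge0// mulrC ler_enorm1B.
Qed.

(** Integration by parts exempts the origin only, so the translation by [y] is moved onto [f]. *)
Lemma psi_by_parts s i y f : 0 <= s -> s < 1 -> smooth f -> far_zero f ->
  \int[lam]_x (psi s (x - y) * partial i f x) = - \int[lam]_x (K s (x - y) ord0 i * f x).
Proof.
move=> s0 s1 sf ff.
pose fy x := f (1 *: x + y).
have sy : smooth fy by exact: smooth_affine.
have Sy : schwartz fy.
  apply: far_zero_schwartz => //; have [M fM] := ff; exists (M + enorm y) => x xM.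
  rewrite /fy scale1r; apply: fM; rewrite -(ltrD2r (enorm y)); apply: lt_le_trans xM _.
  by rewrite -{1}(addrK y x) (le_trans (ler_enormB _ _)).
have [_ E] := integration_by_parts_rV d0 (measurable_psi s) (measurable_K s i) (psi_tame s0)
  (psi_quotient_limit i s0 s1) Sy.
have pfy x : partial i fy x = partial i f (x + y).
  have [_ ->] := grad_at_affine (grad_at_partial (smooth_diff (1 *: x + y) sf)).
  by rewrite mul1r scale1r.
have mf := smooth_measurable sf.
have mpf := smooth_measurable (smooth_partial i sf).
have mB := @measurable_translate y.
transitivity (\int[lam]_x (psi s x * partial i fy x)).
  rewrite -(@Rintegral_shift R d (fun x => psi s (x - y) * partial i f x) y); last first.
    by apply: measurable_funM => //; exact: (measurableT_comp (measurable_psi s) mB).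
  by apply: eq_Rintegral => x _; rewrite addrK pfy.
rewrite E; congr (- _).
rewrite -(@Rintegral_shift R d (fun x => K s (x - y) ord0 i * f x) y); last first.
  by apply: measurable_funM => //; exact: (measurableT_comp (measurable_K s i) mB).
by apply: eq_Rintegral => x _; rewrite addrK /fy scale1r.
Qed.

End kernels.

(** * Averages over balls *)

Section ball_averages.
Context (R : realType) (d : nat).
Local Notation E := 'rV[R]_d.
Local Notation lam := (lebesgue R d).
Implicit Types (f g h : E -> R) (x y z : E).
Hypothesis d0 : (0 < d)%N.

Definition ball_indic z : R := (enorm z < 1)%R%:R.

Lemma measurable_ball_indic : measurable_fun setT ball_indic.
Proof.
rewrite (_ : ball_indic = \1_[set z : E | enorm z < 1]); last first.
  apply/funext => z; rewrite /ball_indic indicE; congr (_%:R).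
  have [z1|z1] := ltP (enorm z) 1; first by rewrite mem_set.
  by rewrite memNset//= ltNge z1.
by apply: measurable_indic; apply: open_measurable_rV; exact: open_enorm_lt.
Qed.

Lemma ball_indic_ge0 z : 0 <= ball_indic z. Proof. by rewrite ler0n. Qed.

Lemma ball_indic_integrable : lam.-integrable setT (EFin \o ball_indic).
Proof.
apply: (@integrable_decay _ _ d0 (2 ^+ (2 * d))); first exact: measurable_ball_indic.
move=> z; rewrite /ball_indic; case: ltP => z1; rewrite ?normr0 ?mulr0 ?exprn_ge0// normr1 mulr1.
by rewrite lerXn2r ?nnegrE ?addr_ge0 ?enorm_ge0//; lra.
Qed.

Lemma ball_indic_gt0 : 0 < \int[lam]_z ball_indic z.
Proof.
(* The cube of side [1 / (d + 1)] lies in the unit ball, because [|x| <= d * sup |x_i| < 1] on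
   it. *)
pose w (t : R) : R := \1_`[0, d.+1%:R^-1]%classic t.
have mw : measurable_fun setT w by exact: measurable_indic.
have wb z : (\prod_(i < d) w (z ord0 i)) <= ball_indic z.
  have [[i wi]|h] := pselect (exists i, w (z ord0 i) = 0).
    by rewrite (bigD1 i)//= wi mul0r ball_indic_ge0.
  have zi i : 0 <= z ord0 i <= d.+1%:R^-1.
    have : w (z ord0 i) <> 0 by move=> e; apply: h; exists i.
    by rewrite /w indicE; case: (boolP (_ \in _)) => // /set_mem /=; rewrite in_itv.
  have -> : ball_indic z = 1.
    rewrite /ball_indic (_ : enorm z < 1)//; apply: le_lt_trans (ler_enorm_norm z) _.
    apply: (@le_lt_trans _ _ (d%:R * d.+1%:R^-1)).
      rewrite ler_wpM2l// [leLHS]/Num.norm /= mx_normrE; apply: bigmax_le; first by rewrite invr_ge0.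
      by move=> [k j] _ /=; rewrite (ord1 k); have /andP[p q] := zi j; rewrite ger0_norm.
    by rewrite ltr_pdivrMr// mul1r ltr_nat.
  apply: (@le_trans _ _ (\prod_(i < d) 1)); last by rewrite big1.
  by apply: ler_prod => i _; rewrite /w indicE; case: (_ \in _); rewrite ?lexx ?ler01.
have w0 t : 0 <= w t by rewrite /w indicE.
have E1 : (\int[lam]_x (\prod_(i < d) w (x ord0 i))%:E = (d.+1%:R^-1 ^+ d)%:E)%E.
  rewrite (@lebesgue_prod _ _ (fun=> w))//.
  have -> : (\int[lebesgue_measure]_x (w x)%:E = (d.+1%:R^-1)%:E)%E.
    rewrite integral_indic// setIT; apply: (etrans (lebesgue_measure_itv `[0, d.+1%:R^-1])).
    by rewrite /= lte_fin invr_gt0 ltr0n /= oppr0 adde0.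
  by rewrite prodEFin prodr_const card_ord.
have le1 : ((d.+1%:R^-1 ^+ d)%:E <= \int[lam]_z (ball_indic z)%:E)%E.
  rewrite -E1; apply: ge0_le_integral => //.
  - by move=> z _; rewrite lee_fin prodr_ge0.
  - apply/measurable_EFinP; apply: measurable_prod => i _.
    exact: (measurableT_comp mw (@measurable_coord _ _ i)).
  - by apply/measurable_EFinP; exact: measurable_ball_indic.
  - by move=> z _; rewrite lee_fin.
rewrite -(fineK (integrable_fin_num measurableT ball_indic_integrable)) lee_fin in le1.
by apply: lt_le_trans le1; rewrite exprn_gt0.
Qed.

(** Rescaling to the unit ball makes the domain independent of [rho]; the powers [rho^d] of volume
    and integral cancel. *)
Lemma ball_average h x (rho : R) : measurable_fun setT h -> 0 < rho ->
  (fine (lam [set y | enorm (y - x) < rho]))^-1 *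
    \int[lam]_(y in [set y | enorm (y - x) < rho]) h y =
  (\int[lam]_z ball_indic z)^-1 * \int[lam]_z (h (rho *: z + x) * ball_indic z).
Proof.
move=> mh rho0; have rn0 : rho != 0 by rewrite gt_eqF.
pose u y := ball_indic (rho^-1 *: (y - x)).
have uE z : u (rho *: z + x) = ball_indic z by rewrite /u addrK scalerA mulVf// scale1r.
have uB y : u y = (enorm (y - x) < rho)%R%:R.
  rewrite /u /ball_indic enormZ ger0_norm ?invr_ge0 ?(ltW rho0)//.
  by rewrite mulrC ltr_pdivrMr// mul1r.
have mu : measurable_fun setT u.
  have -> : u = fun y => ball_indic (rho^-1 *: y + - (rho^-1 *: x)).
    by apply/funext => y; rewrite /u scalerBr.
  exact: (measurableT_comp measurable_ball_indic (measurable_affine _ _)).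
have H g : measurable_fun setT g -> \int[lam]_(y in [set y | enorm (y - x) < rho]) g y =
    rho ^+ d * \int[lam]_z (g (rho *: z + x) * ball_indic z).
  move=> mg; have := @Rintegral_affine _ _ (fun y => g y * u y) rho x rn0 (measurable_funM mg mu).
  under eq_Rintegral do rewrite uE.
  rewrite ger0_norm ?(ltW rho0)// exprVn => ->.
  rewrite mulrA divff ?expf_neq0// mul1r Rintegral_mkcond; apply: eq_Rintegral => y _.
  rewrite /patch uB; case: (boolP (y \in _)) => [/set_mem /= ->|]; first by rewrite mulr1.
  by rewrite notin_setE /= => /negP/negbTE ->; rewrite mulr0.
have -> : fine (lam [set y | enorm (y - x) < rho]) = \int[lam]_(y in [set y | enorm (y - x) < rho]) (1 : R).
  rewrite Rintegral_cst ?mul1r// -[X in measurable X]setTI.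
  have := measurableT_comp (@measurable_enorm R d) (measurable_translate x).
  by move=> /(_ measurableT _ (measurable_itv `]-oo, rho[)); rewrite set_itvE.
rewrite !H//.
under [X in (_ * X)^-1]eq_Rintegral do rewrite mul1r.
by rewrite invfM mulrACA mulVf ?mul1r ?expf_neq0.
Qed.

(** The ball is symmetric about its centre, so the average sees only the even part of [k] about [x].
    This is where the oddness of the kernel becomes usable. *)
Lemma ball_symmetrize (k : E -> R) x (rho : R) :
  lam.-integrable setT (EFin \o (fun z : E => k (rho *: z + x) * ball_indic z)) ->
  lam.-integrable setT (EFin \o (fun z : E => (k (rho *: z + x) + k (x - rho *: z)) * ball_indic z)) /\
  \int[lam]_z ((k (rho *: z + x) + k (x - rho *: z)) * ball_indic z) =
    2 * \int[lam]_z (k (rho *: z + x) * ball_indic z).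
Proof.
move=> ik; pose q z := k (rho *: z + x) * ball_indic z.
have e : (fun z : E => (k (rho *: z + x) + k (x - rho *: z)) * ball_indic z) = fun z => q z + q (- z).
  by apply/funext => z; rewrite /q /ball_indic enormN scalerN (addrC (- _)) mulrDl.
rewrite e; have iq := integrable_opp ik.
split; first exact: (integrable_add ik iq).
transitivity (\int[lam]_z q z + \int[lam]_z q (- z)); first exact: (RintegralD measurableT ik iq).
by rewrite (Rintegral_opp (integrable_measurable ik)) mulr_natl mulr2n.
Qed.

End ball_averages.

(** * Gradients of the potentials of finite measures *)

Section potentials.
Context (R : realType) (d : nat).
Local Notation E := 'rV[R]_d.
Local Notation lam := (lebesgue R d).
Local Notation slam := (@slebesgue R d).
Implicit Types (f g : E -> R) (x y : E).
Hypothesis d0 : (0 < d)%N.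
Variables (s : R) (mu : {finite_measure set E -> \bar R}) (T : dist R d).
Hypotheses (s0 : 0 <= s) (s1 : s < 1) (muT : psi_conv s mu T).

Let m1 : mu.-integrable setT (EFin \o (cst 1 : E -> R)).
Proof. exact/integrable_one/fin_num_measure. Qed.

(** The convolution tested against a Gaussian is an integrable function of [y], and it grows at
    least like [|y|], because [psi s (x - y) >= |y| - |x| - 1]. *)
Lemma psi_conv_moment : mu.-integrable setT (EFin \o (fun y => 1 + enorm y)).
Proof.
have [_ /(_ (gauss 1) (@gauss_schwartz R d 1 ltr01))[iu _]] := muT.
have Sg := @gauss_schwartz R d 1 ltr01.
have ig := schwartz_integrable d0 Sg.
have t1 : tame (fun x : E => 1 + enorm x) by exists 1%N, 1 => x; rewrite mul1r expr1 ger0_norm// addr_ge0 ?enorm_ge0.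
have mt1 : measurable_fun setT (fun x : E => 1 + enorm x) by apply: measurable_funD => //; exact: measurable_enorm.
have ib := tame_schwartz_integrable d0 mt1 t1 Sg.
have ip y : lam.-integrable setT (EFin \o (fun x => psi s (x - y) * gauss 1 x)).
  apply: tame_schwartz_integrable => //; last exact/tame_translate/psi_tame.
  exact: (measurableT_comp (measurable_psi s) (measurable_translate y)).
set u := (fun y => _) in iu.
pose G := \int[lam]_x (gauss 1 x : R); pose B := \int[lam]_x ((1 + enorm x) * gauss 1 x : R).
have uB y : enorm y * G - B <= u y.
  rewrite /G /B -RintegralZl// -RintegralB//; last exact: integrable_scale.
  apply: le_Rintegral => //; first by apply: integrable_sub => //; exact: integrable_scale.
  move=> x _; rewrite -mulrBl ler_wpM2r ?(ltW (gauss_gt0 _ _))//.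
  have h : enorm y <= enorm (x - y) + enorm x.
    by rewrite -(enormN (x - y)) opprB -{1}(subrK x y) ler_enormD.
  (* When [|x - y| < 1] the lower bound is negative; otherwise [|x - y|^(1 + s) >= |x - y|]. *)
  have [z1|z1] := leP 1 (enorm (x - y)); last first.
    apply: (@le_trans _ _ 0); first lra.
    exact: powR_ge0.
  have : enorm (x - y) `^ 1 <= psi s (x - y) by apply: ler_powR => //; rewrite lerDl.
  by rewrite powRr1 ?enorm_ge0//; lra.
have G0 : 0 < G.
  have [kappa k0 kE] := ft_gauss R d0.
  have := kE 0; rewrite /ft gauss0 mulr1 => e; move: k0; rewrite -e; congr (0 < _).
  by apply: eq_Rintegral => x _; rewrite dot0r cos0 mulr1.
have B0 : 0 <= B.
  by apply: Rintegral_ge0 => x _; rewrite mulr_ge0 ?addr_ge0 ?enorm_ge0 ?(ltW (gauss_gt0 _ _)).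
have iw : mu.-integrable setT (EFin \o (fun y => (1 + B / G) * 1 + G^-1 * u y)).
  apply: integrable_add; last exact: integrable_scale.
  exact: integrable_scale m1.
apply: integrable_le iw _; first exact: mt1.
move=> y; rewrite ger0_norm ?addr_ge0 ?enorm_ge0// mulr1 -addrA lerD2l.
by rewrite -(ler_pM2r G0) mulrDl divfK ?gt_eqF// mulrAC mulVf ?gt_eqF// mul1r; have := uB y; lra.
Qed.

Let iK i f : smooth f -> rapid f ->
  measurable_fun setT (fun z : E * E => K s (z.1 - z.2) ord0 i * f z.1).
Proof.
move=> sf rf; apply: measurable_funM.
  exact: (measurableT_comp (measurable_K s i) (@measurable_sub2 R d)).
exact: (measurable_comp_fst (smooth_measurable sf)).
Qed.

Let wi f : measurable_fun setT f -> rapid f ->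
  slam.-integrable setT (EFin \o (fun x => (2 * (1 + enorm x)) * `|f x|)).
Proof.
move=> mf rf.
have t1 : tame (fun x : E => 2 * (1 + enorm x)) by exists 1%N, 2 => x; rewrite expr1 ger0_norm// mulr_ge0// addr_ge0 ?enorm_ge0.
have mt1 : measurable_fun setT (fun x : E => 2 * (1 + enorm x)).
  by apply: measurable_funM => //; apply: measurable_funD => //; exact: measurable_enorm.
apply: (tame_rapid_integrable d0 mt1 _ t1); first exact: measurableT_comp.
by move=> k; have [C fC] := rf k; exists C => x; rewrite normr_id.
Qed.

(** The product majorant for Fubini: the first moment of [mu] integrates the last factor. *)
Let Kfb i f x y : `|K s (x - y) ord0 i * f x| <= (2 * (1 + enorm x)) * `|f x| * (1 + enorm y).
Proof.
rewrite normrM mulrAC ler_wpM2r//; apply: le_trans (K_bound _ _ s0 s1) _.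
by rewrite -mulrA ler_wpM2l// ler_enorm1B.
Qed.

Lemma integrable_K x i : mu.-integrable setT (EFin \o (fun y => K s (x - y) ord0 i)).
Proof.
apply: (integrable_le _ (integrable_scale (2 * (1 + enorm x)) psi_conv_moment)).
  have mB : measurable_fun [set: E] (fun y : E => x - y).
    by have := @measurable_affine R d (-1) x; under eq_fun do rewrite scaleN1r addrC.
  exact: (measurableT_comp (measurable_K s i) mB).
move=> y; apply: le_trans (K_bound _ _ s0 s1) _.
by rewrite -mulrA ler_wpM2l// ler_enorm1B.
Qed.

Lemma K_convE x i : K_conv s mu x ord0 i = \int[mu]_y K s (x - y) ord0 i.
Proof. by rewrite mxE. Qed.

Let K_conv_integrable i f : smooth f -> rapid f ->
  lam.-integrable setT (EFin \o (fun x => K_conv s mu x ord0 i * f x)).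
Proof.
move=> sf rf; have mf := smooth_measurable sf.
have := @integrable_Rintegral1 R _ _ _ _ slam mu _ _ _ (iK i sf rf) (wi mf rf) psi_conv_moment (@Kfb i f).
congr (lam.-integrable _ _); apply/funext => x /=; congr EFin.
by rewrite K_convE -[in RHS](@RintegralZr _ _ _ mu)//; exact: integrable_K.
Qed.

(** Fubini gives the measurability of the product with a rapidly decreasing function; a Gaussian is
    used because it can be divided out. *)
Lemma measurable_K_conv i : measurable_fun setT (fun x => K_conv s mu x ord0 i).
Proof.
have Sg := @gauss_schwartz R d 1 ltr01.
have := integrable_measurable (K_conv_integrable i Sg.1 (schwartz_rapid Sg)).
have mg : measurable_fun setT (fun x : E => expR (1 * dot x x)).
  apply: measurableT_comp => //; have := OM_sqr R d => -[sq _].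
  by apply: smooth_measurable; under eq_fun do rewrite mul1r.
move=> /(measurable_funM)/(_ mg); congr (measurable_fun _ _); apply/funext => x /=.
by rewrite -mulrA -expRD addNr expR0 mulr1.
Qed.

(** Integration by parts under the integral in [y], then Fubini. *)
Lemma psi_conv_gradient : gradient_rep T (K_conv s mu).
Proof.
move=> i; split; first exact: measurable_K_conv.
move=> f tf; have [sf cf _] := tf; have Sf := test_schwartz tf.
have rf := schwartz_rapid Sf; split; first exact: K_conv_integrable.
have [_ /(_ _ (schwartz_partial i Sf))[iu ->]] := muT.
have e y := psi_by_parts d0 i y s0 s1 sf (compact_supp_far_zero cf).
rewrite -mulN1r -RintegralZl//.
transitivity (\int[mu]_y \int[slam]_x (K s (x - y) ord0 i * f x)).
  by apply: eq_Rintegral => y _; rewrite e mulN1r opprK.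
have mf := smooth_measurable sf.
rewrite -(@Rfubini_bound R _ _ _ _ slam mu _ _ _ (iK i sf rf) (wi mf rf) psi_conv_moment (@Kfb i f)).
apply: eq_Rintegral => x _; rewrite K_convE.
exact: (RintegralZr (f x) measurableT (integrable_K x i)).
Qed.

Lemma K_conv_bound : exists2 C, 0 <= C & forall x i, `|K_conv s mu x ord0 i| <= C * (1 + enorm x).
Proof.
exists (2 * \int[mu]_y (1 + enorm y)).
  by rewrite mulr_ge0// Rintegral_ge0// => y _; rewrite addr_ge0 ?enorm_ge0.
move=> x i; rewrite K_convE; apply: le_trans (le_normr_Rintegral measurableT (integrable_K x i)) _.
rewrite mulrAC -(RintegralZl _ measurableT psi_conv_moment).
apply: le_Rintegral => //; first exact/integrable_abs/integrable_K.
  by apply: integrable_scale; exact: psi_conv_moment.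
move=> y _; apply: le_trans (K_bound _ _ s0 s1) _.
by rewrite -mulrA ler_wpM2l// ler_enorm1B.
Qed.

(* At [y = x] the kernel is discontinuous; there the symmetrized increments
   vanish because [K s] is odd. *)
Lemma K_conv_symmetric_limit x (z : E) i (rho : nat -> R) : rho @ \oo --> (0 : R) ->
  (forall n, `|rho n| <= 1) ->
  (fun n => K_conv s mu (x + rho n *: z) ord0 i + K_conv s mu (x - rho n *: z) ord0 i) @ \oo -->
    2 * K_conv s mu x ord0 i.
Proof.
move=> r0 r1.
have e n : K_conv s mu (x + rho n *: z) ord0 i + K_conv s mu (x - rho n *: z) ord0 i =
    \int[mu]_y (K s (x + rho n *: z - y) ord0 i + K s (x - rho n *: z - y) ord0 i).
  by rewrite !K_convE -RintegralD//; exact: integrable_K.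
under eq_fun do rewrite e.
rewrite K_convE -RintegralZl//; last exact: integrable_K.
have mK w : measurable_fun [set: E] (fun y => K s (w - y) ord0 i).
  exact: integrable_measurable (integrable_K w i).
refine (@Rintegral_dct _ _ _ mu _ _ (fun y => (4 * (1 + enorm x + enorm z)) * (1 + enorm y)) _ _ _ _ _).2.
- by move=> n; apply: measurable_funD.
- exact: measurable_funM.
- apply/aeW => y; have [->|xy] := eqVneq y x.
    rewrite subrr.
    have h n : K s (x + rho n *: z - x) ord0 i + K s (x - rho n *: z - x) ord0 i = 0.
      have q (w : E) : x + w - x = w by rewrite addrAC subrr add0r.
      by rewrite !q K_odd subrr.
    under eq_fun do rewrite h.
    by rewrite K_coord mxE !mulr0; exact: cvg_cst.
  have xy0 : x - y != 0 by rewrite subr_eq0 eq_sym.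
  rewrite mulr_natl mulr2n.
  have c (w : nat -> E) : w @ \oo --> (0 : E) -> (fun n => K s (x + w n - y) ord0 i) @ \oo --> K s (x - y) ord0 i.
    move=> w0; apply: (@cvg_comp _ _ _ (fun n => x + w n - y) (fun y => K s y ord0 i) _ (nbhs (x - y))); last exact: K_continuous.
    have h : (fun n => x + w n - y) @ \oo --> x + 0 - y.
      by apply: cvgB; [apply: cvgD => //; exact: cvg_cst|exact: cvg_cst].
    by rewrite addr0 in h.
  apply: cvgD; first by apply: c; exact: scale_cvg0.
  by apply: c; rewrite -oppr0; apply: cvgN; exact: scale_cvg0.
- by apply: integrable_scale; exact: psi_conv_moment.
- move=> n y.
  have h (w : E) : enorm w <= enorm z -> `|K s (x + w - y) ord0 i| <= 2 * (1 + enorm x + enorm z) * (1 + enorm y).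
    move=> wz; apply: le_trans (K_bound _ _ s0 s1) _.
    apply: le_trans (ler_wpM2l _ (ler_enorm1B _ _)) _ => //.
    rewrite mulrA ler_wpM2r ?addr_ge0 ?enorm_ge0// ler_wpM2l// -addrA lerD2l.
    by apply: le_trans (ler_enormD _ _) _; rewrite lerD2l.
  have hz : enorm (rho n *: z) <= enorm z by rewrite enormZ ler_piMl ?enorm_ge0.
  apply: le_trans (ler_normD _ _) _.
  have := h _ hz; have := h (- (rho n *: z)); rewrite enormN => /(_ hz).
  by lra.
Qed.

Lemma K_conv_ball_integrable x i (rho : R) : 0 <= rho -> rho <= 1 ->
  lam.-integrable setT (EFin \o (fun z : E => K_conv s mu (rho *: z + x) ord0 i * ball_indic z)).
Proof.
move=> rho0 rho1; have [C C0 HC] := K_conv_bound.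
apply: (integrable_le _ (integrable_scale (C * (2 + enorm x)) (ball_indic_integrable R d0))).
  apply: measurable_funM; last exact: measurable_ball_indic.
  exact: (measurableT_comp (measurable_K_conv i) (measurable_affine _ _)).
move=> z; rewrite normrM (ger0_norm (ball_indic_ge0 z)) /ball_indic.
case: ltP => z1; last by rewrite !mulr0.
rewrite !mulr1; apply: le_trans (HC _ _) _; rewrite ler_wpM2l//.
have : enorm (rho *: z + x) <= 1 + enorm x.
  apply: le_trans (ler_enormD _ _) _; rewrite lerD2r enormZ ger0_norm//.
  by apply: le_trans (ler_piMl (enorm_ge0 z) rho1) _; exact: ltW.
lra.
Qed.

(** After symmetrization the integrand converges for each fixed [z], and the linear growth of
    [K_conv] dominates it on the unit ball. *)
Lemma K_conv_ball_limit x i :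
  (fun n => (\int[lam]_z ball_indic z)^-1 *
     \int[lam]_z (K_conv s mu (n.+1%:R^-1 *: z + x) ord0 i * ball_indic z)) @ \oo -->
  K_conv s mu x ord0 i.
Proof.
pose b := \int[lam]_z (ball_indic z : R); have b0 : 0 < b by exact: ball_indic_gt0.
have alg t : b^-1 * t = (2 * b)^-1 * (2 * t) by field; rewrite gt_eqF.
pose rho (n : nat) : R := n.+1%:R^-1.
have rho0 n : 0 <= rho n by rewrite invr_ge0.
have rho1 n : rho n <= 1 by rewrite invf_le1// ler1n.
have rc : rho @ \oo --> (0 : R) by exact: cvg_harmonic.
pose k (z : E) : R := K_conv s mu z ord0 i.
have sym n := @ball_symmetrize _ _ k x (rho n) (K_conv_ball_integrable x i (rho0 n) (rho1 n)).
have e n : b^-1 * \int[lam]_z (k (rho n *: z + x) * ball_indic z) =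
    (2 * b)^-1 * \int[lam]_z ((k (rho n *: z + x) + k (x - rho n *: z)) * ball_indic z).
  by rewrite (sym n).2 alg.
rewrite -/b; under eq_fun do rewrite e.
have -> : K_conv s mu x ord0 i = (2 * b)^-1 * \int[lam]_z (2 * k x * ball_indic z).
  rewrite RintegralZl//; last exact: ball_indic_integrable.
  by rewrite -/b /k; field; rewrite gt_eqF.
apply: cvgMr.
have [C C0 HC] := K_conv_bound.
refine (@Rintegral_dct _ _ _ lam _ _ (fun z => 2 * (C * (2 + enorm x)) * ball_indic z) _ _ _ _ _).2.
- by move=> n; exact: integrable_measurable (sym n).1.
- by apply: measurable_funM => //; exact: measurable_ball_indic.
- apply/aeW => z; apply: cvgMl; under eq_fun do rewrite (addrC _ x).
  by apply: K_conv_symmetric_limit => // n; rewrite ger0_norm.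
- by apply: integrable_scale; exact: ball_indic_integrable.
- move=> n z; rewrite normrM (ger0_norm (ball_indic_ge0 z)) /ball_indic.
  case: ltP => z1; last by rewrite !mulr0.
  rewrite !mulr1; apply: le_trans (ler_normD _ _) _; rewrite mulr_natl mulr2n.
  have h (w : E) : enorm w <= 1 -> `|k (x + w)| <= C * (2 + enorm x).
    move=> w1; apply: le_trans (HC _ _) _; rewrite ler_wpM2l//.
    by have := ler_enormD x w; lra.
  have hz : enorm (rho n *: z) <= 1.
    rewrite enormZ ger0_norm//; apply: le_trans (ler_piMl (enorm_ge0 z) (rho1 n)) _; exact: ltW.
  by rewrite addrC (addrC _ x); apply: lerD; apply: h; rewrite ?enormN.
Qed.

End potentials.

Lemma ae_zero_integral (R : realType) d (T : measurableType d) (mu : {measure set T -> \bar R})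
    (f : T -> R) : measurable_fun setT f -> {ae mu, forall x, f x = 0} ->
  mu.-integrable setT (EFin \o f) /\ \int[mu]_x f x = 0.
Proof.
move=> mf f0; have mf' : measurable_fun setT (EFin \o f) by exact/measurable_EFinP.
have e0 : ae_eq mu setT (EFin \o f) (cst 0%E) by apply: filterS f0 => x h _ /=; rewrite h.
have e1 : (\int[mu]_x `|(EFin \o f) x| = 0)%E by apply/ae_eq_integral_abs.
have e2 : (\int[mu]_x (EFin \o f) x = 0)%E.
  by rewrite (@ae_eq_integral _ _ _ mu setT (cst 0%E)) ?integral0.
by split; [apply/integrableP; split => //; rewrite e1|rewrite /Rintegral e2].
Qed.

(** * The normalized gradient and the flux *)

Section stationarity.
Context (R : realType) (d : nat).
Local Notation E := 'rV[R]_d.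
Local Notation lam := (lebesgue R d).
Implicit Types (f g : E -> R) (x y : E).
Hypothesis d0 : (0 < d)%N.
Variables (a r : R) (omega phi : {finite_measure set E -> \bar R}).
Variables (Psi F : dist R d) (g : E -> E).
Hypotheses (a0 : 0 <= a) (a1 : a < 1) (r0 : 0 <= r) (r1 : r < 1).
Hypotheses (oPsi : psi_conv a omega Psi) (gF : gradient_rep F g).
Hypotheses (gm : {ae phi, forall x, mean_value_at g x}) (phiF : gauge r Psi phi F).

Let flux x := K_conv a omega x - K_conv r phi x.

Let flux_coord x i : flux x ord0 i = K_conv a omega x ord0 i - K_conv r phi x ord0 i.
Proof. by rewrite !mxE. Qed.

Let measurable_flux i : measurable_fun setT (fun x => flux x ord0 i).
Proof.
have [T phiT _] := phiF; under eq_fun do rewrite flux_coord.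
apply: measurable_funB; first exact: (measurable_K_conv d0 a0 a1 oPsi).
exact: (measurable_K_conv d0 r0 r1 phiT).
Qed.

(** Both sides represent the gradient of [F], by the gauge condition; the du Bois-Reymond lemma for
    Lebesgue measure separates them only on a null set. *)
Lemma gradient_flux i : {ae lam, forall x, g x ord0 i = flux x ord0 i}.
Proof.
have [T phiT FE] := phiF.
have [mg gi] := gF i.
suff : {ae lam, forall x, g x ord0 i - flux x ord0 i = 0}.
  by apply: filterS => x /eqP; rewrite subr_eq0 => /eqP.
apply: test_eq0; first exact: measurable_funB.
move=> f tf; have [ig Eg] := gi f tf; have Sf := schwartz_partial i (test_schwartz tf).
have [_ /(_ f tf)[ia Ea]] := psi_conv_gradient d0 a0 a1 oPsi i.
have [_ /(_ f tf)[ir Er]] := psi_conv_gradient d0 r0 r1 phiT i.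
have e : (fun x => f x * (g x ord0 i - flux x ord0 i)) =
    fun x => g x ord0 i * f x - (K_conv a omega x ord0 i * f x - K_conv r phi x ord0 i * f x).
  by apply/funext => x; rewrite flux_coord; ring.
rewrite e; have iar := integrable_sub ia ir; split; first exact: integrable_sub.
rewrite RintegralB// [X in _ - X](RintegralB measurableT ia ir) -Eg -Ea -Er FE// /dist_sub.
by ring.
Qed.

(** [phi] may charge Lebesgue-null sets, so the equality passes through ball averages: those of [g]
    and of the flux coincide, the former tend to [g] at [phi]-almost every point and the latter to
    the flux everywhere. *)
Lemma gradient_flux_phi : {ae phi, forall x, forall i, g x ord0 i = flux x ord0 i}.
Proof.
have [T phiT _] := phiF.
apply: filterS gm => x gx i.
have [mg _] := gF i.
pose rho (n : nat) : R := n.+1%:R^-1.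
have rho0 n : 0 < rho n by rewrite invr_gt0.
have rho1 n : rho n <= 1 by rewrite invf_le1// ler1n.
have rc : rho @ \oo --> (0 : R) by exact: cvg_harmonic.
have c1 := (cvg_at_rightP _ _ _).1 (gx i) rho (conj rho0 rc).
have c2 := @cvgB _ _ _ _ _ _ _ _ _ (@K_conv_ball_limit _ _ d0 _ _ _ a0 a1 oPsi x i) (@K_conv_ball_limit _ _ d0 _ _ _ r0 r1 phiT x i).
suff e n : (fine (lam [set y | enorm (y - x) < rho n]))^-1 *
      \int[lam]_(y in [set y | enorm (y - x) < rho n]) g y ord0 i =
    (\int[lam]_z ball_indic z)^-1 * \int[lam]_z (K_conv a omega (n.+1%:R^-1 *: z + x) ord0 i * ball_indic z) -
    (\int[lam]_z ball_indic z)^-1 * \int[lam]_z (K_conv r phi (n.+1%:R^-1 *: z + x) ord0 i * ball_indic z).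
  move: c1; under eq_fun do rewrite e.
  by move=> c1; rewrite flux_coord; apply: (cvg_unique (@norm_hausdorff _ R^o) c1); exact: c2.
rewrite -mulrBr -RintegralB//; last 2 first.
- exact: (@K_conv_ball_integrable _ _ d0 _ _ _ a0 a1 oPsi x i (rho n) (ltW (rho0 n)) (rho1 n)).
- exact: (@K_conv_ball_integrable _ _ d0 _ _ _ r0 r1 phiT x i (rho n) (ltW (rho0 n)) (rho1 n)).
rewrite (_ : \int[lam]_(y in _) g y ord0 i = \int[lam]_(y in [set y | enorm (y - x) < rho n]) flux y ord0 i).
  rewrite ball_average//; congr (_ * _); apply: eq_Rintegral => z _.
  by rewrite flux_coord mulrBl.
(* An average over a ball only sees the integrand up to Lebesgue-null sets. *)
rewrite /Rintegral; congr fine; apply: ae_eq_integral.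
- rewrite -[X in measurable X]setTI.
  have := measurableT_comp (@measurable_enorm R d) (measurable_translate x).
  by move=> /(_ measurableT _ (measurable_itv `]-oo, rho n[)); rewrite set_itvE.
- by apply/measurable_funTS/measurable_EFinP.
- by apply/measurable_funTS/measurable_EFinP; exact: measurable_flux.
- by apply: filterS (gradient_flux i) => y h _; rewrite h.
Qed.

(** As [D] vanishes on [Omega], so does [phi]; a condition on the complement thus holds [phi]-almost
    everywhere, where [g] is the flux. *)
Lemma free_boundary_zero_flux (Omega : set E) (D : dist R d) : open Omega ->
  (forall f, test_on Omega f -> D f = 0) ->
  free_boundary Omega D g phi <-> dist_eq D (dist_measure phi) /\ zero_flux a r omega phi.
Proof.
move=> oO D0; have [T phiT _] := phiF.
split=> [[g0 DE pO p1]|[DE [p1 _ fl0]]].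
- split=> //; split=> //.
    apply/aeW => x i; split; first exact: (integrable_K d0 a0 a1 oPsi).
    exact: (integrable_K d0 r0 r1 phiT).
  have f0 : {ae phi, forall x, forall i, flux x ord0 i = 0}.
    have nO : {ae phi, forall x, ~ Omega x}.
      exists Omega; split => //; first exact: open_measurable_rV.
      by move=> x /=; exact: contrapT.
    apply: filterS3 g0 nO gradient_flux_phi => x h1 h2 h3 i.
    by rewrite -h3 h1// mxE.
  move=> f i [sf _ _].
  apply: ae_zero_integral.
    apply: measurable_funM; first exact: smooth_measurable.
    exact: measurable_flux.
  by apply: filterS f0 => x h; rewrite [X in _ * X]h mulr0.
- have pO : phi Omega = 0%E.
    apply: test_measure_eq0 => //; first exact: fin_num_measure.
    by move=> f tf; rewrite -[LHS]/(dist_measure phi f) -DE ?D0//; exact: test_schwartz tf.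
  split=> //.
  have f0 i : {ae phi, forall x, flux x ord0 i = 0}.
    by apply: test_eq0 => // f tf; exact: fl0.
  have f0' : {ae phi, forall x, forall i, flux x ord0 i = 0}.
    by apply: filter_forall => i; exact: f0.
  apply: filterS2 f0' gradient_flux_phi => x h1 h2 _.
  by apply/rowP => i; rewrite h2 h1 mxE.
Qed.

End stationarity.

(** * Powers of the Laplacian *)

Section fractional_laplacian.
Context (R : realType) (d : nat).
Local Notation E := 'rV[R]_d.
Implicit Types (f g h theta : E -> R) (x xi : E) (T U V H : dist R d).
Hypothesis d0 : (0 < d)%N.

Lemma enorm_powRD x (b c : R) : b + c != 0 -> enorm x `^ (b + c) = enorm x `^ b * enorm x `^ c.
Proof. by move=> bc; rewrite powRD ?(negbTE bc). Qed.

Lemma enorm_powR_even (n : nat) x : enorm x `^ (2 * n%:R) = dot x x ^+ n.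
Proof. by rewrite -natrM powR_mulrn ?enorm_ge0// exprM sqr_enorm. Qed.

Lemma OM_even_powR (n : nat) : OM (fun x : E => enorm x `^ (2 * n%:R)).
Proof.
rewrite (_ : (fun x => _) = fun x => dot x x ^+ n); last first.
  by apply/funext => x; rewrite enorm_powR_even.
exact/OM_exp/OM_sqr.
Qed.

Lemma cutoff_complement_OM theta (eps : R) : cutoff theta -> 0 < eps ->
  OM (fun xi => 1 - theta (eps^-1 *: xi)) /\
  \forall xi \near (0 : E), 1 - theta (eps^-1 *: xi) = 0.
Proof.
move=> [st ct t1] e0; have ei : 0 < eps^-1 by rewrite invr_gt0.
split.
  have [M tM] := compact_supp_far_zero ct.
  apply: OMD; first exact: OM_cst.
  apply: schwartz_OM; apply: schwartzN; apply: far_zero_schwartz.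
    have := smooth_affine (eps^-1) 0 st.
    by congr smooth; apply/funext => xi; rewrite addr0.
  exists (eps * M) => xi xM; apply: tM; rewrite enormZ ger0_norm ?(ltW ei)//.
  by rewrite -(ltr_pM2l e0) mulrA divff ?mul1r ?gt_eqF.
have c : continuous (fun xi : E => eps^-1 *: xi).
  exact: scaler_continuous.
have : \forall y \near (eps^-1 *: (0 : E)), theta y = 1 by rewrite scaler0.
move=> H; have {}H : \forall xi \near (0 : E), theta (eps^-1 *: xi) = 1 := c 0 _ H.
by apply: filterS H => xi ->; rewrite subrr.
Qed.

Lemma schwartz_cutoff_powR theta (eps b : R) f : cutoff theta -> 0 < eps -> schwartz f ->
  schwartz (fun xi => (1 - theta (eps^-1 *: xi)) * enorm xi `^ b * f xi).
Proof.
move=> ct e0 Sf; have [Ot t0] := cutoff_complement_OM ct e0.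
exact: (schwartz_mul (vanish_powR_OM b Ot t0) Sf).
Qed.

(** The limit defining [frac_lap] is required for every cutoff; uniqueness needs one to exist. *)
Lemma cutoff_inhabited : exists theta : E -> R, cutoff theta.
Proof.
have [theta [st ft t1 _]] := @cutoff_exists R d 1 ltr01.
exists theta; split => //; first exact: far_zero_compact_supp.
have := @open_enorm_lt R d 1; rewrite openE => /(_ 0).
rewrite /= enorm0 => /(_ ltr01); apply: filterS => x /= x1; exact/t1/ltW.
Qed.

(** [dist_eq] compares values on Schwartz functions only, so each test function in the definition
    has to be shown Schwartz; with cutoffs this holds for positive [eps]. *)
Lemma frac_lap_dist_eq (alpha : R) T T' U : dist_eq T T' -> frac_lap alpha T U ->
  frac_lap alpha T' U.
Proof.
move=> TT [tU H]; split => // f Sf; have [H1 H2] := H f Sf; split.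
  move=> an; rewrite (H1 an); apply: fourier_dist_eq => //.
  by have [n ->] := an; apply: schwartz_mul => //; exact: OM_even_powR.
move=> an theta ct; have [c1 c2] := H2 an theta ct.
have e : \forall eps \near 0^'+,
    fourier_dist T (fun xi => (1 - theta (eps^-1 *: xi)) * enorm xi `^ (2 * alpha) * f xi) =
    fourier_dist T' (fun xi => (1 - theta (eps^-1 *: xi)) * enorm xi `^ (2 * alpha) * f xi).
  by near=> eps; apply: fourier_dist_eq => //; exact: schwartz_cutoff_powR.
by split; [apply: cvg_trans c1|apply: cvg_trans c2]; apply: near_eq_cvg;
  apply: filterS e => eps ->.
Unshelve. all: by end_near. Qed.

Lemma frac_lap_unique (alpha : R) T U V : frac_lap alpha T U -> frac_lap alpha T V ->
  dist_eq U V.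
Proof.
move=> [tU HU] [tV HV]; apply: fourier_dist_inj => // f Sf.
have [U1 U2] := HU f Sf; have [V1 V2] := HV f Sf.
have [an|an] := pselect (exists n : nat, alpha = n%:R); first by rewrite U1// V1.
have [theta ct] := cutoff_inhabited.
have [u1 u2] := U2 an _ ct; have [v1 v2] := V2 an _ ct.
have e1 := cvg_unique (@norm_hausdorff _ R^o) u1 v1.
have e2 := cvg_unique (@norm_hausdorff _ R^o) u2 v2.
by move: e1 e2; rewrite !fourier_distE /= => -> ->.
Qed.

(** [frac_lap] branches on whether its order is natural. On [(0, 1]] this occurs at 1 alone, so the
    orders [s] and [p + s] always take the same branch. *)
Lemma natural_frac_part (s : R) : 0 < s -> s <= 1 -> (exists n : nat, s = n%:R) -> s = 1.
Proof.
move=> s0 s1 [n sn]; move: s0 s1; rewrite sn ltr0n -[leRHS](mulr1n 1) ler_nat => n0 n1.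
by have -> : n = 1%N by apply/eqP; rewrite eqn_leq n1.
Qed.

Lemma natural_sum (p : nat) (s : R) : 0 < s -> s <= 1 ->
  (exists n : nat, p%:R + s = n%:R) -> s = 1.
Proof.
move=> s0 s1 [n sn]; apply: natural_frac_part => //; exists (n - p)%N.
have pn : (p <= n)%N by rewrite -(ler_nat R) -sn lerDl ltW.
by rewrite natrB// -sn addrAC subrr add0r.
Qed.

Lemma frac_lap_split (p : nat) (s : R) T H V : 0 < s -> s <= 1 ->
  frac_lap p%:R T H -> frac_lap (p%:R + s) T V -> frac_lap s H V.
Proof.
move=> s0 s1 [tH HH] [tV HV]; split => // f Sf.
(* At base 0 the law of exponents requires a nonzero sum. *)
have ps : 2 * p%:R + 2 * s != 0.
  by rewrite gt_eqF// ltr_wpDl ?mulr_ge0 ?mulr_gt0.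
have HHE g : schwartz g -> fourier_dist H g = fourier_dist T (fun xi => enorm xi `^ (2 * p%:R) * g xi).
  by move=> Sg; have [-> //] := HH g Sg; exists p.
have [V1 V2] := HV f Sf; split=> [sn|sn theta ct].
  have s1' := natural_frac_part s0 s1 sn.
  rewrite V1; last by exists p.+1; rewrite s1' natr1.
  rewrite HHE; last first.
    by rewrite s1'; apply: schwartz_mul => //; exact: (OM_even_powR 1).
  congr fourier_dist; apply/funext => xi.
  by rewrite mulrDr enorm_powRD// mulrA.
have nn : ~ exists n : nat, p%:R + s = n%:R.
  by move=> /(natural_sum s0 s1) s1'; apply: sn; exists 1%N.
have [c1 c2] := V2 nn theta ct.
have e : \forall eps \near 0^'+,
    fourier_dist T (fun xi => (1 - theta (eps^-1 *: xi)) * enorm xi `^ (2 * (p%:R + s)) * f xi) =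
    fourier_dist H (fun xi => (1 - theta (eps^-1 *: xi)) * enorm xi `^ (2 * s) * f xi).
  near=> eps; rewrite HHE; last exact: schwartz_cutoff_powR.
  congr fourier_dist; apply/funext => xi.
  by rewrite mulrDr enorm_powRD//; ring.
by split; [apply: cvg_trans c1|apply: cvg_trans c2]; apply: near_eq_cvg;
  apply: filterS e => eps ->.
Unshelve. all: by end_near. Qed.

End fractional_laplacian.

(** * The Dirichlet problem and its Green representation *)

Section dirichlet_problem.
Context (R : realType) (d : nat).
Local Notation E := 'rV[R]_d.
Hypothesis d0 : (0 < d)%N.
Variables (gamma : R -> R) (r a : R) (omega : {finite_measure set E -> \bar R}).
Variables (Psi Q : dist R d) (Omega : set E) (p : nat) (s : R).
Hypotheses (gammaP : forall sigma : R, 0 <= sigma -> sigma < 1 -> gamma_const d sigma (gamma sigma)).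
Hypotheses (r0 : 0 <= r) (ra : r <= a) (a1 : a < 1).
Hypotheses (oPsi : psi_conv a omega Psi) (oO : open Omega).
Hypotheses (s0 : 0 < s) (s1 : s <= 1) (ps : (d%:R + 1 + r) / 2 = p%:R + s).

Let c := (gamma r)^-1.

Let r1 : r < 1. Proof. exact: le_lt_trans a1. Qed.

Let c0 : c != 0. Proof. by have [g0 _] := gammaP r0 r1; rewrite invr_eq0. Qed.

(** Everything rests on the distribution [V0] that the ansatz provides as [(-Delta)^(p + s) F]. It
    is also [(-Delta)^s H], and [LF] is [c] times it; uniqueness transfers its properties to every
    other [V]. *)
Lemma dirichlet_ansatz (F LF H : dist R d) (g : E -> E)
    (mu nu : {finite_measure set E -> \bar R}) :
    ansatz r c Q F LF g mu nu -> frac_lap p%:R F H ->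
    [/\ exists V, frac_lap s H V,
        forall V, frac_lap s H V ->
          (eq_on Omega LF Q <-> eq_on Omega V (dist_scale c^-1 Q))
      & forall h : E -> R,
          eq_on Omega LF Q ->
          represents h H -> (forall x, ~ Omega x -> h x = 0) ->
          [/\ dirichlet Omega s (dist_scale c^-1 Q) h,
              forall (cls : set (E -> R))
                  (G : E -> E -> R) (k : E -> R),
                represents_on Omega k (dist_scale c^-1 Q) ->
                green_kernel Omega s G ->
                well_posed Omega s (dist_scale c^-1 Q) cls ->
                green_valid Omega s (dist_scale c^-1 Q) cls G k ->
                cls h ->
                forall x, Omega x ->
                  h x = \int[lebesgue R d]_(y in Omega) (G x y * k y),
              exists U V, [/\ tempered U,
                represents (patch (fun=> 0) Omega h) U & frac_lap s U V],
              forall U V, tempered U ->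
                represents (patch (fun=> 0) Omega h) U -> frac_lap s U V ->
                dist_eq (dist_sub Q LF) (dist_sub Q (dist_scale c V))
            & forall phi : {finite_measure set E -> \bar R},
                admissible r phi mzero F g ->
                gauge r Psi phi F ->
                (free_boundary Omega (dist_sub Q LF) g phi <->
                 dist_eq (dist_sub Q LF) (dist_measure phi) /\
                 zero_flux a r omega phi)]].
Proof.
move=> [[V0 FV0 LFE] _ _] FH; rewrite ps in FV0.
have HV0 := frac_lap_split s0 s1 FH FV0.
have cQ V : frac_lap s H V -> eq_on Omega LF Q <-> eq_on Omega V (dist_scale c^-1 Q).
  move=> HV; have VV := frac_lap_unique d0 HV HV0.
  split=> e f tf; have Sf := test_schwartz tf; have := e f tf.
    by rewrite LFE// /dist_scale VV// => <-; rewrite mulKf.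
  by rewrite LFE// /dist_scale VV// => ->; rewrite mulVKf.
split=> //; first by exists V0.
move=> h LQ hH h0.
(* Under the exterior condition [h] is its own zero extension. *)
have ph : patch (fun=> 0) Omega h = h.
  apply/funext => x; rewrite /patch; case: ifPn => //; rewrite notin_setE => /h0 ->.
  by [].
have dh : dirichlet Omega s (dist_scale c^-1 Q) h.
  split => //; exists H, V0; split => //; first by case: FH.
  exact/(cQ V0).
split=> //.
(* [h] and the Green potential both solve the problem in [cls], so well-posedness identifies
   them. *)
- move=> cls G k _ _ [u [_ uu]] [_ cG dG] ch x Ox.
  have -> : h = green_potential Omega G k by rewrite -(uu _ (conj cG dG)) -(uu h (conj ch dh)).
  by rewrite /green_potential /patch mem_set.
- by exists H, V0; rewrite ph; split => //; case: FH.
- move=> U V tU; rewrite ph => hU UV f Sf; rewrite /dist_sub LFE//.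
  congr (_ - _); rewrite /dist_scale; congr (_ * _).
  have UH : dist_eq U H.
    by move=> f' Sf'; have [_ /(_ _ Sf')[_ ->]] := hU; have [_ /(_ _ Sf')[_ ->]] := hH.
  exact: (frac_lap_unique d0 HV0 (frac_lap_dist_eq d0 UH UV)).
- move=> phi [_ _ gF _ [gm _]] phiF.
  have a0 := le_trans r0 ra.
  apply: (free_boundary_zero_flux d0 a0 a1 r0 r1 oPsi gF gm phiF oO).
  by move=> f tf; rewrite /dist_sub LQ// subrr.
Qed.

End dirichlet_problem.

(** * Natural powers of the Laplacian *)

Section laplacian.
Context (R : realType) (d : nat).
Local Notation E := 'rV[R]_d.
Local Notation lam := (lebesgue R d).
Implicit Types (f g q : E -> R) (x xi : E) (T U V H : dist R d) (k : R -> R).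
Hypothesis d0 : (0 < d)%N.

(** The sign makes the symbol [|xi|^2]. *)
Definition lapl f x : R := - \sum_i partial i (partial i f) x.

Lemma schwartz_lapl f : schwartz f -> schwartz (lapl f).
Proof.
by move=> Sf; apply/schwartzN/schwartz_sum => i; do 2 apply: schwartz_partial.
Qed.

Lemma schwartz_iter_lapl n f : schwartz f -> schwartz (iter n lapl f).
Proof. by move=> Sf; elim: n => //= n; exact: schwartz_lapl. Qed.

Lemma OM_lapl q : OM q -> OM (lapl q).
Proof.
move=> Oq; rewrite (_ : lapl q = fun x => -1 * \sum_i partial i (partial i q) x).
  apply: OMM; first exact: OM_cst.
  by apply: OM_sum => i; do 2 apply: OM_partial.
by apply/funext => x; rewrite mulN1r.
Qed.

Lemma ft_sum k (I : Type) (r : seq I) (F : I -> E -> R) xi : wave k -> (forall j, schwartz (F j)) ->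
  ft k (fun x => \sum_(j <- r) F j x) xi = \sum_(j <- r) ft k (F j) xi.
Proof.
move=> wk SF; elim: r => [|j r IH].
  rewrite big_nil /ft; under eq_Rintegral do rewrite big_nil mul0r.
  by rewrite Rintegral_cst ?mul0r.
rewrite big_cons -IH -ft_add//; last exact: schwartz_sum.
by congr ft; apply/funext => x; rewrite big_cons.
Qed.

Lemma lapl_ft f : schwartz f ->
  lapl (ft cos f) = ft cos (fun x => dot x x * f x) /\
  lapl (ft sin f) = ft sin (fun x => dot x x * f x).
Proof.
move=> Sf.
have S1 i : schwartz (fun x => x ord0 i * f x) by exact: schwartz_coord_mul.
have S2 i : schwartz (fun x => x ord0 i * (x ord0 i * f x)) by exact: schwartz_coord_mul.
have e : (fun x => dot x x * f x) = fun x => \sum_i x ord0 i * (x ord0 i * f x).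
  by apply/funext => x; rewrite mulr_suml; apply: eq_bigr => i _; rewrite mulrA.
have pc i g : schwartz g -> partial i (ft cos g) = ft sin (fun x => - (x ord0 i * g x)).
  by move=> Sg; apply/funext => xi; have [_ ->] := ft_cos_grad d0 xi Sg.
have pS i g : schwartz g -> partial i (ft sin g) = ft cos (fun x => x ord0 i * g x).
  by move=> Sg; apply/funext => xi; have [_ ->] := ft_sin_grad d0 xi Sg.
have ftNe k g xi : wave k -> schwartz g -> ft k (fun x => - g x) xi = - ft k g xi.
  move=> wk Sg; rewrite -mulN1r -ft_scale//; congr ft.
  by apply/funext => x; rewrite mulN1r.
rewrite e; split; apply/funext => xi; rewrite ft_sum//; try exact: wave_cos; try exact: wave_sin.
  rewrite /lapl -sumrN; apply: eq_bigr => i _.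
  rewrite pc// pS; last exact: schwartzN.
  rewrite (_ : (fun x => x ord0 i * - _) = fun x => - (x ord0 i * (x ord0 i * f x))).
    by rewrite ftNe ?opprK//; exact: wave_cos.
  by apply/funext => x; rewrite mulrN.
rewrite /lapl -sumrN; apply: eq_bigr => i _.
by rewrite pS// pc// ftNe ?opprK//; exact: wave_sin.
Qed.

Lemma schwartz_dot_exp n f : schwartz f -> schwartz (fun x => dot x x ^+ n * f x).
Proof. by apply: schwartz_mul; exact/OM_exp/OM_sqr. Qed.

Lemma iter_lapl_ft n f : schwartz f ->
  iter n lapl (ft cos f) = ft cos (fun x => dot x x ^+ n * f x) /\
  iter n lapl (ft sin f) = ft sin (fun x => dot x x ^+ n * f x).
Proof.
move=> Sf; elim: n => [|n [IHc IHs]] /=.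
  by split; congr ft; apply/funext => x; rewrite expr0 mul1r.
have [e1 e2] := lapl_ft (schwartz_dot_exp n Sf).
by rewrite IHc IHs e1 e2; split; congr ft; apply/funext => x; rewrite exprS mulrA.
Qed.

Lemma lapl_linear (c : R) f g : schwartz f -> schwartz g ->
  lapl (fun x => c * f x + g x) = fun x => c * lapl f x + lapl g x.
Proof.
move=> Sf Sg; have Scf := schwartz_scale c Sf; apply/funext => x.
rewrite /lapl mulrN -opprD mulr_sumr -big_split /=; congr (- _); apply: eq_bigr => i _.
have := partials_add [:: i; i] Scf.1 Sg.1 => /= ->.
by have := partials_scale [:: i; i] c Sf.1 => /= ->.
Qed.

Lemma laplN f : schwartz f -> lapl (fun x => - f x) = fun x => - lapl f x.
Proof.
move=> Sf; apply/funext => x; rewrite /lapl; congr (- _); rewrite -sumrN; apply: eq_bigr => i _.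
have := partials_scale [:: i; i] (-1) Sf.1 => /= e; rewrite -mulN1r -[RHS]/((fun y => _) x) -e.
by congr (partial i (partial i _) x); apply/funext => y; rewrite mulN1r.
Qed.

Lemma partials_cat s1 s2 f : partials (s1 ++ s2) f = partials s1 (partials s2 f).
Proof. by rewrite /partials foldr_cat. Qed.

Lemma partials_sum s (I : Type) (r : seq I) (F : I -> E -> R) : (forall j, smooth (F j)) ->
  partials s (fun x => \sum_(j <- r) F j x) = fun x => \sum_(j <- r) partials s (F j) x.
Proof.
move=> sF; elim: r => [|j r IH].
  transitivity (partials s (fun=> 0 : R) : E -> R).
    by congr partials; apply/funext => x; rewrite big_nil.
  have := partials_scale s 0 (@smooth_cst R d 0).
  rewrite (_ : (fun x => 0 * 0) = fun=> 0); last by apply/funext => x; rewrite mul0r.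
  by move=> ->; apply/funext => x; rewrite big_nil mul0r.
transitivity (partials s (fun x => F j x + \sum_(j <- r) F j x)).
  by congr partials; apply/funext => x; rewrite big_cons.
rewrite partials_add//; last exact: smooth_sum.
by rewrite IH; apply/funext => x; rewrite big_cons.
Qed.

Lemma tempered_lapl T : tempered T -> tempered (fun f => T (lapl f)).
Proof.
move=> [lT [N [C TC]]]; split=> [c f g Sf Sg|].
  by rewrite lapl_linear// lT//; exact: schwartz_lapl.
(* Two more derivatives, [d] terms, and an absolute value because [C] may be negative. *)
exists (N + 2)%N, (`|C| * d%:R) => f M Sf fM.
have H s x : (size s <= N)%N -> (1 + enorm x) ^+ N * `|partials s (lapl f) x| <= d%:R * M.
  move=> sN; have Sp i : smooth (partial i (partial i f)).
    by have [] := schwartz_partial i (schwartz_partial i Sf).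
  rewrite (_ : lapl f = fun x => -1 * \sum_i partial i (partial i f) x); last first.
    by apply/funext => y; rewrite mulN1r.
  rewrite partials_scale; last exact: smooth_sum.
  rewrite mulN1r normrN partials_sum//.
  apply: (@le_trans _ _ (\sum_(i < d) (1 + enorm x) ^+ N * `|partials s (partial i (partial i f)) x|)).
    by rewrite -mulr_sumr ler_wpM2l ?exprn_ge0 ?addr_ge0 ?enorm_ge0// ler_norm_sum.
  rewrite mulr_natl -[d in M *+ d]card_ord -sumr_const; apply: ler_sum => i _.
  have := fM (s ++ [:: i; i]) x; rewrite size_cat leq_add// => /(_ isT).
  rewrite partials_cat; apply: le_trans.
  by rewrite ler_wpM2r// ler_weXn2l ?enorm1_ge1// leq_addr.
have := TC _ _ (schwartz_lapl Sf) H; move/le_trans; apply.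
rewrite mulrA; have M0 : 0 <= M.
  by apply: le_trans (fM [::] 0 _) => //; rewrite mulr_ge0 ?exprn_ge0 ?addr_ge0 ?enorm_ge0.
by rewrite ler_wpM2r// ler_wpM2r// ler_norm.
Qed.

(** The Laplacian is its own transpose, and [lapl] on the transform side is multiplication by
    [|xi|^2] before the transform. This provides [H] for the two ansatzes compared at the end. *)
Lemma frac_lap_natural n T : tempered T -> frac_lap n%:R T (fun f => T (iter n lapl f)).
Proof.
move=> tT; split.
  suff : tempered (fun f => T (iter n lapl f)) by [].
  elim: n => //= n IH; have := tempered_lapl IH.
  by congr tempered; apply/funext => f; rewrite -iterSr.
move=> f Sf; split; last by move=> []; exists n.
move=> _; rewrite !fourier_distE; have [ec es] := iter_lapl_ft n Sf.
have e : (fun xi => enorm xi `^ (2 * n%:R) * f xi) = fun xi => dot xi xi ^+ n * f xi.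
  by apply/funext => xi; rewrite enorm_powR_even.
have eN : iter n lapl (fun xi => - ft sin f xi) = fun xi => - ft sin (fun xi => dot xi xi ^+ n * f xi) xi.
  rewrite -es; have [_ Ss] := schwartz_ft d0 Sf.
  by elim: n {ec es e} => //= n ->; rewrite laplN//; exact: schwartz_iter_lapl.
by rewrite e ec eN.
Qed.

Definition dist_fun q : dist R d := fun f => \int[lam]_x (q x * f x).

Lemma dist_fun_integrable q f : OM q -> schwartz f ->
  lam.-integrable setT (EFin \o (fun x => q x * f x)).
Proof.
move=> Oq Sf; apply: (tame_schwartz_integrable d0 _ _ Sf); last exact: Oq.2 [::].
exact: smooth_measurable Oq.1.
Qed.

Lemma tempered_dist_fun q : OM q -> tempered (dist_fun q).
Proof.
move=> Oq; split=> [c f g Sf Sg|].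
  rewrite /dist_fun -RintegralZl//; last exact: dist_fun_integrable.
  rewrite -RintegralD//; last 2 first.
  - by apply: integrable_scale; exact: dist_fun_integrable.
  - exact: dist_fun_integrable.
  by apply: eq_Rintegral => x _; rewrite mulrDr mulrCA.
have [N [C [C0 qC]]] := tame_ge0 (Oq.2 [::]).
pose w (x : E) : R := (1 + enorm x) ^- (2 * d).
have w0 x : 0 <= w x by rewrite invr_ge0 exprn_ge0 ?addr_ge0 ?enorm_ge0.
have mw : measurable_fun setT w.
  have -> : w = fun x => (1 + enorm x) `^ (- (2 * d)%:R).
    by apply/funext => x; rewrite powRN powR_mulrn// ltW// enorm1_gt0.
  apply: (measurableT_comp (measurable_powR _)); apply: measurable_funD => //.
  exact: measurable_enorm.
have iw : lam.-integrable setT (EFin \o w).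
  apply: (@integrable_decay _ _ d0 1) => // x.
  by rewrite ger0_norm// mulfV// expf_neq0// gt_eqF// enorm1_gt0.
(* [N] powers absorb the growth of [q], and [2 * d] more pay for the integrable weight [w]. *)
exists (N + 2 * d)%N, (C * \int[lam]_x w x) => f M Sf fM.
apply: le_trans (le_normr_Rintegral measurableT (dist_fun_integrable Oq Sf)) _.
rewrite mulrAC -RintegralZl//.
apply: le_Rintegral => //; first exact/integrable_abs/dist_fun_integrable.
  exact: integrable_scale.
move=> x _; rewrite normrM.
have e0 := enorm1_gt0 x.
apply: (@le_trans _ _ (C * (1 + enorm x) ^+ N * `|f x|)); first by rewrite ler_wpM2r// qC.
rewrite -!mulrA ler_wpM2l// /w ler_pdivlMr ?exprn_gt0//.
have := fM [::] x isT; rewrite exprD /=; apply: le_trans.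
by rewrite mulrAC.
Qed.

Lemma dist_fun_lapl q f : OM q -> schwartz f -> dist_fun q (lapl f) = dist_fun (lapl q) f.
Proof.
move=> Oq Sf.
have by_parts i u v : OM u -> schwartz v ->
    \int[lam]_x (u x * partial i v x) = - \int[lam]_x (partial i u x * v x).
  move=> Ou Sv; have Opu := OM_partial i Ou.
  exact: (integration_by_parts_rV d0 (smooth_measurable Ou.1) (smooth_measurable Opu.1)
    (Ou.2 [::]) (OM_quotient_limit i Ou) Sv).2.
have sum_out (u v : 'I_d -> E -> R) : (forall i, OM (u i)) -> (forall i, schwartz (v i)) ->
    \int[lam]_x (\sum_i u i x * v i x) = \sum_i \int[lam]_x (u i x * v i x).
  by move=> Ou Sv; rewrite Rintegral_sum// => i; exact: dist_fun_integrable.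
have Nint h : lam.-integrable setT (EFin \o h) -> \int[lam]_x (- h x) = - \int[lam]_x h x.
  by move=> ih; rewrite -mulN1r -RintegralZl//; apply: eq_Rintegral => x _; rewrite mulN1r.
transitivity (- \sum_i \int[lam]_x (q x * partial i (partial i f) x)).
  rewrite -sum_out// => [|i]; last by do 2 apply: schwartz_partial.
  rewrite -Nint.
    by apply: eq_Rintegral => x _; rewrite /lapl mulrN mulr_sumr.
  have := dist_fun_integrable Oq (schwartzN (schwartz_lapl Sf)).
  congr (lam.-integrable _ _); apply/funext => x /=; rewrite /lapl opprK mulr_sumr.
  by [].
transitivity (- \sum_i \int[lam]_x (partial i (partial i q) x * f x)).
  congr (- _); apply: eq_bigr => i _.
  rewrite by_parts//; last exact: schwartz_partial.
  by rewrite by_parts ?opprK//; exact: OM_partial.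
rewrite -sum_out// => [|i]; last by do 2 apply: OM_partial.
rewrite -Nint.
  by apply: eq_Rintegral => x _; rewrite /lapl mulNr mulr_suml.
have := integrable_scale (-1) (dist_fun_integrable (OM_lapl Oq) Sf).
congr (lam.-integrable _ _); apply/funext => x /=.
by congr EFin; rewrite mulN1r /lapl mulNr opprK mulr_suml.
Qed.

Lemma dist_fun_iter_lapl n q f : OM q -> schwartz f ->
  dist_fun q (iter n lapl f) = dist_fun (iter n lapl q) f.
Proof.
move=> Oq Sf; elim: n q Oq => // n IH q Oq.
rewrite [iter n.+1 lapl f]/= [iter n.+1 lapl q]iterSr.
rewrite dist_fun_lapl//; last exact: schwartz_iter_lapl.
by apply: IH; exact: OM_lapl.
Qed.

End laplacian.

(** * Laplacians of a monomial *)

Section monomials.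
Context (R : realType) (d : nat).
Local Notation E := 'rV[R]_d.
Implicit Types (x : E) (i : 'I_d).

Lemma monomial_grad (c : R) n i x :
  grad_at (fun y : E => c * y ord0 i ^+ n.+1) x (fun j => (c * n.+1%:R) * x ord0 i ^+ n * (j == i)%:R).
Proof.
elim: n => [|n IH].
  apply: grad_at_eq (grad_atZ c (grad_at_coord i x)) _ => j.
  by rewrite expr0 !mulr1.
have -> : (fun y : E => c * y ord0 i ^+ n.+2) = fun y => (c * y ord0 i ^+ n.+1) * y ord0 i.
  by apply/funext => y; rewrite exprSr mulrA.
apply: grad_at_eq (grad_atM IH (grad_at_coord i x)) _ => j.
by rewrite -[n.+2%:R]natr1 exprSr; ring.
Qed.

Lemma lapl_cst (c : R) : @lapl R d (fun=> c) = fun=> 0.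
Proof.
apply/funext => x; rewrite /lapl big1 ?oppr0// => i _.
have e (k : R) : partial i (fun=> k : R) = fun=> 0 :> R by apply/funext => y; have [_ ->] := grad_at_cst k y.
by rewrite !e.
Qed.

Lemma lapl_monomial (c : R) n i : lapl (fun x : E => c * x ord0 i ^+ n.+2) =
  fun x => - (c * n.+2%:R * n.+1%:R) * x ord0 i ^+ n.
Proof.
apply/funext => x; rewrite /lapl (bigD1 i)//= big1 ?addr0 => [|j ji].
  have -> : partial i (fun x : E => c * x ord0 i ^+ n.+2) = fun x => (c * n.+2%:R) * x ord0 i ^+ n.+1.
    by apply/funext => y; have [_ ->] := monomial_grad c n.+1 i y; rewrite eqxx mulr1.
  by have [_ ->] := monomial_grad (c * n.+2%:R) n i x; rewrite eqxx mulr1 mulNr.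
have -> : partial j (fun x : E => c * x ord0 i ^+ n.+2) = fun=> 0.
  by apply/funext => y; have [_ ->] := monomial_grad c n.+1 i y; rewrite (negbTE ji) mulr0.
by have [_ ->] := grad_at_cst 0 x.
Qed.

Lemma iter_lapl_monomial p i : exists2 kappa : R, kappa != 0 &
  iter p (@lapl R d) (fun x : E => x ord0 i ^+ (2 * p)) = fun=> kappa.
Proof.
(* Each Laplacian lowers the degree by 2 and multiplies the coefficient by a nonzero number, so the
   induction runs over all nonzero coefficients. *)
suff H : forall c : R, c != 0 -> exists2 kappa : R, kappa != 0 &
    iter p (@lapl R d) (fun x : E => c * x ord0 i ^+ (2 * p)) = fun=> kappa.
  have [k k0 e] := H 1 (oner_neq0 _); exists k => //; rewrite -e.
  by congr iter; apply/funext => x; rewrite mul1r.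
elim: p => [|p IH] c c0.
  by exists c => //; apply/funext => x; rewrite /= muln0 expr0 mulr1.
rewrite mulnS iterSr lapl_monomial; apply: IH.
by rewrite oppr_eq0 !mulf_neq0 ?pnatr_eq0.
Qed.

End monomials.

(** * Fourier transform of a potential *)

Section riesz_potential.
Context (R : realType) (d : nat).
Local Notation E := 'rV[R]_d.
Local Notation lam := (lebesgue R d).
Local Notation slam := (@slebesgue R d).
Implicit Types (f g q m : E -> R) (x y xi : E).
Hypothesis d0 : (0 < d)%N.

Lemma tempered_scale (c : R) (T : dist R d) : tempered T -> tempered (dist_scale c T).
Proof.
move=> [lT [N [C TC]]]; split=> [k f g Sf Sg|]; first by rewrite /dist_scale lT//; ring.
exists N, (`|c| * C) => f M Sf fM; rewrite normrM -mulrA ler_wpM2l//; exact: TC.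
Qed.

Lemma tempered_add (T U : dist R d) : tempered T -> tempered U -> tempered (fun f => T f + U f).
Proof.
move=> [lT [N [C TC]]] [lU [N' [C' UC]]]; split=> [k f g Sf Sg|].
  by rewrite lT// lU//; ring.
exists (maxn N N'), (C + C') => f M Sf fM.
have h n : (n <= maxn N N')%N -> forall s x, (size s <= n)%N -> (1 + enorm x) ^+ n * `|partials s f x| <= M.
  move=> nN s x sn; apply: le_trans (fM s x (leq_trans sn nN)).
  by rewrite ler_wpM2r// ler_weXn2l// enorm1_ge1.
apply: le_trans (ler_normD _ _) _; rewrite mulrDl; apply: lerD.
  by apply: TC => //; apply: h; exact: leq_maxl.
by apply: UC => //; apply: h; exact: leq_maxr.
Qed.

Lemma ae_neq0 : {ae lam, forall x : E, x != 0}.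
Proof. by have := negligible_origin R d0. Qed.

Lemma eq_Rintegral_neq0 f g : measurable_fun setT f -> measurable_fun setT g ->
  (forall x, x != 0 -> f x = g x) -> \int[lam]_x f x = \int[lam]_x g x.
Proof.
move=> mf mg fg; rewrite /Rintegral; congr fine; apply: ae_eq_integral => //.
- exact/measurable_EFinP.
- exact/measurable_EFinP.
- by apply: filterS ae_neq0 => x x0 _; rewrite fg.
Qed.

(* As the integral converges, the divergent power is removed with coefficient 0. *)
Lemma finite_part_integral (sigma : R) f L : 0 <= sigma ->
  lam.-integrable setT (EFin \o (fun xi => f xi * enorm xi `^ (- d%:R - 1 - sigma))) ->
  finite_part sigma f L ->
  L = \int[lam]_xi (f xi * enorm xi `^ (- d%:R - 1 - sigma)).
Proof.
set q := (fun xi => f xi * _) => s0 iq [A cA].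
pose e_ (n : nat) : R := n.+1%:R^-1.
have e0 n : 0 < e_ n by rewrite invr_gt0.
have ec : e_ @ \oo --> (0 : R) by exact: cvg_harmonic.
have c1 := (cvg_at_rightP _ _ _).1 cA e_ (conj e0 ec).
have mq := integrable_measurable iq.
have c2 : (fun n => \int[lam]_(xi in [set xi | e_ n < enorm xi]) q xi) @ \oo --> \int[lam]_xi q xi.
  under eq_fun do rewrite Rintegral_mkcond.
  refine (@Rintegral_dct _ _ _ lam _ _ (fun xi => `|q xi|) _ _ _ _ _).2 => //.
  - move=> n; apply/(measurable_restrictT _ _).1; last exact: measurable_funTS.
    by apply: open_measurable_rV; exact: open_enorm_gt.
  - apply: filterS ae_neq0 => xi xi0.
    have xp : 0 < enorm xi by rewrite enorm_gt0.
    apply: (@cvg_near_cst _ _ _ _ _ _ _).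
    near=> n; rewrite patchE mem_set//=; near: n.
    exact: (@cvgr_lt _ _ _ _ _ _ ec _ xp).
  - exact: integrable_abs.
  - by move=> n xi; rewrite patchE; case: ifP => _ //; rewrite normr0.
have e1 n : e_ n <= 1 by rewrite invf_le1// ler1n.
have c4 : (fun n => e_ n `^ (1 + sigma)) @ \oo --> (0 : R).
  apply: (@squeeze_cvgr _ _ _ _ (fun=> 0) e_) => //; last exact: cvg_cst.
  by apply: nearW => n; rewrite powR_ge0 ge1r_powR ?e0 ?e1 ?lerDl.
(* The difference is [A e^(- 1 - sigma)], and times [e^(1 + sigma)] it is the constant [A]; but the
   difference converges and the factor tends to 0. *)
have c5 : (fun n => (\int[lam]_(xi in [set xi | e_ n < enorm xi]) q xi -
      (\int[lam]_(xi in [set xi | e_ n < enorm xi]) q xi - A * e_ n `^ (- 1 - sigma))) * e_ n `^ (1 + sigma)) @ \oo -->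
    (\int[lam]_xi q xi - L) * 0 by exact: (cvgM (cvgB c2 c1) c4).
have A0 : A = 0.
  have c6 : (fun=> A) @ \oo --> (\int[lam]_xi q xi - L) * 0.
    have e n : (\int[lam]_(xi in [set xi | e_ n < enorm xi]) q xi -
      (\int[lam]_(xi in [set xi | e_ n < enorm xi]) q xi - A * e_ n `^ (- 1 - sigma))) * e_ n `^ (1 + sigma) = A.
      rewrite opprB addrC subrK -mulrA -powRD ?(gt_eqF (e0 n)) ?implybT//.
      by rewrite -opprD addNr powRr0 mulr1.
    by move: c5; under eq_fun do rewrite e.
  by move: c6; rewrite mulr0 => /(cvg_unique (@norm_hausdorff _ R^o) (cvg_cst A)).
have c7 : (fun n => \int[lam]_(xi in [set xi | e_ n < enorm xi]) q xi) @ \oo --> L.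
  by move: c1; rewrite A0; apply: cvg_trans; apply: near_eq_cvg; apply: nearW => n /=; rewrite mul0r subr0.
by apply/esym; apply: (cvg_unique (@norm_hausdorff _ R^o) c2); exact: c7.
Unshelve. all: by end_near. Qed.

Variables (a ga : R) (omega : {finite_measure set E -> \bar R}) (Psi : dist R d).
Hypotheses (a0 : 0 <= a) (a1 : a < 1) (gaP : gamma_const d a ga).
Hypothesis (oPsi : psi_conv a omega Psi).

Let w xi := enorm xi `^ (- d%:R - 1 - a) : R.

Let mw : measurable_fun setT w. Proof. exact: measurable_enorm_powR. Qed.

(** When [g] compensates the singularity of [w], the finite part that defines [gamma] is an ordinary
    integral. *)
Lemma psi_ft g : schwartz g -> lam.-integrable setT (EFin \o (fun xi => g xi * w xi)) ->
  \int[lam]_x (psi a x * ft cos g x) = ga * \int[lam]_xi (g xi * w xi) /\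
  \int[lam]_x (psi a x * ft sin g x) = 0.
Proof.
move=> Sg ig; have [_ /(_ g Sg)[L fL]] := gaP.
have -> := finite_part_integral a0 ig fL.
rewrite fourier_distE => -[-> e2]; split => //.
have [_ Ss] := schwartz_ft d0 Sg.
have ip := tame_schwartz_integrable d0 (measurable_psi a) (psi_tame d a0) Ss.
apply/eqP; rewrite -oppr_eq0 -mulN1r -RintegralZl//; apply/eqP; rewrite -{}e2.
by apply: eq_Rintegral => x _; rewrite mulN1r mulrN.
Qed.

Lemma ft_shift g y x : schwartz g ->
  ft cos g (x + y) = ft cos (fun xi => g xi * cos (dot xi y)) x - ft sin (fun xi => g xi * sin (dot xi y)) x /\
  ft sin g (x + y) = ft sin (fun xi => g xi * cos (dot xi y)) x + ft cos (fun xi => g xi * sin (dot xi y)) x.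
Proof.
move=> Sg; have ig := schwartz_integrable d0 Sg.
have ic := integrable_wave y (@wave_cos R) ig; have is_ := integrable_wave y (@wave_sin R) ig.
have icc := integrable_wave x (@wave_cos R) ic; have ics := integrable_wave x (@wave_sin R) ic.
have isc := integrable_wave x (@wave_cos R) is_; have iss := integrable_wave x (@wave_sin R) is_.
split; rewrite /ft.
  rewrite -RintegralB//; apply: eq_Rintegral => xi _.
  by rewrite dotDr cosD; ring.
rewrite -RintegralD//; apply: eq_Rintegral => xi _.
by rewrite dotDr sinD; ring.
Qed.

(** The shift of [psi a] is moved onto the transform, where it modulates [g] by the cosine and sine
    of [dot xi y]; [psi_ft] applies to both modulated functions. *)
Lemma psi_shift_ft g y : schwartz g -> lam.-integrable setT (EFin \o (fun xi => g xi * w xi)) ->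
  \int[lam]_x (psi a (x - y) * ft cos g x) = ga * \int[lam]_xi (g xi * w xi * cos (dot xi y)) /\
  \int[lam]_x (psi a (x - y) * ft sin g x) = ga * \int[lam]_xi (g xi * w xi * sin (dot xi y)).
Proof.
move=> Sg ig; have [Oc Os] := @OM_cos_sin R d y.
pose gc xi := g xi * cos (dot xi y); pose gs xi := g xi * sin (dot xi y).
have Sc : schwartz gc by have := schwartz_mul Oc Sg; congr schwartz; apply/funext => xi; rewrite mulrC.
have Ss : schwartz gs by have := schwartz_mul Os Sg; congr schwartz; apply/funext => xi; rewrite mulrC.
have ec : (fun xi => gc xi * w xi) = fun xi => g xi * w xi * cos (dot xi y).
  by apply/funext => xi; rewrite /gc mulrAC.
have es : (fun xi => gs xi * w xi) = fun xi => g xi * w xi * sin (dot xi y).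
  by apply/funext => xi; rewrite /gs mulrAC.
have [c1 c2] : \int[lam]_x (psi a x * ft cos gc x) = ga * \int[lam]_xi (g xi * w xi * cos (dot xi y)) /\
    \int[lam]_x (psi a x * ft sin gc x) = 0.
  by rewrite -[X in ga * X](_ : \int[lam]_xi (gc xi * w xi) = _); [apply: psi_ft => //; rewrite ec; exact: integrable_wave (@wave_cos R) ig|rewrite ec].
have [s1 s2] : \int[lam]_x (psi a x * ft cos gs x) = ga * \int[lam]_xi (g xi * w xi * sin (dot xi y)) /\
    \int[lam]_x (psi a x * ft sin gs x) = 0.
  by rewrite -[X in ga * X](_ : \int[lam]_xi (gs xi * w xi) = _); [apply: psi_ft => //; rewrite es; exact: integrable_wave (@wave_sin R) ig|rewrite es].
have ip f : schwartz f -> lam.-integrable setT (EFin \o (fun x => psi a x * f x)).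
  by move=> Sf; exact: (tame_schwartz_integrable d0 (measurable_psi a) (psi_tame d a0) Sf).
have [Scc Scs] := schwartz_ft d0 Sc; have [Ssc Sss] := schwartz_ft d0 Ss.
have [Sgc Sgs] := schwartz_ft d0 Sg.
have shift h : measurable_fun setT h ->
    \int[lam]_x (psi a (x - y) * h x) = \int[lam]_x (psi a x * h (x + y)).
  move=> mh; rewrite -(@Rintegral_shift R d (fun x => psi a (x - y) * h x) y).
    by apply: eq_Rintegral => x _; rewrite addrK.
  by apply: measurable_funM => //; exact: (measurableT_comp (measurable_psi a) (measurable_translate y)).
rewrite !shift; [|exact: smooth_measurable Sgs.1|exact: smooth_measurable Sgc.1].
split.
  rewrite -[RHS]subr0 -{}c1 -{}s2 -RintegralB//; [|exact: ip|exact: ip].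
  by apply: eq_Rintegral => x _; rewrite (ft_shift y x Sg).1 mulrBr.
rewrite -[RHS]add0r -{}c2 -{}s1 -RintegralD//; [|exact: ip|exact: ip].
by apply: eq_Rintegral => x _; rewrite (ft_shift y x Sg).2 mulrDr.
Qed.

Let o1 : omega.-integrable setT (EFin \o (cst 1 : E -> R)).
Proof. exact/integrable_one/fin_num_measure. Qed.

Lemma ft_measure_swap k q : wave k -> lam.-integrable setT (EFin \o q) ->
  lam.-integrable setT (EFin \o (fun xi => q xi * \int[omega]_y k (dot y xi))) /\
  \int[omega]_y \int[lam]_xi (q xi * k (dot xi y)) = \int[lam]_xi (q xi * \int[omega]_y k (dot y xi)).
Proof.
move=> wk iq; have [ck k1] := wk; have mq := integrable_measurable iq.
have mF : measurable_fun setT (fun z : E * E => q z.1 * k (dot z.1 z.2)).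
  apply: measurable_funM; first exact: measurable_comp_fst.
  apply: (@measurableT_comp _ _ _ _ _ _ k); last exact: measurable_dot2.
  exact: continuous_measurable_fun.
have Fb x y : `|q x * k (dot x y)| <= `|q x| * cst 1 y.
  by rewrite normrM ler_wpM2l.
have ik xi : omega.-integrable setT (EFin \o (fun y => k (dot y xi))).
  by apply: (integrable_le _ o1 (fun y => k1 _)); exact: measurable_wave.
have e xi : \int[omega]_y (q xi * k (dot xi y)) = q xi * \int[omega]_y k (dot y xi).
  by rewrite -RintegralZl//; apply: eq_Rintegral => y _; rewrite dotC.
have iaq : slam.-integrable setT (EFin \o (fun x => `|q x|)) by exact: (integrable_abs iq).
split.
  have := @integrable_Rintegral1 R _ _ _ _ slam omega _ _ _ mF iaq o1 Fb.
  by congr (lam.-integrable _ _); apply/funext => xi /=; rewrite e.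
have /= <- := @Rfubini_bound R _ _ _ _ slam omega _ _ _ mF iaq o1 Fb.
by apply: eq_Rintegral => xi _; rewrite e.
Qed.

Lemma psi_conv_ft g : schwartz g -> lam.-integrable setT (EFin \o (fun xi => g xi * w xi)) ->
  Psi (ft cos g) = ga * \int[lam]_xi (g xi * w xi * \int[omega]_y cos (dot y xi)) /\
  Psi (ft sin g) = ga * \int[lam]_xi (g xi * w xi * \int[omega]_y sin (dot y xi)).
Proof.
move=> Sg ig; have [Sc Ss] := schwartz_ft d0 Sg; have [tP HP] := oPsi.
have [hc ->] := HP _ Sc; have [hs ->] := HP _ Ss.
have [ic <-] := ft_measure_swap (@wave_cos R) ig; have [is_ <-] := ft_measure_swap (@wave_sin R) ig.
have [ga0 _] := gaP.
(* The convolution gives the integrability of [ga * B]; that of [B] follows on dividing by [ga],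
   which is nonzero. *)
have pull u B : omega.-integrable setT (EFin \o u) -> (forall y, u y = ga * B y) ->
    \int[omega]_y u y = ga * \int[omega]_y B y.
  move=> iu uB; have iB : omega.-integrable setT (EFin \o B).
    have := integrable_scale ga^-1 iu; congr (omega.-integrable _ _).
    by apply/funext => y /=; rewrite uB mulKf.
  by rewrite -RintegralZl//; apply: eq_Rintegral => y _; rewrite uB.
by split; apply: pull => // y; have [] := psi_shift_ft y Sg ig.
Qed.

Variables (r gr alpha : R) (Q : dist R d).
Hypotheses (r0 : 0 <= r) (ra : r <= a) (gr0 : gr != 0).
Hypotheses (alphaE : alpha = (d%:R + 1 + r) / 2) (QP : calL_psi r a gr ga omega Q).

Let v xi := enorm xi `^ (r - a) : R.

Let alpha2 : 2 * alpha = d%:R + 1 + r. Proof. by rewrite alphaE mulrCA divff ?mulr1. Qed.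

Let alpha2_neq0 : 2 * alpha != 0.
Proof. by rewrite alpha2 gt_eqF// ltr_pwDl// ltr_wpDl. Qed.

(** The singularity has exponent [a - r], which lies in [[0, 1)]. *)
Let iv f : schwartz f -> lam.-integrable setT (EFin \o (fun xi => v xi * f xi)).
Proof.
move=> Sf; have [C fC] := schwartz_rapid Sf (2 * d)%N.
apply: (@integrable_decay_sing _ _ d0 (a - r) C).
- by rewrite subr_ge0.
- by apply: le_lt_trans a1; rewrite gerBl.
- apply: measurable_funM; first exact: measurable_enorm_powR.
  exact: smooth_measurable Sf.1.
- move=> xi; rewrite normrM (ger0_norm (powR_ge0 _ _)) opprB mulrCA ler_wpM2l ?powR_ge0//.
  by rewrite ler_pdivlMr ?exprn_gt0 ?enorm1_gt0// mulrC.
Qed.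

(** The exponents [d + 1 + r] and [- d - 1 - a] add up to [r - a]; they can be added at a nonzero
    base. *)
Let multiplier_weight m f xi : xi != 0 ->
  m xi * enorm xi `^ (2 * alpha) * f xi * w xi = m xi * (v xi * f xi).
Proof.
move=> xi0; have e0 : enorm xi != 0 by rewrite gt_eqF// enorm_gt0.
have -> : v xi = enorm xi `^ (2 * alpha) * w xi.
  by rewrite /w -powRD ?e0 ?implybT// alpha2; congr (_ `^ _); ring.
by ring.
Qed.

(** The bounded factor [m] is 1 when [alpha] is natural and [1 - theta (xi / eps)] otherwise, so
    both branches of [frac_lap] are served. *)
Lemma psi_conv_multiplier m (B : R) k f : wave k -> (forall xi, `|m xi| <= B) ->
  measurable_fun setT m -> schwartz f ->
  schwartz (fun xi => m xi * enorm xi `^ (2 * alpha) * f xi) ->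
  lam.-integrable setT (EFin \o (fun xi => m xi * enorm xi `^ (2 * alpha) * f xi * w xi)) /\
  \int[lam]_xi (m xi * enorm xi `^ (2 * alpha) * f xi * w xi * \int[omega]_y k (dot y xi)) =
  \int[lam]_xi (m xi * (v xi * f xi * \int[omega]_y k (dot y xi))).
Proof.
move=> wk mB mm Sf Sg.
have ig : lam.-integrable setT (EFin \o (fun xi => m xi * enorm xi `^ (2 * alpha) * f xi * w xi)).
  apply: (integrable_le _ (integrable_scale B (integrable_abs (iv Sf)))).
    by apply: measurable_funM => //; exact: smooth_measurable Sg.1.
  move=> xi; have [->|xi0] := eqVneq xi 0.
    rewrite enorm0 powR0// mulr0 mul0r mul0r normr0 mulr_ge0//.
    exact: le_trans (mB 0).
  by rewrite multiplier_weight// normrM ler_wpM2r.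
split=> //.
have [i1 _] := ft_measure_swap wk ig; have [i2 _] := ft_measure_swap wk (iv Sf).
apply: eq_Rintegral_neq0.
- exact: integrable_measurable i1.
- by apply: measurable_funM => //; exact: integrable_measurable i2.
- by move=> xi xi0; rewrite multiplier_weight// -mulrA.
Qed.

Lemma calL_psi_ft f : schwartz f ->
  gr * Q (ft cos f) = ga * \int[lam]_xi (v xi * f xi * \int[omega]_y cos (dot y xi)) /\
  gr * Q (fun xi => - ft sin f xi) = - (ga * \int[lam]_xi (v xi * f xi * \int[omega]_y sin (dot y xi))).
Proof.
move=> Sf; have [_ /(_ f Sf)] := QP; rewrite fourier_distE /= => -[-> ->].
have [ic _] := ft_measure_swap (@wave_cos R) (iv Sf); have [is_ _] := ft_measure_swap (@wave_sin R) (iv Sf).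
have E (t : R) W : lam.-integrable setT (EFin \o (fun xi => v xi * f xi * W xi)) ->
    gr * \int[lam]_xi (ga / gr * enorm xi `^ (r - a) * f xi * (t * W xi)) =
    t * (ga * \int[lam]_xi (v xi * f xi * W xi)).
  move=> iW; rewrite (_ : (fun xi => _) = fun xi => (t * (ga / gr)) * (v xi * f xi * W xi)).
    by rewrite RintegralZl//; set I := Rintegral _ _ _; field.
  by apply/funext => xi; rewrite /v; ring.
split; [have := E 1 _ ic|have := E (-1) _ is_].
  by rewrite mul1r => <-; congr (_ * _); apply: eq_Rintegral => xi _; rewrite mul1r.
by rewrite mulN1r => <-; congr (_ * _); apply: eq_Rintegral => xi _; rewrite mulN1r.
Qed.

(** The direct definition of [L_r (psi_a * omega)] by the symbol [|xi|^(r - a)] agrees with the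
    multiplier [gr^-1 |xi|^(2 alpha)]; the factor [gr] appears because [frac_lap] lacks the constant
    [c_{d,r}]. *)
Lemma psi_conv_frac_lap : frac_lap alpha Psi (dist_scale gr Q).
Proof.
have [tP _] := oPsi; have [tQ _] := QP.
split; first exact: tempered_scale.
move=> f Sf; have [Qc Qs] := calL_psi_ft Sf.
have [i1 _] := ft_measure_swap (@wave_cos R) (iv Sf); have [i2 _] := ft_measure_swap (@wave_sin R) (iv Sf).
have main m (B : R) : (forall xi, `|m xi| <= B) -> measurable_fun setT m ->
    schwartz (fun xi => m xi * enorm xi `^ (2 * alpha) * f xi) ->
    fourier_dist Psi (fun xi => m xi * enorm xi `^ (2 * alpha) * f xi) =
    complex.Complex (ga * \int[lam]_xi (m xi * (v xi * f xi * \int[omega]_y cos (dot y xi))))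
      (- (ga * \int[lam]_xi (m xi * (v xi * f xi * \int[omega]_y sin (dot y xi))))).
  move=> mB mm Sg; rewrite fourier_distE.
  have [ig <-] := psi_conv_multiplier (@wave_cos R) mB mm Sf Sg.
  have [_ <-] := psi_conv_multiplier (@wave_sin R) mB mm Sf Sg.
  have [<- <-] := psi_conv_ft Sg ig.
  by rewrite temperedN//; have [] := schwartz_ft d0 Sg.
split.
  move=> an; have Sg : schwartz (fun xi => 1 * enorm xi `^ (2 * alpha) * f xi).
    have [n ->] := an; have := schwartz_mul (@OM_even_powR R d n) Sf.
    by congr schwartz; apply/funext => xi; rewrite mul1r.
  rewrite (_ : (fun xi => enorm xi `^ _ * f xi) = fun xi => 1 * enorm xi `^ (2 * alpha) * f xi); last first.
    by apply/funext => xi; rewrite mul1r.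
  rewrite (main (fun=> 1) 1)// => [|xi]; last by rewrite normr1.
  rewrite fourier_distE /dist_scale Qc Qs; congr complex.Complex; [congr (_ * _)|congr (- (_ * _))];
    by apply: eq_Rintegral => xi _; rewrite mul1r.
move=> _ theta ct; have [st cpt _] := ct.
have [M tM] := compact_supp_far_zero cpt.
have St : schwartz theta by apply: far_zero_schwartz => //; exists M.
have [B thB] : exists B, forall xi, `|theta xi| <= B.
  by have [B HB] := schwartz_rapid St 0%N; exists B => xi; have := HB xi; rewrite expr0 mul1r.
(* At each [xi != 0] the factor [1 - theta (xi / eps)] is eventually 1, and it is bounded by
   [1 + B]. *)
have lim k : lam.-integrable setT (EFin \o (fun xi => v xi * f xi * \int[omega]_y k (dot y xi))) ->
    (fun eps : R => ga * \int[lam]_xi ((1 - theta (eps^-1 *: xi)) * (v xi * f xi * \int[omega]_y k (dot y xi)))) @ 0^'+ -->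
    ga * \int[lam]_xi (v xi * f xi * \int[omega]_y k (dot y xi)).
  set W := (fun xi => _) => iW; apply: cvgMr.
  apply/cvg_at_rightP => e_ [e0 ec].
  have mt n : measurable_fun setT (fun xi : E => 1 - theta ((e_ n)^-1 *: xi)).
    by have [[sm _] _] := cutoff_complement_OM ct (e0 n); exact: smooth_measurable.
  refine (@Rintegral_dct _ _ _ lam _ _ (fun xi => (1 + B) * `|W xi|) _ _ _ _ _).2.
  - by move=> n; apply: measurable_funM => //; exact: integrable_measurable iW.
  - exact: integrable_measurable iW.
  - apply: filterS ae_neq0 => xi xi0.
    have xp : 0 < enorm xi by rewrite enorm_gt0.
    apply: cvg_near_cst.
    near=> n; rewrite tM ?subr0 ?mul1r// enormZ gtr0_norm ?invr_gt0//.
    rewrite mulrC ltr_pdivlMr//; near: n.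
    have cM : (fun n => M * e_ n) @ \oo --> M * 0 by exact: cvgMr.
    by rewrite mulr0 in cM; exact: (@cvgr_lt _ _ _ _ _ _ cM _ xp).
  - by apply: integrable_scale; exact: integrable_abs.
  - move=> n xi; rewrite normrM ler_wpM2r//.
    by apply: le_trans (ler_normB _ _) _; rewrite normr1 lerD2l.
have e : \forall eps \near 0^'+,
    fourier_dist Psi (fun xi => (1 - theta (eps^-1 *: xi)) * enorm xi `^ (2 * alpha) * f xi) =
    complex.Complex (ga * \int[lam]_xi ((1 - theta (eps^-1 *: xi)) * (v xi * f xi * \int[omega]_y cos (dot y xi))))
      (- (ga * \int[lam]_xi ((1 - theta (eps^-1 *: xi)) * (v xi * f xi * \int[omega]_y sin (dot y xi))))).
  near=> eps; have e0 : 0 < eps by [].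
  apply: (main _ (1 + B)); last exact: schwartz_cutoff_powR.
    by move=> xi; apply: le_trans (ler_normB _ _) _; rewrite normr1 lerD2l.
  by have [[sm _] _] := cutoff_complement_OM ct e0; exact: smooth_measurable.
have cRe := lim cos i1.
have cIm : (fun eps : R => - (ga * \int[lam]_xi ((1 - theta (eps^-1 *: xi)) *
      (v xi * f xi * \int[omega]_y sin (dot y xi))))) @ 0^'+ -->
    - (ga * \int[lam]_xi (v xi * f xi * \int[omega]_y sin (dot y xi))).
  by apply: cvgN; exact: lim.
rewrite [fourier_dist (dist_scale _ _) _]fourier_distE /dist_scale Qc Qs.
by split; [apply: cvg_trans cRe|apply: cvg_trans cIm]; apply: near_eq_cvg;
  apply: filterS e => eps ->.
Unshelve. all: by end_near. Qed.

End riesz_potential.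

Section zero_measure.
Context (R : realType) d (T : measurableType d).

(** The zero measure as a finite measure: the candidate [Q - L_r F] when [L_r F = Q]. *)
Definition fzero : set T -> \bar R := mzero.

HB.instance Definition _ := Measure.on fzero.

Let fzero_finite : fin_num_fun fzero.
Proof. by []. Qed.

HB.instance Definition _ := Measure_isFinite.Build _ _ _ fzero fzero_finite.

Lemma Rintegral_fzero (f : T -> R) : \int[fzero]_x f x = 0.
Proof. by rewrite /Rintegral integral_measure_zero. Qed.

Lemma integrable_fzero (f : T -> R) : measurable_fun setT f ->
  fzero.-integrable setT (EFin \o f).
Proof.
move=> mf; apply/integrableP; split; first exact/measurable_EFinP.
by rewrite integral_measure_zero.
Qed.

Lemma ae_fzero (P : T -> Prop) : {ae fzero, forall x, P x}.
Proof. by exists setT; split. Qed.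

End zero_measure.

Lemma iter_lapl0 (R : realType) (d n : nat) : iter n (@lapl R d) (fun=> 0) = fun=> 0.
Proof. by elim: n => // n IH; rewrite iterS IH lapl_cst. Qed.

(** * Independence of the exterior condition *)

Section exterior_condition.
Context (R : realType) (d : nat).
Local Notation E := 'rV[R]_d.
Local Notation lam := (lebesgue R d).
Implicit Types (f q : E -> R).
Hypothesis d0 : (0 < d)%N.
Variables (gamma : R -> R) (r a : R) (omega : {finite_measure set E -> \bar R}).
Variables (Psi Q : dist R d) (p : nat) (s : R).
Hypotheses (gammaP : forall sigma : R, 0 <= sigma -> sigma < 1 -> gamma_const d sigma (gamma sigma)).
Hypotheses (r0 : 0 <= r) (ra : r <= a) (a1 : a < 1).
Hypotheses (oPsi : psi_conv a omega Psi) (QP : calL_psi r a (gamma r) (gamma a) omega Q).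
Hypotheses (s0 : 0 < s) (s1 : s <= 1) (ps : (d%:R + 1 + r) / 2 = p%:R + s).

Let a0 : 0 <= a. Proof. exact: le_trans ra. Qed.
Let r1 : r < 1. Proof. exact: le_lt_trans a1. Qed.
Let gr0 : gamma r != 0. Proof. by have [] := gammaP r0 r1. Qed.

(** Integrability, even for the zero measure, includes measurability. A Gaussian in [y] makes Fubini
    applicable and is then divided out. *)
Lemma measurable_psi_conv (sigma : R) f : 0 <= sigma -> schwartz f ->
  measurable_fun setT (fun y : E => \int[lam]_x (psi sigma (x - y) * f x)).
Proof.
move=> sg0 Sf; have [|n Hn] := @enorm_powR_le R d (1 + sigma); first by rewrite addr_ge0.
have Sg := @gauss_schwartz R d 1 ltr01.
pose F (z : E * E) := psi sigma (z.2 - z.1) * f z.2 * gauss 1 z.1.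
have mf := smooth_measurable Sf.1; have mg := smooth_measurable Sg.1.
have mF : measurable_fun setT F.
  apply: measurable_funM; last exact: measurable_comp_fst.
  apply: measurable_funM; last exact: measurable_comp_snd.
  have m2 : measurable_fun setT (fun z : E * E => z.2 - z.1).
    apply: measurable_fun_rVP => i; under eq_fun do rewrite !mxE.
    apply: measurable_funB; first exact: (measurable_comp_snd (@measurable_coord _ _ i)).
    exact: (measurable_comp_fst (@measurable_coord _ _ i)).
  exact: (measurableT_comp (measurable_psi sigma) m2).
have wt (h : E -> R) : schwartz h -> lam.-integrable setT (EFin \o (fun x => (1 + enorm x) ^+ n * `|h x|)).
  move=> Sh; apply: (tame_rapid_integrable d0).
  - apply: measurable_funX; apply: measurable_funD => //; exact: measurable_enorm.
  - by apply: measurableT_comp => //; exact: smooth_measurable Sh.1.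
  - exists n, 1 => x; rewrite mul1r ger0_norm// exprn_ge0// ltW// enorm1_gt0.
    by [].
  - by move=> k; have [C hC] := schwartz_rapid Sh k; exists C => x; rewrite normr_id.
have Fb x y : `|F (x, y)| <= (1 + enorm x) ^+ n * `|gauss 1 x| * ((1 + enorm y) ^+ n * `|f y|).
  rewrite /F /= !normrM (ger0_norm (powR_ge0 _ _)).
  have h : psi sigma (y - x) <= (1 + enorm x) ^+ n * (1 + enorm y) ^+ n.
    apply: le_trans (Hn _) _; rewrite -exprMn lerXn2r ?nnegrE ?mulr_ge0 ?addr_ge0 ?enorm_ge0//.
    by rewrite mulrC ler_enorm1B.
  rewrite (_ : (1 + enorm x) ^+ n * `|gauss 1 x| * ((1 + enorm y) ^+ n * `|f y|) =
    (1 + enorm x) ^+ n * (1 + enorm y) ^+ n * `|f y| * `|gauss 1 x|); last by ring.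
  by rewrite ler_wpM2r// ler_wpM2r.
have := @integrable_Rintegral1 R _ _ _ _ (@slebesgue R d) (@slebesgue R d) F _ _ mF (wt _ Sg) (wt _ Sf) Fb.
move=> /integrable_measurable.
have me : measurable_fun setT (fun x : E => expR (1 * dot x x)).
  apply: measurableT_comp => //; have := OM_sqr R d => -[sq _].
  by apply: smooth_measurable; under eq_fun do rewrite mul1r.
move=> /(measurable_funM)/(_ me); congr (measurable_fun _ _); apply/funext => y /=.
have ip : lam.-integrable setT (EFin \o (fun x => psi sigma (x - y) * f x)).
  apply: (tame_schwartz_integrable d0 _ _ Sf); last exact: tame_translate (psi_tame d sg0).
  exact: (measurableT_comp (measurable_psi sigma) (measurable_translate y)).
rewrite [X in X * _](RintegralZr (gauss 1 y) measurableT ip) -mulrA /gauss -expRD addNr expR0.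
by rewrite mulr1.
Qed.

(** For [q] annihilated by [p + 1] Laplacians, adding [q] leaves [L_r] unchanged but may change
    [(-Delta)^p]. *)
Definition perturbed_potential q : dist R d := fun f => Psi f + dist_fun q f.

Lemma perturbed_tempered q : OM q -> tempered (perturbed_potential q).
Proof. by move=> Oq; apply: tempered_add; [case: oPsi|exact: tempered_dist_fun]. Qed.

(** The factor [|xi|^(2n)] becomes [n] Laplacians of the transform, which are moved onto [q]. *)
Lemma dist_fun_ft_eq0 n q g : OM q -> iter n (@lapl R d) q = (fun=> 0) -> schwartz g ->
  dist_fun q (ft cos (fun xi => dot xi xi ^+ n * g xi)) = 0 /\
  dist_fun q (ft sin (fun xi => dot xi xi ^+ n * g xi)) = 0.
Proof.
move=> Oq q0 Sg; have [Sc Ss] := schwartz_ft d0 Sg; have [<- <-] := iter_lapl_ft d0 n Sg.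
rewrite !dist_fun_iter_lapl// q0 /dist_fun.
by split; under eq_Rintegral do rewrite mul0r; rewrite Rintegral_cst ?mul0r.
Qed.

Lemma fourier_perturbed n q g : OM q -> iter n (@lapl R d) q = (fun=> 0) -> schwartz g ->
  fourier_dist (perturbed_potential q) (fun xi => dot xi xi ^+ n * g xi) =
  fourier_dist Psi (fun xi => dot xi xi ^+ n * g xi).
Proof.
move=> Oq q0 Sg; rewrite !fourier_distE /perturbed_potential.
have [c s_] := dist_fun_ft_eq0 Oq q0 Sg.
have [_ Ss] := schwartz_ft d0 (schwartz_dot_exp n Sg).
by rewrite c addr0 (temperedN (tempered_dist_fun d0 Oq))// s_ oppr0 addr0.
Qed.

(** If [p + s] is natural then [s = 1] and the multiplier is exactly [|xi|^(2(p + 1))]. Otherwise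
    this power is split off from the cut-off multiplier, and in either case [q] contributes
    nothing. *)
Lemma perturbed_frac_lap q : OM q -> iter p.+1 (@lapl R d) q = (fun=> 0) ->
  frac_lap (p%:R + s) (perturbed_potential q) (dist_scale (gamma r) Q).
Proof.
move=> Oq q0; have ga := gammaP a0 a1.
have [tQ H] := psi_conv_frac_lap d0 a0 a1 ga oPsi r0 ra gr0 (esym ps) QP.
split => // f Sf; have [H1 H2] := H f Sf; split=> [an|an theta ct].
  rewrite (H1 an) (natural_sum s0 s1 an).
  have -> : (fun xi => enorm xi `^ (2 * (p%:R + 1)) * f xi) = fun xi => dot xi xi ^+ p.+1 * f xi.
    by apply/funext => xi; rewrite natr1 enorm_powR_even.
  by rewrite fourier_perturbed.
have [c1 c2] := H2 an theta ct; have [_ _ /nbhs_singleton t1] := ct.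
have e : \forall eps \near 0^'+,
    fourier_dist Psi (fun xi => (1 - theta (eps^-1 *: xi)) * enorm xi `^ (2 * (p%:R + s)) * f xi) =
    fourier_dist (perturbed_potential q) (fun xi => (1 - theta (eps^-1 *: xi)) * enorm xi `^ (2 * (p%:R + s)) * f xi).
  near=> eps; have eps0 : 0 < eps by [].
  (* The remaining exponent [2s - 2] is not positive, but the cutoff vanishes near the origin and
     the quotient stays Schwartz. *)
  have -> : (fun xi => (1 - theta (eps^-1 *: xi)) * enorm xi `^ (2 * (p%:R + s)) * f xi) =
      fun xi => dot xi xi ^+ p.+1 * ((1 - theta (eps^-1 *: xi)) * enorm xi `^ (2 * s - 2) * f xi).
    apply/funext => xi; have [->|xi0] := eqVneq xi 0.
      by rewrite scaler0 t1 subrr !mul0r mulr0.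
    rewrite -enorm_powR_even (_ : 2 * (p%:R + s) = 2 * p.+1%:R + (2 * s - 2)); last first.
      by rewrite -natr1; ring.
    rewrite powRD ?(gt_eqF (_ : 0 < enorm xi)) ?implybT ?enorm_gt0//.
    by ring.
  by rewrite fourier_perturbed//; exact: schwartz_cutoff_powR.
by split; [apply: cvg_trans c1|apply: cvg_trans c2]; apply: near_eq_cvg;
  apply: filterS e => eps ->.
Unshelve. all: by end_near. Qed.

Lemma perturbed_gradient q : OM q ->
  gradient_rep (perturbed_potential q) (fun x => \row_i (K_conv a omega x ord0 i + partial i q x)).
Proof.
move=> Oq i; have [mK HK] := psi_conv_gradient d0 a0 a1 oPsi i.
have Op := OM_partial i Oq.
have -> : (fun x : E => (\row_i (K_conv a omega x ord0 i + partial i q x)) ord0 i) =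
    fun x => K_conv a omega x ord0 i + partial i q x.
  by apply/funext => x; rewrite mxE.
split; first by apply: measurable_funD => //; exact: smooth_measurable Op.1.
move=> f tf; have [iK eK] := HK f tf; have Sf := test_schwartz tf.
have [iq eq_] := integration_by_parts_rV d0 (smooth_measurable Oq.1) (smooth_measurable Op.1)
    (Oq.2 [::]) (OM_quotient_limit i Oq) Sf.
have -> : (fun x => (K_conv a omega x ord0 i + partial i q x) * f x) =
    fun x => K_conv a omega x ord0 i * f x + partial i q x * f x.
  by apply/funext => x; rewrite mulrDl.
split; first exact: (integrable_add iK iq).
rewrite [RHS](RintegralD measurableT iK iq) -eK /perturbed_potential opprD; congr (_ + _).
by rewrite /dist_fun eq_ opprK.
Qed.

(** As [L_r F = Q], the candidate is the zero measure, for which the almost-everywhere conditions of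
    [admissible] hold trivially. *)
Lemma perturbed_ansatz q : OM q -> iter p.+1 (@lapl R d) q = (fun=> 0) ->
  ansatz r (gamma r)^-1 Q (perturbed_potential q) Q
    (fun x => \row_i (K_conv a omega x ord0 i + partial i q x)) (@fzero R _ E) (@fzero R _ E).
Proof.
move=> Oq q0; have Op i := OM_partial i Oq.
have z0 : psi_conv r (@fzero R _ E) (fun=> 0).
  split.
    split; first by move=> k f g _ _; rewrite mulr0 addr0.
    exists 0%N, 0 => f M _ _; rewrite normr0 mul0r.
    by [].
  move=> f Sf; split; last by rewrite Rintegral_fzero.
  exact: integrable_fzero (measurable_psi_conv r0 Sf).
have zs : psi_conv_signed r (@fzero R _ E) (@fzero R _ E) (fun=> 0).
  by exists (fun=> 0), (fun=> 0); split => // f _; rewrite /dist_sub subrr.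
split.
- exists (dist_scale (gamma r) Q); first by rewrite ps; exact: perturbed_frac_lap.
  by move=> f _; rewrite /dist_scale mulKf.
- by move=> f _; rewrite /dist_sub !subrr.
- split.
  + by exists (fun=> 0) => //; exists (@fzero R _ E), (@fzero R _ E).
  + exact: perturbed_tempered.
  + exact: perturbed_gradient.
  + have mg i : measurable_fun setT (fun x : E => (\row_i (K_conv a omega x ord0 i + partial i q x)) ord0 i).
      by have [] := perturbed_gradient Oq i.
    by move=> i; split; exact: integrable_fzero.
  + by split; exact: ae_fzero.
Qed.

Lemma exterior_condition_independent (Omega : set E) : open Omega ->
  lebesgue R d (~` Omega) != 0%E ->
   ~ (forall (F LF H : dist R d) (g : E -> E)
        (mu nu : {finite_measure set E -> \bar R}),
      ansatz r (gamma r)^-1 Q F LF g mu nu ->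
      frac_lap p%:R F H ->
      eq_on Omega LF Q ->
      exterior_zero Omega H).
Proof.
move=> oO /negP nO C; apply: nO.
pose i0 : 'I_d := Ordinal d0.
have [kappa k0 kE] := iter_lapl_monomial R p i0.
(* Compared below with [q = 0]; for [p = 0] it is the constant 1. *)
pose q1 (x : E) : R := x ord0 i0 ^+ (2 * p).
have Oq1 : OM q1 by apply: OM_exp; exact: OM_coord.
have q10 : iter p.+1 (@lapl R d) q1 = fun=> 0 by rewrite /= kE lapl_cst.
have Oq0 : OM (fun _ : E => 0 : R) by exact: OM_cst.
have q00 := iter_lapl0 R d.
have [h1 rh1 h10] := C _ _ _ _ _ _ (perturbed_ansatz Oq1 q10)
  (frac_lap_natural d0 p (perturbed_tempered Oq1)) (fun _ _ => erefl).
have [h0 rh0 h00] := C _ _ _ _ _ _ (perturbed_ansatz Oq0 (q00 p.+1))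
  (frac_lap_natural d0 p (perturbed_tempered Oq0)) (fun _ _ => erefl).
have [m1 H1] := rh1; have [m0 H0] := rh0.
(* The two distributions [H] differ by [(-Delta)^p q1], the constant [kappa], and so do the
   functions that represent them. *)
have ae : {ae lam, forall x, h1 x - h0 x - kappa = 0}.
  apply: test_eq0.
    by apply: measurable_funB => //; exact: measurable_funB.
  move=> f tf; have Sf := test_schwartz tf.
  have [i1 e1] := H1 f Sf; have [i0' e0] := H0 f Sf.
  have ik := integrable_scale kappa (schwartz_integrable d0 Sf).
  have -> : (fun x => f x * (h1 x - h0 x - kappa)) = fun x => (h1 x * f x - h0 x * f x) - kappa * f x.
    by apply/funext => x; ring.
  have i10 := integrable_sub i1 i0'; split; first exact: integrable_sub.
  rewrite [LHS](RintegralB measurableT i10 ik) [X in X - _](RintegralB measurableT i1 i0') -e1 -e0.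
  rewrite /perturbed_potential !dist_fun_iter_lapl// kE q00 /dist_fun.
  have E (t : R) : \int[lam]_x (t * f x) = t * \int[lam]_x f x.
    by rewrite RintegralZl//; exact: schwartz_integrable.
  by rewrite !E; ring.
(* On the complement of [Omega] both functions are 0 and [kappa] is not, so the complement lies in
   the exceptional null set. *)
have [N [mN N0 sN]] := ae.
have mO : measurable (~` Omega) by apply: measurableC; exact: open_measurable_rV.
apply/eqP/(subset_measure0 mO mN) => // x Ox; apply: sN => /=.
by rewrite h10// h00// subrr sub0r => /eqP; rewrite oppr_eq0 (negbTE k0).
Qed.

End exterior_condition.

Theorem proposition6p5 (R : realType) (d : nat) (gamma : R -> R) (r a : R)
    (omega : {finite_measure set 'rV[R]_d -> \bar R})
    (Psi Q : dist R d) (Omega : set 'rV[R]_d) (p : nat) (s : R) :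
  (0 < d)%N ->
  (forall sigma : R, 0 <= sigma -> sigma < 1 ->
     gamma_const d sigma (gamma sigma)) ->
  0 <= r -> r <= a -> a < 1 ->
  psi_conv a omega Psi ->
  calL_psi r a (gamma r) (gamma a) omega Q ->
  open Omega ->
  0 < s -> s <= 1 -> (d%:R + 1 + r) / 2 = p%:R + s ->
  let c := (gamma r)^-1 in
  (forall (F LF H : dist R d) (g : 'rV[R]_d -> 'rV[R]_d)
      (mu nu : {finite_measure set 'rV[R]_d -> \bar R}),
    ansatz r c Q F LF g mu nu ->
    frac_lap p%:R F H ->
    [/\ exists V, frac_lap s H V,
        forall V, frac_lap s H V ->
          (eq_on Omega LF Q <-> eq_on Omega V (dist_scale c^-1 Q))
      & forall h : 'rV[R]_d -> R,
          eq_on Omega LF Q ->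
          represents h H -> (forall x, ~ Omega x -> h x = 0) ->
          [/\ dirichlet Omega s (dist_scale c^-1 Q) h,
              forall (cls : set ('rV[R]_d -> R))
                  (G : 'rV[R]_d -> 'rV[R]_d -> R) (k : 'rV[R]_d -> R),
                represents_on Omega k (dist_scale c^-1 Q) ->
                green_kernel Omega s G ->
                well_posed Omega s (dist_scale c^-1 Q) cls ->
                green_valid Omega s (dist_scale c^-1 Q) cls G k ->
                cls h ->
                forall x, Omega x ->
                  h x = \int[lebesgue R d]_(y in Omega) (G x y * k y),
              exists U V, [/\ tempered U,
                represents (patch (fun=> 0) Omega h) U & frac_lap s U V],
              forall U V, tempered U ->
                represents (patch (fun=> 0) Omega h) U -> frac_lap s U V ->
                dist_eq (dist_sub Q LF) (dist_sub Q (dist_scale c V))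
            & forall phi : {finite_measure set 'rV[R]_d -> \bar R},
                admissible r phi mzero F g ->
                gauge r Psi phi F ->
                (free_boundary Omega (dist_sub Q LF) g phi <->
                 dist_eq (dist_sub Q LF) (dist_measure phi) /\
                 zero_flux a r omega phi)]]) /\
  (lebesgue R d (~` Omega) != 0%E ->
   ~ (forall (F LF H : dist R d) (g : 'rV[R]_d -> 'rV[R]_d)
        (mu nu : {finite_measure set 'rV[R]_d -> \bar R}),
      ansatz r c Q F LF g mu nu ->
      frac_lap p%:R F H ->
      eq_on Omega LF Q ->
      exterior_zero Omega H)).
Proof.
move=> d0 gammaP r0 ra a1 oPsi QP oO s0 s1 ps c.
split=> [F LF H g mu nu FA FH|nO].
  exact: (dirichlet_ansatz d0 gammaP r0 ra a1 oPsi oO s0 s1 ps FA FH).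
exact: (exterior_condition_independent d0 gammaP r0 ra a1 oPsi QP s0 s1 ps oO nO).
Qed.
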